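(* The principal block of $\mathbb{F}_2 S_5$ and the non-principal block of $\mathbb{F}_2 S_7$ of weight $2$ are Morita equivalent. Moreover, the corresponding blocks of the Schur algebras $S_{\mathbb{F}_2}(5,5)$ and $S_{\mathbb{F}_2}(7,7)$ are Morita equivalent.
   Context: $S_n$ denotes the symmetric group of degree $n$ and $\mathbb{F}_2$ the field with two elements. For a partition $\lambda=(\lambda_1,\dots,\lambda_t)$ of $n$, $M^\lambda=\mathbb{F}_2[S_n/S_\lambda]$ is the permutation module on the cosets of the Young subgroup $S_\lambda=S_{\lambda_1}\times\cdots\times S_{\lambda_t}$. The Young modules $Y^\lambda$ ($\lambda\vdash n$) are the indecomposable direct summands, up to isomorphism, of the modules $M^\mu$, $\mu \vdash n$. They are parametrized by partitions so that $Y^\lambda$ occurs exactly once as a summand of $M^\lambda$ and all summands of $M^\lambda$ have the form $Y^\mu$ with $\mu\ge\lambda$ in the dominance order. The Schur algebra is taken here up to Morita equivalence, as the basic algebra $S_{\mathbb{F}_2}(n,n)=\operatorname{End}_{\mathbb{F}_2S_n}\left(\bigoplus_{\lambda\vdash n}Y^\lambda\right)$. The weight of a block of $\mathbb{F}_2S_n$ is the number of rim $2$-hooks that must be removed from any partition $\lambda$ with $Y^\lambda$ in the block in order to reach its $2$-core. $\mathbb{F}_2S_7$ has exactly two blocks: the principal block (weight $3$, $2$-core $[1]$) and one non-principal block (weight $2$, $2$-core $[2,1]$), whose Young modules are those labelled by $[6,1],[4,3],[4,1^3],[2^3,1],[2,1^5]$. The principal block of $\mathbb{F}_2S_5$ has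 weight $2$ and $2$-core $[1]$, and its Young modules are those labelled by $[5],[3,2],[3,1^2],[2^2,1],[1^5]$. The block of $S_{\mathbb{F}_2}(n,n)$ corresponding to a block $B$ of $\mathbb{F}_2S_n$ is $\operatorname{End}_{\mathbb{F}_2S_n}\left(\bigoplus_{\lambda}Y^\lambda\right)$, where $\lambda$ runs over the partitions of $n$ such that $Y^\lambda$ lies in $B$. *)

(* Defs.v *)
From HB Require Import structures.
From mathcomp Require Import all_boot all_order all_algebra all_fingroup.
From mathcomp Require Import boolp.

Set Implicit Arguments.
Unset Strict Implicit.
Unset Printing Implicit Defensive.

Import GRing.Theory.
Local Open Scope ring_scope.

(* Morita equivalence: an equivalence between the categories of left modules.
   An equivalence of module categories is automatically additive, and over the
   prime field 'F_2 additive functors (and A-linear maps) are automatically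
   'F_2-linear, so rings carry all the structure needed here. *)

Record mod_functor (R S : pzRingType) := ModFunctor {
  fobj :> lmodType R -> lmodType S;
  fmap : forall M N : lmodType R, {linear M -> N} -> {linear fobj M -> fobj N};
  fmap_id : forall M : lmodType R, fmap (idfun : {linear M -> M}) =1 idfun;
  fmap_comp : forall (M N P : lmodType R)
      (g : {linear N -> P}) (f : {linear M -> N}),
    fmap (g \o f : {linear M -> P}) =1 fmap g \o fmap f }.

Definition morita_equivalent (R S : pzRingType) : Prop :=
  exists (F : mod_functor R S) (G : mod_functor S R)
         (eta : forall M : lmodType R, {linear M -> G (F M)})
         (eps : forall N : lmodType S, {linear F (G N) -> N}),
    [/\ forall M, bijective (eta M),
        forall N, bijective (eps N),
        forall (M M' : lmodType R) (f : {linear M -> M'}),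
          eta M' \o f =1 fmap G (fmap F f) \o eta M
      & forall (N N' : lmodType S) (g : {linear N -> N'}),
          eps N' \o fmap F (fmap G g) =1 g \o eps N].

Section Modules.
Variable R : pzRingType.
Implicit Types M N : lmodType R.

Definition mod_iso M N : Prop := exists f : {linear M -> N}, bijective f.

Definition summand_of N M : Prop :=
  exists N' : lmodType R, mod_iso M (N * N')%type.

Definition mod_zero M : Prop := forall m : M, m = 0.

Definition indecomposable M : Prop :=
  ~ mod_zero M /\
  forall N N' : lmodType R,
    mod_iso M (N * N')%type -> mod_zero N \/ mod_zero N'.

(* Multiplicity one; by Krull-Schmidt the choice of complement is immaterial
   for the finite modules considered below. *)
Definition occurs_once N M : Prop :=
  exists N' : lmodType R, mod_iso M (N * N')%type /\ ~ summand_of N N'.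

End Modules.

Section DirectSum.
Variables (R : pzRingType) (I : finType) (V : I -> lmodType R).

Definition dirsum := {dffun forall i : I, V i}.
HB.instance Definition _ := Choice.on dirsum.
Implicit Types f g : dirsum.

Definition dirsum_zero : dirsum := [ffun i => 0 : V i].
Definition dirsum_opp f : dirsum := [ffun i => - f i].
Definition dirsum_add f g : dirsum := [ffun i => f i + g i].
Definition dirsum_scale (a : R) f : dirsum := [ffun i => a *: f i].

Fact dirsum_addA : associative dirsum_add.
Proof. by move=> f g h; apply/ffunP=> i; rewrite !ffunE addrA. Qed.
Fact dirsum_addC : commutative dirsum_add.
Proof. by move=> f g; apply/ffunP=> i; rewrite !ffunE addrC. Qed.
Fact dirsum_add0 : left_id dirsum_zero dirsum_add.
Proof. by move=> f; apply/ffunP=> i; rewrite !ffunE add0r. Qed.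
Fact dirsum_addN : left_inverse dirsum_zero dirsum_opp dirsum_add.
Proof. by move=> f; apply/ffunP=> i; rewrite !ffunE addNr. Qed.

HB.instance Definition _ := GRing.isZmodule.Build dirsum
  dirsum_addA dirsum_addC dirsum_add0 dirsum_addN.

Fact dirsum_scaleA a b f :
  dirsum_scale a (dirsum_scale b f) = dirsum_scale (a * b) f.
Proof. by apply/ffunP=> i; rewrite !ffunE scalerA. Qed.
Fact dirsum_scale1 : left_id 1 dirsum_scale.
Proof. by move=> f; apply/ffunP=> i; rewrite !ffunE scale1r. Qed.
Fact dirsum_scaleDr : right_distributive dirsum_scale +%R.
Proof. by move=> a f g; apply/ffunP=> i; rewrite !ffunE scalerDr. Qed.
Fact dirsum_scaleDl f : {morph dirsum_scale^~ f : a b / a + b}.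
Proof. by move=> a b; apply/ffunP=> i; rewrite !ffunE scalerDl. Qed.

HB.instance Definition _ := GRing.Zmodule_isLmodule.Build R dirsum
  dirsum_scaleA dirsum_scale1 dirsum_scaleDr dirsum_scaleDl.

End DirectSum.

Section Endomorphisms.
Variables (R : pzRingType) (M : lmodType R).

Definition endo := {linear M -> M}.
HB.instance Definition _ := gen_eqMixin endo.
HB.instance Definition _ := gen_choiceMixin endo.
Implicit Types f g h : endo.

Definition endo_fun f : M -> M := f.
Definition endo_zero : endo := \0 : {linear M -> M}.
Definition endo_one : endo := idfun : {linear M -> M}.
Definition endo_opp f : endo := (\- endo_fun f)%R : {linear M -> M}.
Definition endo_add f g : endo :=
  (endo_fun f \+ endo_fun g)%R : {linear M -> M}.
Definition endo_mul f g : endo := (endo_fun f \o endo_fun g) : {linear M -> M}.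

End Endomorphisms.

Section EndomorphismRing.
Variables (R : pzRingType) (M : lmodType R).
Implicit Types f g h : endo M.

Lemma endoP f g : endo_fun f =1 endo_fun g -> f = g.
Proof.
case: f g => [f [[f1] [f2]]] [g [[g1] [g2]]] /funext fg.
rewrite /endo_fun /= in fg; subst g.
by rewrite (Prop_irrelevance f1 g1) (Prop_irrelevance f2 g2).
Qed.

Fact endo_addA : associative (@endo_add R M).
Proof. by move=> f g h; apply: endoP => m; apply: addrA. Qed.
Fact endo_addC : commutative (@endo_add R M).
Proof. by move=> f g; apply: endoP => m; apply: addrC. Qed.
Fact endo_add0 : left_id (@endo_zero R M) (@endo_add R M).
Proof. by move=> f; apply: endoP => m; apply: add0r. Qed.
Fact endo_addN : left_inverse (@endo_zero R M) (@endo_opp R M) (@endo_add R M).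
Proof. by move=> f; apply: endoP => m; apply: addNr. Qed.

HB.instance Definition _ := GRing.isZmodule.Build (endo M)
  endo_addA endo_addC endo_add0 endo_addN.

Fact endo_mulA : associative (@endo_mul R M).
Proof. by move=> f g h; apply: endoP. Qed.
Fact endo_mul1l : left_id (@endo_one R M) (@endo_mul R M).
Proof. by move=> f; apply: endoP. Qed.
Fact endo_mul1r : right_id (@endo_one R M) (@endo_mul R M).
Proof. by move=> f; apply: endoP. Qed.
Fact endo_mulDl : left_distributive (@endo_mul R M) +%R.
Proof. by move=> f g h; apply: endoP. Qed.
Fact endo_mulDr : right_distributive (@endo_mul R M) +%R.
Proof. by move=> f g h; apply: endoP => m; apply: (raddfD f). Qed.

HB.instance Definition _ := GRing.Zmodule_isPzRing.Build (endo M)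
  endo_mulA endo_mul1l endo_mul1r endo_mulDl endo_mulDr.

End EndomorphismRing.

Section GroupAlgebra.
Variables (F : fieldType) (gT : finGroupType).

(* [a x] is the coefficient of [x : gT]; the product is convolution. *)
Definition group_algebra := {ffun gT -> F}.
HB.instance Definition _ := GRing.Zmodule.on group_algebra.
Implicit Types a b c : group_algebra.

Definition galg_one : group_algebra := [ffun x => (x == 1%g)%:R].
Definition galg_mul a b : group_algebra :=
  [ffun x => \sum_(y : gT) a y * b (y^-1 * x)%g].

Fact galg_mulA : associative galg_mul.
Proof.
move=> a b c; apply/ffunP=> x; rewrite !ffunE.
under eq_bigr => y _ do rewrite ffunE mulr_sumr.
under [RHS]eq_bigr => z _ do rewrite ffunE mulr_suml.
rewrite [RHS]exchange_big /=; apply: eq_bigr => y _.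
rewrite [RHS](reindex_inj (mulgI y)) /=; apply: eq_bigr => z _.
by rewrite mulKg invMg -!mulgA mulrA.
Qed.
Fact galg_mul1l : left_id galg_one galg_mul.
Proof.
move=> a; apply/ffunP=> x; rewrite ffunE (bigD1 1%g) //= ffunE eqxx mul1r.
rewrite invg1 mul1g big1 ?addr0 // => y /negbTE y1.
by rewrite ffunE y1 mul0r.
Qed.
Fact galg_mul1r : right_id galg_one galg_mul.
Proof.
move=> a; apply/ffunP=> x; rewrite ffunE (bigD1 x) //= ffunE mulVg eqxx mulr1.
rewrite big1 ?addr0 // => y yx; rewrite ffunE.
by rewrite -eq_mulVg1 (negbTE yx) mulr0.
Qed.
Fact galg_mulDl : left_distributive galg_mul +%R.
Proof.
move=> a b c; apply/ffunP=> x; rewrite !ffunE -big_split /=.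
by apply: eq_bigr => y _; rewrite ffunE mulrDl.
Qed.
Fact galg_mulDr : right_distributive galg_mul +%R.
Proof.
move=> a b c; apply/ffunP=> x; rewrite !ffunE -big_split /=.
by apply: eq_bigr => y _; rewrite ffunE mulrDr.
Qed.

HB.instance Definition _ := GRing.Zmodule_isPzRing.Build group_algebra
  galg_mulA galg_mul1l galg_mul1r galg_mulDl galg_mulDr.

End GroupAlgebra.

Section PermutationModule.
Variables (F : fieldType) (gT : finGroupType) (H : {set gT}).

Definition coset_space := {X : {set gT} | X \in lcosets H [set: gT]}.

Fact lcoset_closed (g : gT) (X : coset_space) :
  (g *: val X)%g \in lcosets H [set: gT].
Proof.
case: X => X /= /lcosetsP[x _ ->].
by rewrite -lcosetM; apply/lcosetsP; exists (g * x)%g; rewrite ?inE.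
Qed.

Definition coset_act (g : gT) (X : coset_space) : coset_space :=
  Sub (g *: val X)%g (lcoset_closed g X).

Lemma coset_act1 X : coset_act 1 X = X.
Proof. by apply: val_inj; rewrite /= lcoset1. Qed.

Lemma coset_actM g h X : coset_act (g * h) X = coset_act g (coset_act h X).
Proof. by apply: val_inj; rewrite /= lcosetM. Qed.

(* F[G/H], with [f X] the coefficient of the coset [X]. *)
Definition perm_module := {ffun coset_space -> F}.
HB.instance Definition _ := GRing.Zmodule.on perm_module.
Implicit Types (f : perm_module) (a b : group_algebra F gT).

Definition perm_scale a f : perm_module :=
  [ffun X => \sum_(g : gT) a g * f (coset_act g^-1 X)].

Fact perm_scaleA a b f : perm_scale a (perm_scale b f) = perm_scale (a * b) f.
Proof.
apply/ffunP=> X; rewrite !ffunE.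
under eq_bigr => y _ do rewrite ffunE mulr_sumr.
under [RHS]eq_bigr => z _ do rewrite ffunE mulr_suml.
rewrite [RHS]exchange_big /=; apply: eq_bigr => y _.
rewrite [RHS](reindex_inj (mulgI y)) /=; apply: eq_bigr => z _.
by rewrite mulKg invMg coset_actM mulrA.
Qed.
Fact perm_scale1 : left_id 1 perm_scale.
Proof.
move=> f; apply/ffunP=> X; rewrite ffunE (bigD1 1%g) //= ffunE eqxx mul1r.
rewrite invg1 coset_act1 big1 ?addr0 // => y /negbTE y1.
by rewrite ffunE y1 mul0r.
Qed.
Fact perm_scaleDr : right_distributive perm_scale +%R.
Proof.
move=> a f g; apply/ffunP=> X; rewrite !ffunE -big_split /=.
by apply: eq_bigr => y _; rewrite ffunE mulrDr.
Qed.
Fact perm_scaleDl f : {morph perm_scale^~ f : a b / a + b}.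
Proof.
move=> a b; apply/ffunP=> X; rewrite !ffunE -big_split /=.
by apply: eq_bigr => y _; rewrite ffunE mulrDl.
Qed.

HB.instance Definition _ :=
  GRing.Zmodule_isLmodule.Build (group_algebra F gT) perm_module
    perm_scaleA perm_scale1 perm_scaleDr perm_scaleDl.

End PermutationModule.

Section Blocks.
Variable A : pzRingType.

Definition central_idempotent (e : A) : Prop :=
  e * e = e /\ forall x : A, e * x = x * e.

(* A block is given by its primitive central idempotent. *)
Record block := Block {
  block_idem :> A;
  block_neq0 : block_idem <> 0;
  block_central_idem : central_idempotent block_idem;
  block_primitive : forall e f : A,
    central_idempotent e -> central_idempotent f -> e * f = 0 ->
    block_idem = e + f -> e = 0 \/ f = 0 }.

Definition in_block (B : block) (M : lmodType A) : Prop :=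
  forall m : M, (B : A) *: m = m.

(* The two-sided ideal A e, a ring with identity element e. *)
Definition block_ideal (B : block) : {pred A} :=
  [pred x | block_idem B * x == x].

Fact block_ideal_zmod (B : block) : zmod_closed (block_ideal B).
Proof.
split=> [|x y]; rewrite !inE ?mulr0 // => /eqP Bx /eqP By.
by rewrite mulrBr Bx By.
Qed.
HB.instance Definition _ (B : block) :=
  GRing.isZmodClosed.Build A (block_ideal B) (block_ideal_zmod B).

Section BlockAlgebra.
Variable B : block.

Record block_algebra := BlockElt {
  block_val :> A; block_valP : block_val \in block_ideal B }.

HB.instance Definition _ := [isSub for block_val].
HB.instance Definition _ := [Choice of block_algebra by <:].
HB.instance Definition _ := [SubChoice_isSubZmodule of block_algebra by <:].

Fact block_one_in : block_idem B \in block_ideal B.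
Proof. by rewrite inE (block_central_idem B).1. Qed.
Fact block_mul_in (x y : block_algebra) :
  block_val x * block_val y \in block_ideal B.
Proof. by rewrite inE mulrA (eqP (block_valP x)). Qed.

Definition block_one := BlockElt block_one_in.
Definition block_mul x y := BlockElt (block_mul_in x y).

Fact block_mulA : associative block_mul.
Proof. by move=> x y z; apply: val_inj; apply: mulrA. Qed.
Fact block_mul1l : left_id block_one block_mul.
Proof. by move=> x; apply: val_inj; apply: (eqP (block_valP x)). Qed.
Fact block_mul1r : right_id block_one block_mul.
Proof.
move=> x; apply: val_inj; rewrite /= -(block_central_idem B).2.
exact: (eqP (block_valP x)).
Qed.
Fact block_mulDl : left_distributive block_mul +%R.
Proof. by move=> x y z; apply: val_inj; apply: mulrDl. Qed.
Fact block_mulDr : right_distributive block_mul +%R.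
Proof. by move=> x y z; apply: val_inj; apply: mulrDr. Qed.

HB.instance Definition _ := GRing.Zmodule_isPzRing.Build block_algebra
  block_mulA block_mul1l block_mul1r block_mulDl block_mulDr.

End BlockAlgebra.
End Blocks.

(* F[G/G] is the trivial module. *)
Definition principal_block (F : fieldType) (gT : finGroupType)
    (B : block (group_algebra F gT)) : Prop :=
  in_block B (perm_module F [set: gT]).

Definition is_intpart (s : seq nat) : bool := sorted geq s && (0%N \notin s).

Section IntegerPartitions.
Variable n : nat.

Record intpart := IntPart {
  parts :> seq nat; partsP : is_intpart parts && (sumn parts == n) }.

HB.instance Definition _ := [isSub for parts].
HB.instance Definition _ := [Countable of intpart by <:].

Fact intpart_size (la : intpart) : (size la <= n)%N.
Proof.
case: la => s /= /andP[/andP[_ s0] /eqP <-].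
elim: s s0 => //= x s IHs; rewrite inE negb_or eq_sym -lt0n => /andP[x0 /IHs].
by move=> le_s; rewrite -add1n leq_add.
Qed.

Fact intpart_le (la : intpart) i : i \in parts la -> (i <= n)%N.
Proof.
case: la => s /= /andP[_ /eqP <-].
elim: s => //= x s IHs; rewrite inE => /orP[/eqP->|/IHs]; first exact: leq_addr.
by move/leq_trans; apply; apply: leq_addl.
Qed.

Definition intpart_code (la : intpart) : n.-bseq 'I_n.+1 :=
  insub_bseq n [seq inord i | i <- la].
Definition intpart_decode (t : n.-bseq 'I_n.+1) : option intpart :=
  insub [seq val i | i <- t].

Fact intpart_codeK : pcancel intpart_code intpart_decode.
Proof.
move=> la; rewrite /intpart_decode /intpart_code /insub_bseq.
rewrite insubdK; last by rewrite unfold_in size_map intpart_size.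
rewrite -map_comp (_ : map _ _ = parts la) ?valK //.
by apply: map_id_in => i /intpart_le le_in; rewrite /= inordK.
Qed.


HB.instance Definition _ : isFinite intpart := PCanIsFinite intpart_codeK.

End IntegerPartitions.

Definition dominates (la mu : seq nat) : Prop :=
  forall k, (sumn (take k mu) <= sumn (take k la))%N.

(* [nu] is obtained from [la] by removing a rim 2-hook, i.e. a horizontal
   domino in row i or a vertical domino in rows i and i+1. *)
Definition rim2_removal (la nu : seq nat) : Prop :=
  [/\ is_intpart la, is_intpart nu
    & exists i,
        (nth 0 la i = nth 0 nu i + 2
         /\ forall j, j != i -> nth 0 la j = nth 0 nu j)
     \/ [/\ nth 0 la i = nth 0 nu i + 1,
            nth 0 la i.+1 = nth 0 nu i.+1 + 1,
            nth 0 la i = nth 0 la i.+1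
          & forall j, j != i -> j != i.+1 -> nth 0 la j = nth 0 nu j]]%N.

Inductive weight2 : seq nat -> nat -> Prop :=
| Weight2Core la : (forall nu, ~ rim2_removal la nu) -> weight2 la 0
| Weight2Step la nu w : rim2_removal la nu -> weight2 nu w -> weight2 la w.+1.

Section YoungModules.
Variables (F : fieldType) (n : nat).
Local Notation FSn := (group_algebra F 'S_n).

(* Products in 'S_n compose from left to right; inversion identifies it with
   the opposite convention and preserves the Young subgroups.
   [reshape_index la i] is the row containing i when 0, ..., n-1 are
   distributed consecutively over rows of lengths la_1, la_2, ... *)
Definition young_subgroup (la : intpart n) : {set 'S_n} :=
  [set s : 'S_n |
    [forall i, reshape_index la (s i) == reshape_index la i]].

Definition young_perm_module (la : intpart n) : lmodType FSn :=
  perm_module F (young_subgroup la).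

Definition young_modules (Y : intpart n -> lmodType FSn) : Prop :=
  [/\ forall la, indecomposable (Y la),
      forall la mu, mod_iso (Y la) (Y mu) -> la = mu,
      forall la, occurs_once (Y la) (young_perm_module la)
    & forall la (X : lmodType FSn),
        indecomposable X -> summand_of X (young_perm_module la) ->
        exists2 mu : intpart n, dominates mu la & mod_iso X (Y mu)].

Variables (Y : intpart n -> lmodType FSn) (B : block FSn).

(* [B] has weight [w], for the prime 2. *)
Definition block_weight2 (w : nat) : Prop :=
  forall la : intpart n, in_block B (Y la) -> weight2 la w.

Definition block_index := {la : intpart n | `[< in_block B (Y la) >]}.

Definition schur_block : pzRingType :=
  endo (dirsum (fun i : block_index => Y (val i))).

End YoungModules.

(* Main.v *)
(** The symmetric group of degree 5 is embedded in that of degree 7, S and R are the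
    two group algebras over 'F_2, and K3, K5 are sums of 3-cycles and of 5-cycles.
    Squaring class functions shows that the central idempotents in degrees 5 and 7
    are 0, 1, K3 + K5 and 1 + K3 + K5; so the two blocks have the idempotents
    a = 1 + K3 + K5 in S and b = K3 + K5 in R.

    On e = a b the Jucys-Murphy elements x6 and x7 coincide and have square
    z = 1 + K3, and the transposition t6 of the last two letters satisfies
    t6 x6 = x6 t6 + 1. Hence f = x6 (1 + t6) e is an idempotent commuting with S, the
    divided power of the functor that removes two nodes. The double cosets of the
    small group in the large one give f R f = S f, the map s |-> s f is injective on
    the block of a, and R f R = R b. So M |-> f M is an equivalence between the blocks.

    By Mackey's formula f M is a summand of a Young permutation module if M is;
    conversely an indecomposable Young module in the block of a is a summand of f M
    for some permutation module M, hence f Y for a Young module Y in the block of b.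
    Thus f matches the Young modules of the two blocks, and being full and faithful
    it identifies the endomorphism rings of their direct sums. *)

Require Import Defs.
From HB Require Import structures.
From mathcomp Require Import all_boot all_order all_algebra all_fingroup.
From mathcomp Require Import boolp zify.

Set Implicit Arguments.
Unset Strict Implicit.
Unset Printing Implicit Defensive.
Import GRing.Theory.
Local Open Scope ring_scope.

(** * Corners of rings and Morita equivalence *)

(** The 2-core [2,1] arises from [1] by adding two nodes of the same residue 1; accordingly [x6] and
    [x7] are unipotent on [e], while [x5] is nilpotent on [a]. Removing the two nodes in either
    order yields every image twice, and halving with (1 + [t6])/2 is impossible in characteristic 2.
    On [e], however, [x6] and [t6] have squares [z] and 1 and satisfy t6 x6 + x6 t6 = 1: these are
    the relations of a split Clifford algebra, that is of 2 by 2 matrices, and [f] is an idempotent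
    of rank one there. As [f] commutes with the smaller group algebra, it cuts out one of the two
    copies. Injectivity of s |-> s f is not read off from dimensions: an explicit [t] commuting with
    the smaller algebra is given such that t f truncates to the block idempotent in degree 5. Blocks
    are given by abstract primitive idempotents, hence the list of all central idempotents. In
    degree 7 only relations between sparse elements are multiplied out; the rest is algebra in the
    right ideal [e * R]. *)

Definition linear_of (R : pzRingType) (U V : lmodType R) (f : U -> V)
    (fP : forall a u v, f (a *: u + v) = a *: f u + f v) : {linear U -> V} :=
  HB.pack_for {linear U -> V} f (GRing.isLinear.Build R U V *:%R f fP).

Lemma cancel_linear (R : pzRingType) (U V : lmodType R) (f : {linear U -> V})
    (g : V -> U) : cancel f g -> cancel g f ->
  forall a u v, g (a *: u + v) = a *: g u + g v.
Proof. by move=> fK gK a u v; apply: (can_inj fK); rewrite gK linearP !gK. Qed.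

(* An additive and multiplicative map [theta] need not preserve 1. Every
   [R]-module [M] then yields the [S]-module [theta 1 *: M]. *)
Record corner_morph (R S : pzRingType) := CornerMorph {
  corner_fun :> S -> R;
  corner_add : {morph corner_fun : x y / x + y};
  corner_mul : {morph corner_fun : x y / x * y} }.

Section CornerModule.
Variables (R S : pzRingType) (theta : corner_morph R S) (M : lmodType R).

Definition corner_pred : {pred M} := [pred m | theta 1 *: m == m].

Fact corner_zmod : zmod_closed corner_pred.
Proof.
split=> [|x y]; rewrite !inE ?scaler0 // => /eqP xE /eqP yE.
by rewrite scalerBr xE yE.
Qed.
HB.instance Definition _ := GRing.isZmodClosed.Build M corner_pred corner_zmod.

Record corner := Corner { corner_val : M; corner_valP : corner_val \in corner_pred }.
HB.instance Definition _ := [isSub for corner_val].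
HB.instance Definition _ := [Choice of corner by <:].
HB.instance Definition _ := [SubChoice_isSubZmodule of corner by <:].

Fact corner_scale_in (s : S) (x : corner) : theta s *: corner_val x \in corner_pred.
Proof. by rewrite inE scalerA -corner_mul mul1r. Qed.
Definition corner_scale s x := Corner (corner_scale_in s x).

Fact corner_scaleA a b x : corner_scale a (corner_scale b x) = corner_scale (a * b) x.
Proof. by apply: val_inj; rewrite /= scalerA corner_mul. Qed.
Fact corner_scale1 : left_id 1 corner_scale.
Proof. by move=> x; apply: val_inj; apply/eqP/corner_valP. Qed.
Fact corner_scaleDr : right_distributive corner_scale +%R.
Proof. by move=> a x y; apply: val_inj; rewrite /= scalerDr. Qed.
Fact corner_scaleDl x : {morph corner_scale^~ x : a b / a + b}.
Proof. by move=> a b; apply: val_inj; rewrite /= corner_add scalerDl. Qed.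
HB.instance Definition _ := GRing.Zmodule_isLmodule.Build S corner
  corner_scaleA corner_scale1 corner_scaleDr corner_scaleDl.

Lemma corner_valZ s (x : corner) : corner_val (s *: x) = theta s *: corner_val x.
Proof. by []. Qed.

Lemma corner_valD (x y : corner) : corner_val (x + y) = corner_val x + corner_val y.
Proof. by []. Qed.

Lemma corner_valE (x : corner) : theta 1 *: corner_val x = corner_val x.
Proof. exact/eqP/corner_valP. Qed.

Lemma corner_projP (m : M) : theta 1 *: m \in corner_pred.
Proof. by rewrite inE scalerA -corner_mul mul1r. Qed.
Definition corner_proj m := Corner (corner_projP m).

Lemma corner_valK (x : corner) : corner_proj (corner_val x) = x.
Proof. exact/val_inj/corner_valE. Qed.
End CornerModule.

Section CornerMap.
Variables (R S : pzRingType) (theta : corner_morph R S) (M N : lmodType R).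
Variable g : {linear M -> N}.

Fact corner_map_subproof (x : corner theta M) : g (corner_val x) \in @corner_pred R S theta N.
Proof. by rewrite inE -linearZ corner_valE. Qed.
Definition corner_map_fun x := Corner (corner_map_subproof x).
Fact corner_map_linear a u v :
  corner_map_fun (a *: u + v) = a *: corner_map_fun u + corner_map_fun v.
Proof. by apply: val_inj; rewrite /= linearP. Qed.
Definition corner_map : {linear corner theta M -> corner theta N} :=
  linear_of corner_map_linear.
End CornerMap.

Section CornerEquivalence.
Variables (R S : pzRingType) (theta : corner_morph R S).
Hypothesis theta_inj : injective theta.
Hypothesis theta_onto : forall r, exists s, theta 1 * r * theta 1 = theta s.
Variables (n : nat) (u v : 'I_n -> R).
Hypothesis uv1 : \sum_i u i * theta 1 * v i = 1.

Let f : R := theta 1.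

Fact corner_idem : f * f = f.
Proof. by rewrite /f -corner_mul mul1r. Qed.

(* With [f = theta 1], the columns [v i] and rows [u j] make [R * f] a summand of
   [(f * R * f)^n]; so [R * f] tensored with [N] is realised inside [N^n] as the image
   of the idempotent matrix [coef 1], on which [r] acts as the matrix [coef r]. *)
Definition coef (r : R) i j : S := projT1 (cid (theta_onto (v i * r * u j))).

Lemma coefE r i j : theta (coef r i j) = f * v i * r * u j * f.
Proof. by rewrite /coef; case: cid => s /= <-; rewrite !mulrA. Qed.

Lemma corner_sumr (I : Type) (s : seq I) (P : pred I) (F : I -> S) :
  theta (\sum_(i <- s | P i) F i) = \sum_(i <- s | P i) theta (F i).
Proof.
have theta0 : theta 0 = 0.
  by apply: (addrI (theta 0)); rewrite -corner_add !addr0.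
exact: (big_morph theta (@corner_add _ _ theta) theta0).
Qed.

Lemma coefD r r' i j : coef (r + r') i j = coef r i j + coef r' i j.
Proof. by apply: theta_inj; rewrite corner_add !coefE !(mulrDr, mulrDl). Qed.

(** The relation [uv1] appears between the two factors and collapses, so [coef] is multiplicative
    and [coef 1] is an idempotent matrix. *)
Lemma coefM r r' i k : \sum_j coef r i j * coef r' j k = coef (r * r') i k.
Proof.
apply: theta_inj; rewrite corner_sumr coefE.
under eq_bigr => j _ do rewrite corner_mul !coefE.
transitivity (f * v i * r * (\sum_j u j * f * v j) * r' * u k * f); last first.
  by rewrite uv1 mulr1 !mulrA.
rewrite mulr_sumr !mulr_suml; apply: eq_bigr => j _.
rewrite !mulrA -(mulrA _ f f) corner_idem; congr (_ * _ * _ * _).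
Qed.

Section Induced.
Variable N : lmodType S.

Definition coef_act (r : R) (x : {ffun 'I_n -> N}) : {ffun 'I_n -> N} :=
  [ffun i => \sum_j coef r i j *: x j].

Lemma coef_actM r r' x : coef_act r (coef_act r' x) = coef_act (r * r') x.
Proof.
apply/ffunP => i; rewrite !ffunE.
under eq_bigr => j _ do rewrite ffunE scaler_sumr.
rewrite exchange_big /=; apply: eq_bigr => k _.
by rewrite -coefM scaler_suml; apply: eq_bigr => j _; rewrite scalerA.
Qed.

Lemma coef_actDr r x y : coef_act r (x + y) = coef_act r x + coef_act r y.
Proof.
apply/ffunP => i; rewrite !ffunE -big_split /=.
by apply: eq_bigr => j _; rewrite ffunE scalerDr.
Qed.

Lemma coef_actDl r r' x : coef_act (r + r') x = coef_act r x + coef_act r' x.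
Proof.
apply/ffunP => i; rewrite !ffunE -big_split /=.
by apply: eq_bigr => j _; rewrite coefD scalerDl.
Qed.

Definition induced_pred : {pred {ffun 'I_n -> N}} := [pred x | coef_act 1 x == x].

Fact induced_zmod : zmod_closed induced_pred.
Proof.
have act0 : coef_act 1 0 = 0.
  by apply: (addrI (coef_act 1 0)); rewrite -coef_actDr !addr0.
split=> [|x y]; rewrite !inE ?act0 // => /eqP xE /eqP yE.
rewrite -{2}xE -{2}yE coef_actDr; apply/eqP; congr (_ + _).
by apply: (addrI (coef_act 1 y)); rewrite -coef_actDr !subrr act0.
Qed.
HB.instance Definition _ :=
  GRing.isZmodClosed.Build {ffun 'I_n -> N} induced_pred induced_zmod.

Record induced := Induced {
  induced_val : {ffun 'I_n -> N}; induced_valP : induced_val \in induced_pred }.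
HB.instance Definition _ := [isSub for induced_val].
HB.instance Definition _ := [Choice of induced by <:].
HB.instance Definition _ := [SubChoice_isSubZmodule of induced by <:].

Fact coef_act_in r x : coef_act r x \in induced_pred.
Proof. by rewrite inE coef_actM mul1r. Qed.
Definition induced_scale r (x : induced) := Induced (coef_act_in r (induced_val x)).

Fact induced_scaleA a b x :
  induced_scale a (induced_scale b x) = induced_scale (a * b) x.
Proof. by apply: val_inj; rewrite /= coef_actM. Qed.
Fact induced_scale1 : left_id 1 induced_scale.
Proof. by move=> x; apply: val_inj; apply/eqP/induced_valP. Qed.
Fact induced_scaleDr : right_distributive induced_scale +%R.
Proof. by move=> a x y; apply: val_inj; rewrite /= coef_actDr. Qed.
Fact induced_scaleDl x : {morph induced_scale^~ x : a b / a + b}.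
Proof. by move=> a b; apply: val_inj; rewrite /= coef_actDl. Qed.
HB.instance Definition _ := GRing.Zmodule_isLmodule.Build R induced
  induced_scaleA induced_scale1 induced_scaleDr induced_scaleDl.

Lemma induced_valE (x : induced) : coef_act 1 (induced_val x) = induced_val x.
Proof. exact/eqP/induced_valP. Qed.

Lemma induced_val_sum (x : induced) i :
  induced_val x i = \sum_j coef 1 i j *: induced_val x j.
Proof. by rewrite -{1}induced_valE ffunE. Qed.
End Induced.

Section InducedMap.
Variables (N N' : lmodType S) (g : {linear N -> N'}).

Lemma coef_act_map r (x : {ffun 'I_n -> N}) :
  coef_act r [ffun i => g (x i)] = [ffun i => g (coef_act r x i)].
Proof.
apply/ffunP => i; rewrite !ffunE linear_sum.
by apply: eq_bigr => j _; rewrite ffunE linearZ.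
Qed.

Fact induced_map_subproof (x : induced N) :
  [ffun i => g (induced_val x i)] \in @induced_pred N'.
Proof. by rewrite inE coef_act_map induced_valE. Qed.
Definition induced_map_fun x := Induced (induced_map_subproof x).
Fact induced_map_linear a x y :
  induced_map_fun (a *: x + y) = a *: induced_map_fun x + induced_map_fun y.
Proof.
apply: val_inj; apply/ffunP => i /=.
by rewrite coef_act_map !ffunE linearD.
Qed.
Definition induced_map : {linear induced N -> induced N'} :=
  linear_of induced_map_linear.
End InducedMap.

Definition corner_functor : mod_functor R S.
Proof.
pose F (M : lmodType R) : lmodType S := corner theta M.
pose Fm (M N : lmodType R) (g : {linear M -> N}) : {linear F M -> F N} :=
  corner_map theta g.
by apply: (@ModFunctor R S F Fm) => [M x|M N P g h x]; apply: val_inj.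
Defined.

Definition induced_functor : mod_functor S R.
Proof.
pose F (M : lmodType S) : lmodType R := induced M.
pose Fm (M N : lmodType S) (g : {linear M -> N}) : {linear F M -> F N} :=
  induced_map g.
apply: (@ModFunctor S R F Fm) => [M x|M N P g h x]; apply: val_inj;
  by apply/ffunP => i; rewrite /= !ffunE.
Defined.

Section Unit.
Variable N : lmodType S.

Lemma cornerZ (x : corner theta (induced N)) i :
  \sum_j coef f i j *: induced_val (corner_val x) j = induced_val (corner_val x) i.
Proof.
have /(congr1 (fun y => induced_val y i)) := corner_valE x.
by rewrite /= ffunE.
Qed.


(** [coefr r] is the column of [r * f] in [R * f], with entries f v_i r f read in [S]; the row
    [coefl] has entries f u_i f. *)
Definition coefr r i : S := projT1 (cid (theta_onto (v i * r))).
Definition coefl i : S := projT1 (cid (theta_onto (u i))).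

Lemma coefrE r i : theta (coefr r i) = f * v i * r * f.
Proof. by rewrite /coefr; case: cid => s /= <-; rewrite !mulrA. Qed.

Lemma coeflE i : theta (coefl i) = f * u i * f.
Proof. by rewrite /coefl; case: cid => s /= <-. Qed.

Lemma coef_coefr r r' i : \sum_j coef r i j * coefr r' j = coefr (r * r') i.
Proof.
apply: theta_inj; rewrite corner_sumr coefrE.
under eq_bigr => j _ do rewrite corner_mul coefE coefrE.
transitivity (f * v i * r * (\sum_j u j * f * v j) * r' * f).
  rewrite mulr_sumr !mulr_suml; apply: eq_bigr => j _.
  by rewrite !mulrA -(mulrA _ f f) corner_idem.
by rewrite uv1 mulr1 !mulrA.
Qed.

Lemma coefr_theta r s i : coefr r i * s = coefr (r * theta s) i.
Proof.
apply: theta_inj; rewrite corner_mul !coefrE -!mulrA; do 3!congr (_ * _).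
by rewrite /f -!corner_mul mul1r mulr1.
Qed.

Definition unit_val r (x : N) : {ffun 'I_n -> N} := [ffun i => coefr r i *: x].

Lemma coef_act_unit r r' x : coef_act r (unit_val r' x) = unit_val (r * r') x.
Proof.
apply/ffunP => i; rewrite !ffunE -coef_coefr scaler_suml.
by apply: eq_bigr => j _; rewrite ffunE scalerA.
Qed.

Fact unit_in1 (x : N) : unit_val 1 x \in @induced_pred N.
Proof. by rewrite inE coef_act_unit mul1r. Qed.

Fact unit_in2 (x : N) : Induced (unit_in1 x) \in @corner_pred R S theta (induced N).
Proof.
rewrite inE; apply/eqP/val_inj => /=; rewrite coef_act_unit mulr1.
apply/ffunP => i; rewrite !ffunE; congr (_ *: _); apply: theta_inj.
by rewrite !coefrE mulr1 -!mulrA corner_idem.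
Qed.

Definition unit_fun x : corner theta (induced N) := Corner (unit_in2 x).

Fact unit_linear a x y : unit_fun (a *: x + y) = a *: unit_fun x + unit_fun y.
Proof.
apply/val_inj/val_inj/ffunP => i.
rewrite /= coef_act_unit !ffunE scalerDr scalerA; congr (_ *: _ + _).
by rewrite coefr_theta mul1r mulr1.
Qed.

Definition corner_unit : {linear N -> corner theta (induced N)} :=
  linear_of unit_linear.

Lemma corner_unit_bij : bijective corner_unit.
Proof.
(* Row times column is the sum of the f u_i f v_i f, which is f by [uv1]; column times row is the
   matrix [coef f], the identity on the corner. *)
exists (fun y => \sum_i coefl i *: induced_val (corner_val y) i) => [x|y].
  rewrite /=; under eq_bigr => i _ do rewrite ffunE scalerA.
  rewrite -scaler_suml -[RHS]scale1r; congr (_ *: _); apply: theta_inj.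
  rewrite corner_sumr.
  under eq_bigr => i _ do rewrite corner_mul coeflE coefrE mulr1.
  transitivity (f * (\sum_i u i * f * v i) * f).
    rewrite mulr_sumr mulr_suml; apply: eq_bigr => i _.
    by rewrite !mulrA -(mulrA _ f f) corner_idem.
  by rewrite uv1 mulr1 corner_idem.
apply/val_inj/val_inj/ffunP => i; rewrite /= ffunE -[RHS]cornerZ scaler_sumr.
apply: eq_bigr => j _; rewrite scalerA; congr (_ *: _); apply: theta_inj.
by rewrite corner_mul coefrE coeflE coefE mulr1 !mulrA -(mulrA _ f f) corner_idem.
Qed.
End Unit.

Section Counit.
Variable M : lmodType R.

(** With [induced N] viewed as [R * f] tensored with [N], this is multiplication, sending the tensor
    of r f and m to r f m. *)
Definition counit_fun (x : induced (corner theta M)) : M :=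
  \sum_i u i *: corner_val (induced_val x i).

Fact counit_linear r x y : counit_fun (r *: x + y) = r *: counit_fun x + counit_fun y.
Proof.
rewrite /counit_fun scaler_sumr /=.
under eq_bigr => i _ do rewrite !ffunE corner_valD scalerDr.
rewrite big_split; congr (_ + _) => /=.
have sumE i : corner_val (\sum_j coef r i j *: induced_val x j)
    = \sum_j (f * v i * r * u j) *: corner_val (induced_val x j).
  rewrite (big_morph _ (@corner_valD R S theta M) (erefl _)).
  apply: eq_bigr => j _.
  by rewrite corner_valZ coefE -scalerA /f corner_valE.
under eq_bigr => i _ do rewrite sumE scaler_sumr.
rewrite exchange_big /=; apply: eq_bigr => j _.
under eq_bigr => i _ do rewrite scalerA.
rewrite scalerA -scaler_suml; congr (_ *: _).
rewrite -[RHS]mul1r -uv1 mulr_suml; apply: eq_bigr => i _.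
by rewrite !mulrA.
Qed.

Definition corner_counit : {linear induced (corner theta M) -> M} :=
  linear_of counit_linear.

Definition counit_inv_val (m : M) : {ffun 'I_n -> corner theta M} :=
  [ffun i => corner_proj theta (v i *: m)].

Fact counit_inv_in m : counit_inv_val m \in @induced_pred (corner theta M).
Proof.
rewrite inE; apply/eqP/ffunP => i; rewrite !ffunE; apply: val_inj => /=.
rewrite (big_morph _ (@corner_valD R S theta M) (erefl _)) /=.
under eq_bigr => j _.
  rewrite ffunE /= coefE !scalerA mulr1 -!mulrA (mulrA f f) corner_idem !mulrA.
  over.
rewrite -scaler_suml scalerA; congr (_ *: _).
rewrite -[RHS]mulr1 -uv1 mulr_sumr; apply: eq_bigr => j _.
by rewrite !mulrA.
Qed.

Lemma corner_counit_bij : bijective corner_counit.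
Proof.
exists (fun m => Induced (counit_inv_in m)) => [x|m] /=; last first.
  rewrite /counit_fun /=; under eq_bigr => i _ do rewrite ffunE /= !scalerA.
  by rewrite -scaler_suml uv1 scale1r.
apply/val_inj/ffunP => i; apply: val_inj.
rewrite /= ffunE induced_val_sum (big_morph _ (@corner_valD R S theta M) (erefl _)) /=.
rewrite /counit_fun !scaler_sumr; apply: eq_bigr => j _.
by rewrite coefE mulr1 !scalerA -[RHS]scalerA corner_valE.
Qed.
End Counit.

Theorem corner_morita : morita_equivalent S R.
Proof.
exists induced_functor, corner_functor, corner_unit, corner_counit; split.
- exact: corner_unit_bij.
- exact: corner_counit_bij.
- move=> N N' g x; apply/val_inj/val_inj/ffunP => i /=.
  by rewrite !ffunE linearZ.
- move=> M M' g x; rewrite /= /counit_fun linear_sum.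
  by apply: eq_bigr => i _; rewrite /= ffunE linearZ.
Qed.
End CornerEquivalence.

(** * Retracts and the Krull-Schmidt property *)

Section FixedSubmodule.
Variables (R : pzRingType) (M : lmodType R) (e : {linear M -> M}).

Definition fixed_pred : {pred M} := [pred m | e m == m].
Fact fixed_zmod : zmod_closed fixed_pred.
Proof.
by split=> [|x y]; rewrite !inE ?linear0 // => /eqP xE /eqP yE; rewrite linearB xE yE.
Qed.
HB.instance Definition _ := GRing.isZmodClosed.Build M fixed_pred fixed_zmod.

Record fixed := Fixed { fixed_val : M; fixed_valP : fixed_val \in fixed_pred }.
HB.instance Definition _ := [isSub for fixed_val].
HB.instance Definition _ := [Choice of fixed by <:].
HB.instance Definition _ := [SubChoice_isSubZmodule of fixed by <:].

Fact fixed_scale_in r (x : fixed) : r *: fixed_val x \in fixed_pred.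
Proof. by rewrite inE linearZ /= (eqP (fixed_valP x)). Qed.
Definition fixed_scale r x := Fixed (fixed_scale_in r x).
Fact fixed_scaleA a b x : fixed_scale a (fixed_scale b x) = fixed_scale (a * b) x.
Proof. by apply: val_inj; rewrite /= scalerA. Qed.
Fact fixed_scale1 : left_id 1 fixed_scale.
Proof. by move=> x; apply: val_inj; rewrite /= scale1r. Qed.
Fact fixed_scaleDr : right_distributive fixed_scale +%R.
Proof. by move=> a x y; apply: val_inj; rewrite /= scalerDr. Qed.
Fact fixed_scaleDl x : {morph fixed_scale^~ x : a b / a + b}.
Proof. by move=> a b; apply: val_inj; rewrite /= scalerDl. Qed.
HB.instance Definition _ := GRing.Zmodule_isLmodule.Build R fixed
  fixed_scaleA fixed_scale1 fixed_scaleDr fixed_scaleDl.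

Lemma fixed_valE x : e (fixed_val x) = fixed_val x.
Proof. exact/eqP/fixed_valP. Qed.

Hypothesis e_idem : forall m, e (e m) = e m.
Fact fixed_projP m : e m \in fixed_pred.
Proof. by rewrite inE e_idem. Qed.
Definition fixed_proj m := Fixed (fixed_projP m).
End FixedSubmodule.

Section Retracts.
Variable R : pzRingType.
Implicit Types M N X Z : lmodType R.

(** Retracts compose and pass through functors with no complement to carry along; [summand_retract]
    and [retract_summand] identify them with direct summands. *)
Definition retract Z X : Prop :=
  exists (i : {linear Z -> X}) (p : {linear X -> Z}), cancel i p.

Lemma idem_split M (e : {linear M -> M}) : (forall m, e (e m) = e m) ->
  mod_iso M (fixed e * fixed (idfun \- e)%R)%type.
Proof.
move=> ee; have ee' m : (idfun \- e) ((idfun \- e) m) = (idfun \- e) m.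
  by rewrite /= linearB /= ee subrr subr0.
pose f m : (fixed e * fixed (idfun \- e)%R)%type := (fixed_proj ee m, fixed_proj ee' m).
have fP a u v : f (a *: u + v) = a *: f u + f v.
  apply: injective_projections; apply: val_inj; first exact: (linearP e).
  exact: (linearP (idfun \- e)%R).
exists (linear_of fP).
exists (fun y => fixed_val y.1 + fixed_val y.2) => [m|[y z]] /=.
  by rewrite addrC subrK.
have ez : e (fixed_val z) = 0.
  by rewrite -[LHS](subKr (fixed_val z)); have /= -> := fixed_valE z; rewrite subrr.
apply: injective_projections; apply: val_inj; rewrite /= linearD /= fixed_valE ez addr0 //.
by rewrite addrC addKr.
Qed.

Lemma summand_retract Z X : summand_of Z X -> retract Z X.
Proof.
case=> N [f [g fK gK]].
have gP := cancel_linear fK gK.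
have iP a (u v : Z) : g (a *: u + v, 0) = a *: g (u, 0) + g (v, 0).
  by rewrite -gP; congr (g (_, _)); rewrite /= scaler0 addr0.
have pP a (u v : X) : (f (a *: u + v)).1 = a *: (f u).1 + (f v).1 by rewrite linearP.
by exists (linear_of iP), (linear_of pP) => z /=; rewrite gK.
Qed.

Lemma retract_summand Z X : retract Z X -> summand_of Z X.
Proof.
case=> i [p ipK]; pose e : {linear X -> X} := i \o p.
have ee m : e (e m) = e m by rewrite /= ipK.
have [f [g fK gK]] := idem_split ee.
have eV (x : fixed e) : i (p (fixed_val x)) = fixed_val x by apply: (fixed_valE x).
exists (fixed (idfun \- e)%R).
have hP a u v : (p (fixed_val (f (a *: u + v)).1), (f (a *: u + v)).2) =
    a *: (p (fixed_val (f u).1), (f u).2) + (p (fixed_val (f v).1), (f v).2).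
  by apply: injective_projections; rewrite /= linearP //= linearP.
exists (linear_of hP).
have iP z : i z \in fixed_pred e by rewrite inE /= ipK.
exists (fun y => g (Fixed (iP y.1), y.2)) => [x|[z y]] /=.
  rewrite -[RHS]fK [f x]surjective_pairing; congr (g (_, _)).
  by apply: val_inj; rewrite /= eV.
by rewrite gK /= ipK.
Qed.

Lemma retract_trans Y Z X : retract Z Y -> retract Y X -> retract Z X.
Proof.
case=> i [p ipK] [j [q jqK]]; exists (j \o i), (p \o q) => z /=.
by rewrite jqK ipK.
Qed.

Lemma iso_retract Z X : mod_iso Z X -> retract Z X.
Proof.
case=> f [g fK gK]; exists f, (linear_of (cancel_linear fK gK)); exact: fK.
Qed.

Lemma iso_sym Z X : mod_iso Z X -> mod_iso X Z.
Proof.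
by case=> f [g fK gK]; exists (linear_of (cancel_linear fK gK)), f.
Qed.

Lemma iso_trans Y Z X : mod_iso Z Y -> mod_iso Y X -> mod_iso Z X.
Proof. by case=> f fB [g gB]; exists (g \o f); apply: bij_comp. Qed.

Lemma indec_idem M (e : {linear M -> M}) : indecomposable M ->
  (forall m, e (e m) = e m) -> (forall m, e m = 0) \/ (forall m, e m = m).
Proof.
move=> [_ indM] ee; case: (indM _ _ (idem_split ee)) => z; [left|right] => m.
  exact: (congr1 (@fixed_val _ _ _) (z (fixed_proj ee m))).
have mP : m - e m \in fixed_pred (idfun \- e)%R.
  by rewrite inE /= linearB /= ee subrr subr0.
have /= /eqP := congr1 (@fixed_val _ _ _) (z (Fixed mP)).
by rewrite subr_eq0 => /eqP.
Qed.

Lemma idem_indec M : ~ mod_zero M ->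
  (forall e : {linear M -> M}, (forall m, e (e m) = e m) ->
     (forall m, e m = 0) \/ (forall m, e m = m)) -> indecomposable M.
Proof.
move=> nzM idM; split=> // N N' [f [g fK gK]].
have gP := cancel_linear fK gK.
have eP a u v : g ((f (a *: u + v)).1, 0) = a *: g ((f u).1, 0) + g ((f v).1, 0).
  by rewrite -gP linearP; congr (g (_, _)); rewrite /= scaler0 addr0.
case: (idM (linear_of eP)) => [m|z|z] /=; first by rewrite gK.
  left=> n; have /= := z (g (n, 0)); rewrite gK => /(congr1 f).
  by rewrite gK linear0 => -[].
right=> n; have /= := z (g (0, n)); rewrite gK => /(congr1 f).
by rewrite !gK => -[].
Qed.

Lemma retract_indec_iso Z X :
  indecomposable X -> ~ mod_zero Z -> retract Z X -> mod_iso Z X.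
Proof.
move=> indX nzZ [i [p ipK]]; pose e : {linear X -> X} := i \o p.
have ee m : e (e m) = e m by rewrite /= ipK.
case: (indec_idem indX ee) => z.
  case: nzZ => m; have /= := z (i m); rewrite ipK => im0.
  by rewrite -(ipK m) im0 linear0.
by exists i, p.
Qed.

Definition fin_mod M : Prop := exists s : seq M, forall m, m \in s.

Lemma fin_mod_retract Z X : retract Z X -> fin_mod X -> fin_mod Z.
Proof.
case=> i [p ipK] [s sP]; exists (map p s) => z.
by apply/mapP; exists (i z); rewrite ?ipK.
Qed.

(** Finite form of Fitting's lemma: the iterates of [c] are eventually periodic, and an iterate
    whose exponent is a multiple of the period beyond the preperiod is idempotent. *)
Lemma fin_idem_power M (c : {linear M -> M}) : fin_mod M ->
  exists k, forall m, iter k.+1 c (iter k.+1 c m) = iter k.+1 c m.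
Proof.
case=> s sP; pose T := seq_sub s.
pose F k : {ffun T -> T} := [ffun x => SeqSub (sP (iter k c (val x)))].
have [i [j [ij Fij]]] : exists i j : 'I_#|{ffun T -> T}|.+1, i != j /\ F i = F j.
  case: (boolP (injectiveb (fun i : 'I_#|{ffun T -> T}|.+1 => F i))).
    by move/injectiveP/leq_card; rewrite card_ord ltnn.
  by case/injectivePn => i [j ij Fij]; exists i, j.
wlog lt_ij : i j ij Fij / (i < j)%N.
  move=> W; case: (ltngtP i j) => [lt|lt|/val_inj eq_ij].
  - exact: W ij Fij lt.
  - by apply: W (esym Fij) lt; rewrite eq_sym.
  - by rewrite eq_ij eqxx in ij.
have iterE m : iter j c m = iter i c m.
  by have /ffunP/(_ (SeqSub (sP m))) := Fij; rewrite !ffunE => /(congr1 val).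
pose d := (j - i)%N; have d_gt0 : (0 < d)%N by rewrite subn_gt0.
have perd a m : (i <= a)%N -> iter (a + d) c m = iter a c m.
  move=> le_ia; rewrite -(subnK le_ia) -addnA subnKC 1?ltnW // !iterD.
  by rewrite iterE.
have perkd a b m : (i <= a)%N -> iter (a + b * d) c m = iter a c m.
  move=> le_ia; elim: b => [|b IHb]; first by rewrite addn0.
  by rewrite mulSn addnCA addnC perd // (leq_trans le_ia) ?leq_addr.
(* The exponent [i.+1 * d] is a positive multiple of the period [d] and is at least [i]. *)
exists (i.+1 * d).-1 => m; have k_gt0 : (0 < i.+1 * d)%N by rewrite muln_gt0.
rewrite prednK // -iterD perkd //.
by apply: leq_trans (leqnSn i) _; rewrite leq_pmulr.
Qed.

(** Some power of an endomorphism is idempotent, hence 0 or 1 on [M], so each endomorphism is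
    nilpotent or bijective. If [a] is nilpotent, b m = 0 gives a m = m and so m = 0: then [b] is
    injective and cannot be nilpotent. *)
Lemma indec_local M (a b : {linear M -> M}) : fin_mod M -> indecomposable M ->
  (forall m, a m + b m = m) -> bijective a \/ bijective b.
Proof.
move=> finM indM abE.
have iter_linear (c : {linear M -> M}) k :
    exists c' : {linear M -> M}, forall m, c' m = iter k c m.
  elim: k => [|k [c' c'E]]; first by exists idfun.
  by exists (c \o c') => m; rewrite /= c'E.
have nil_or_bij (c : {linear M -> M}) :
    bijective c \/ exists k, forall m, iter k c m = 0.
  have [k kP] := fin_idem_power c finM.
  have [c' c'E] := iter_linear c k.+1.
  case: (@indec_idem _ c' indM) => [m|z|z]; first by rewrite !c'E.
    by right; exists k.+1 => m; rewrite -c'E.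
  left; exists (iter k c) => m; last by rewrite -iterS -c'E.
  by rewrite -iterSr -c'E.
case: (nil_or_bij a) => [|[k ka]]; first by left.
right; case: (nil_or_bij b) => // -[l lb].
have b_inj m : b m = 0 -> m = 0.
  move=> bm; have am : a m = m by rewrite -[RHS]abE bm addr0.
  by rewrite -(ka m); elim: k {ka} => //= k <-.
case: indM.1 => m; elim: l m lb => [|l IHl] m lb; first exact: lb.
by apply: IHl => m'; apply: b_inj; apply: lb.
Qed.

(** An arbitrary bijection [d] takes the place of the identity because, once a summand is dropped,
    the remaining sum is only known to be bijective. *)
Lemma indec_sum_bij M (I : Type) (s : seq I) (c : I -> {linear M -> M})
    (d : {linear M -> M}) : fin_mod M -> indecomposable M ->
  bijective d -> (forall m, \sum_(i <- s) c i m = d m) ->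
  exists i, bijective (c i).
Proof.
move=> finM indM; elim: s d => [|i s IHs] d d_bij cE.
  case: d_bij => d' dK _; case: indM.1 => m.
  have := cE m; rewrite big_nil => dm.
  by rewrite -(dK m) -dm -{1}(linear0 d) dK.
case: (d_bij) => d' dK d'K; pose D := linear_of (cancel_linear dK d'K).
have restP a u v : \sum_(j <- s) c j (a *: u + v) =
    a *: (\sum_(j <- s) c j u) + \sum_(j <- s) c j v.
  by rewrite scaler_sumr -big_split; apply: eq_bigr => j _; rewrite linearP.
pose r := linear_of restP.
case: (@indec_local _ (D \o c i) (D \o r) finM indM) => [m|bij|bij].
- transitivity (D (c i m + r m)); first by rewrite linearD.
  by rewrite /= -[RHS]dK -cE big_cons.
- exists i; apply: (@eq_bij _ _ (d \o (D \o c i))); first exact: bij_comp.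
  by move=> m; rewrite /= d'K.
- apply: (IHs r) => //; apply: (@eq_bij _ _ (d \o (D \o r))); first exact: bij_comp.
  by move=> m; rewrite /= d'K.
Qed.

(** The Krull-Schmidt property in the form used below: the modules [X i] may themselves decompose,
    and their direct sum need not be formed. *)
Lemma retract_sum Z (I : Type) (s : seq I) (X : I -> lmodType R)
    (i_ : forall i, {linear Z -> X i}) (p_ : forall i, {linear X i -> Z}) :
  fin_mod Z -> indecomposable Z -> (forall z, \sum_(i <- s) p_ i (i_ i z) = z) ->
  exists i, retract Z (X i).
Proof.
move=> finZ indZ sumE.
have id_bij : bijective (idfun : {linear Z -> Z}) by exists idfun.
have [i [q qK Kq]] := indec_sum_bij (c := fun i => p_ i \o i_ i) finZ indZ id_bij sumE.
by exists i, (i_ i), (linear_of (cancel_linear qK Kq) \o p_ i) => z; apply: qK.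
Qed.

Lemma retract_prod Z X X' : fin_mod Z -> indecomposable Z ->
  retract Z (X * X')%type -> retract Z X \/ retract Z X'.
Proof.
move=> finZ indZ [i [p ipK]].
pose Y b : lmodType R := if b then X else X'.
have iP (b : bool) : {i_ : {linear Z -> Y b} & {p_ : {linear Y b -> Z} |
    forall z, p_ (i_ z) = p (if b then ((i z).1, 0) else (0, (i z).2))}}.
  case: b => /=.
    have i1 a u v : (i (a *: u + v)).1 = a *: (i u).1 + (i v).1 by rewrite linearP.
    have p1 a u v : p (a *: u + v, 0) = a *: p (u, 0) + p (v, 0).
      by rewrite -linearP; congr (p (_, _)); rewrite /= scaler0 addr0.
    by exists (linear_of i1), (linear_of p1).
  have i2 a u v : (i (a *: u + v)).2 = a *: (i u).2 + (i v).2 by rewrite linearP.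
  have p2 a u v : p (0, a *: u + v) = a *: p (0, u) + p (0, v).
    by rewrite -linearP; congr (p (_, _)); rewrite /= scaler0 addr0.
  by exists (linear_of i2), (linear_of p2).
have [|[] ?] := @retract_sum Z bool [:: true; false] Y (fun b => projT1 (iP b))
  (fun b => sval (projT2 (iP b))) finZ indZ; [|by left|by right].
move=> z; rewrite !big_cons big_nil addr0.
rewrite (svalP (projT2 (iP true))) (svalP (projT2 (iP false))) -linearD.
rewrite -[RHS]ipK; congr (p _); case: (i z) => x y.
by apply: injective_projections; rewrite /= ?addr0 ?add0r.
Qed.
End Retracts.

(** * Retracts and indecomposable modules under the corner functor *)

Lemma retract_corner (R S : pzRingType) (theta : corner_morph R S)
  (M N : lmodType R) : retract M N -> retract (corner theta M) (corner theta N).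
Proof.
case=> i [p ipK]; exists (corner_map theta i), (corner_map theta p) => x.
by apply: val_inj; rewrite /= ipK.
Qed.

Lemma iso_corner (R S : pzRingType) (theta : corner_morph R S)
  (M N : lmodType R) : mod_iso M N -> mod_iso (corner theta M) (corner theta N).
Proof.
case=> f [g fK gK]; pose G := linear_of (cancel_linear fK gK).
by exists (corner_map theta f), (corner_map theta G) => x; apply: val_inj; rewrite /= ?fK ?gK.
Qed.

Lemma corner_prod (R S : pzRingType) (theta : corner_morph R S) (M N : lmodType R) :
  retract (corner theta (M * N)%type) (corner theta M * corner theta N)%type.
Proof.
have iP a u v : (corner_map theta (@fst M N) (a *: u + v),
                 corner_map theta (@snd M N) (a *: u + v)) =
    a *: (corner_map theta (@fst M N) u, corner_map theta (@snd M N) u)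
    + (corner_map theta (@fst M N) v, corner_map theta (@snd M N) v).
  by rewrite !linearP.
have pV (y : (corner theta M * corner theta N)%type) :
    (corner_val y.1, corner_val y.2) \in @corner_pred R S theta (M * N)%type.
  by rewrite inE; apply/eqP; apply: injective_projections; rewrite /= corner_valE.
have pP a u v : Corner (pV (a *: u + v)) = a *: Corner (pV u) + Corner (pV v).
  by apply: val_inj.
exists (linear_of iP), (linear_of pP) => x; apply: val_inj => /=.
by rewrite -surjective_pairing.
Qed.

Section CornerSummands.
Variables (R S : pzRingType) (theta : corner_morph R S).

(** Induction on the number of elements of [M]: if [M] decomposes, its corner decomposes likewise,
    and [Z] is a retract of the corner of one factor. *)
Lemma corner_retract_indec (Z : lmodType S) (M : lmodType R) :
    fin_mod M -> fin_mod Z -> indecomposable Z -> retract Z (corner theta M) ->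
  exists X : lmodType R, [/\ indecomposable X, retract X M & retract Z (corner theta X)].
Proof.
move=> finM finZ indZ.
have [n [s [sP le_sn]]] : exists n (s : seq M), (forall m, m \in s) /\ (size s <= n)%N.
  by case: finM => s sP; exists (size s), s.
elim: n M s sP le_sn {finM} => [|n IHn] M s sP le_sn rZM.
  by have := sP 0; case: s le_sn {sP}.
have [indM|nindM] := pselect (indecomposable M).
  by exists M; split=> //; exists idfun, idfun.
have nzM : ~ mod_zero M.
  move=> zM; case: rZM => i [p ipK]; apply: indZ.1 => z.
  rewrite -(ipK z) (_ : i z = 0) ?linear0 //.
  by apply: val_inj; apply: zM.
have [N [N' [isoM nzN nzN']]] : exists N N' : lmodType R,
    [/\ mod_iso M (N * N')%type, ~ mod_zero N & ~ mod_zero N'].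
  apply: contrapT => H; apply: nindM; split=> // N N' isoM.
  by apply: contrapT => /not_orP[? ?]; apply: H; exists N, N'.
have {rZM} := retract_trans rZM (retract_corner theta (iso_retract isoM)).
move/retract_trans/(_ (corner_prod theta N N'))/(retract_prod finZ indZ) => rZ.
suff [X [indX rX rZX]] : exists X : lmodType R, [/\ indecomposable X,
    retract X (N * N')%type & retract Z (corner theta X)].
  by exists X; split=> //; apply: retract_trans rX (iso_retract (iso_sym isoM)).
have fstP a (u v : N) : (a *: u + v, 0) = a *: (u, 0) + (v, 0) :> (N * N').
  by apply: injective_projections; rewrite /= ?scaler0 ?addr0.
have sndP a (u v : N') : (0, a *: u + v) = a *: (0, u) + (0, v) :> (N * N').
  by apply: injective_projections; rewrite /= ?scaler0 ?addr0.
have rN : retract N (N * N')%type by exists (linear_of fstP), (@fst N N').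
have rN' : retract N' (N * N')%type by exists (linear_of sndP), (@snd N N').
case: isoM => f [g fK gK].
(* A nonzero element of the complementary factor fails the filter, so the list exhausting a factor
   is strictly shorter than [s]. *)
have small (T : eqType) (h : M -> T) (P : pred M) m :
    ~~ P m -> (size [seq h x | x <- s & P x] <= n)%N.
  move=> Pm; rewrite size_map -ltnS (leq_trans _ le_sn) // size_filter.
  rewrite -(count_predC P) -addn1 leq_add2l -has_count.
  by apply/hasP; exists m.
case: rZ => rZ.
  have [m' m'0] : exists m, ~ (m : N') = 0 by apply/existsNP.
  have [|||X [indX rX rZX]] := IHn N [seq (f x).1 | x <- s & (f x).2 == 0].
  - by move=> m; apply/mapP; exists (g (m, 0)); rewrite ?mem_filter gK /= ?eqxx ?sP.
  - by apply: (small _ _ _ (g (0, m'))); rewrite gK; apply/negP => /eqP.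
  - exact: rZ.
  by exists X; split=> //; apply: retract_trans rX rN.
have [m' m'0] : exists m, ~ (m : N) = 0 by apply/existsNP.
have [|||X [indX rX rZX]] := IHn N' [seq (f x).2 | x <- s & (f x).1 == 0].
- by move=> m; apply/mapP; exists (g (0, m)); rewrite ?mem_filter gK /= ?eqxx ?sP.
- by apply: (small _ _ _ (g (m', 0))); rewrite gK; apply/negP => /eqP.
- exact: rZ.
by exists X; split=> //; apply: retract_trans rX rN'.
Qed.

Variable e : R.
Hypothesis e_central : central_idempotent e.
Hypothesis e_theta : e * theta 1 = theta 1.
Hypothesis theta_onto : forall r, exists s, theta 1 * r * theta 1 = theta s.
Variables (n : nat) (u v : 'I_n -> R).
Hypothesis uve : \sum_i u i * theta 1 * v i = e.

Definition acts1 (M : lmodType R) : Prop := forall m : M, e *: m = m.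

Lemma e_corner (M : lmodType R) (x : corner theta M) : e *: corner_val x = corner_val x.
Proof. by rewrite -corner_valE scalerA e_theta. Qed.

(** The central idempotent [e] acts as an idempotent endomorphism, thus as 0 or 1, and 0 is excluded
    because [e] fixes the corner. *)
Lemma indec_acts1 (M : lmodType R) :
  indecomposable M -> ~ mod_zero (corner theta M) -> acts1 M.
Proof.
move=> indM nz.
have eP a (x y : M) : e *: (a *: x + y) = a *: (e *: x) + e *: y.
  by rewrite scalerDr !scalerA e_central.2.
have ee m : linear_of eP (linear_of eP m) = linear_of eP m.
  by rewrite /= scalerA e_central.1.
case: (indec_idem indM ee) => // zM; case: nz => x; apply: val_inj.
by rewrite /= -corner_valE -e_theta -scalerA; apply: zM.
Qed.

Lemma acts1_expand (M : lmodType R) (m : M) : acts1 M ->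
  m = \sum_i u i *: corner_val (corner_proj theta (v i *: m)).
Proof.
move=> M1; rewrite -{1}[m]M1 -uve scaler_suml.
by apply: eq_bigr => i _; rewrite /= !scalerA.
Qed.

(** By [acts1_expand] the corner generates [M]. *)
Lemma corner_faithful (M N : lmodType R) (g h : {linear M -> N}) : acts1 M ->
  (forall x : corner theta M, g (corner_val x) = h (corner_val x)) -> g =1 h.
Proof.
move=> M1 gh m; rewrite (acts1_expand m M1) !linear_sum.
by apply: eq_bigr => i _; rewrite [LHS]linearZ [RHS]linearZ gh.
Qed.

(** Linearity forces g m to be the sum of the u_i h(f v_i m). This map is linear because f v_i r f
    is the image of a scalar of [S], which [h] respects: so g(r x) = e r h(x) for x in the corner,
    and the corner generates [M]. *)
Lemma corner_full (M N : lmodType R) (h : {linear corner theta M -> corner theta N}) :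
  acts1 M -> exists g : {linear M -> N}, forall x, g (corner_val x) = corner_val (h x).
Proof.
move=> M1.
pose g (m : M) := \sum_i u i *: corner_val (h (corner_proj theta (v i *: m))).
have gD m m' : g (m + m') = g m + g m'.
  rewrite /g -big_split; apply: eq_bigr => i _ /=.
  have -> : corner_proj theta (v i *: (m + m')) =
      corner_proj theta (v i *: m) + corner_proj theta (v i *: m').
    by apply: val_inj; rewrite /= !scalerDr.
  by rewrite linearD /= scalerDr.
have gcorner r (x : corner theta M) :
    g (r *: corner_val x) = (e * r) *: corner_val (h x).
  rewrite /g -uve mulr_suml scaler_suml; apply: eq_bigr => i _.
  have [s sE] := theta_onto (v i * r).
  have -> : corner_proj theta (v i *: (r *: corner_val x)) = s *: x.
    by apply: val_inj; rewrite /= -sE -[RHS]scalerA corner_valE !scalerA !mulrA.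
  by rewrite linearZ corner_valZ -sE -!scalerA corner_valE !scalerA ?mulrA.
have g_sum (I : Type) (s : seq I) (F : I -> M) : g (\sum_(i <- s) F i) = \sum_(i <- s) g (F i).
  have g0 : g 0 = 0 by apply: (addrI (g 0)); rewrite -gD !addr0.
  exact: (big_morph g gD g0).
have gP r m m' : g (r *: m + m') = r *: g m + g m'.
  rewrite gD; congr (_ + _); rewrite [in LHS](acts1_expand m M1) scaler_sumr g_sum.
  rewrite [in RHS]/g scaler_sumr; apply: eq_bigr => i _; rewrite [r *: (_ *: _)]scalerA gcorner.
  by rewrite e_central.2 -!scalerA e_corner.
by exists (linear_of gP) => x; rewrite /= -[corner_val x]scale1r gcorner mulr1 e_corner.
Qed.

Lemma acts1_zero (M : lmodType R) : acts1 M -> mod_zero (corner theta M) -> mod_zero M.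
Proof.
move=> M1 z m; rewrite (acts1_expand m M1) big1 // => i _.
by rewrite (z (corner_proj theta (v i *: m))) /= scaler0.
Qed.

Lemma indec_corner (M : lmodType R) :
  acts1 M -> indecomposable M -> indecomposable (corner theta M).
Proof.
move=> M1 indM; apply: idem_indec => [|c cc].
  by move/(acts1_zero M1); apply: indM.1.
have [g gE] := corner_full c M1.
have gg : forall m, g (g m) = g m.
  by apply: (corner_faithful (g := g \o g) (h := g)) => // x; rewrite /= !gE cc.
case: (indec_idem indM gg) => gP; [left|right] => x; apply: val_inj;
  by rewrite /= -gE gP.
Qed.

Lemma corner_iso_inj (M N : lmodType R) : acts1 M -> acts1 N ->
  mod_iso (corner theta M) (corner theta N) -> mod_iso M N.
Proof.
move=> M1 N1 [f [f' fK f'K]].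
have [g gE] := corner_full f M1.
have [g' g'E] := corner_full (linear_of (cancel_linear fK f'K)) N1.
exists g, g'.
  by apply: (corner_faithful (g := g' \o g) (h := idfun)) => // x; rewrite /= gE g'E /= fK.
by apply: (corner_faithful (g := g \o g') (h := idfun)) => // x; rewrite /= g'E gE /= f'K.
Qed.

End CornerSummands.

(** * Group algebras and permutation modules *)

Section Monomials.
Variables (F : fieldType) (gT : finGroupType).
Implicit Types (c d : F) (g h : gT) (a b : group_algebra F gT).

Definition gmono c g : group_algebra F gT := [ffun x => if x == g then c else 0].

Lemma gmonoE c g x : gmono c g x = if x == g then c else 0.
Proof. by rewrite ffunE. Qed.

Lemma galg_mulE a b x : (a * b) x = \sum_y a y * b (y^-1 * x)%g.
Proof. by rewrite [a * b]/(galg_mul a b) ffunE. Qed.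

Lemma galg_oneE x : (1 : group_algebra F gT) x = (x == 1%g)%:R.
Proof. by rewrite [1]/(galg_one F gT) ffunE. Qed.

Lemma galg_sumE (I : Type) (s : seq I) (P : pred I) (f : I -> group_algebra F gT) x :
  (\sum_(i <- s | P i) f i) x = \sum_(i <- s | P i) f i x.
Proof.
apply: (big_morph (fun a : group_algebra F gT => a x)) => [a b|]; exact: ffunE.
Qed.

Lemma gmonoMl c g a x : (gmono c g * a) x = c * a (g^-1 * x)%g.
Proof.
rewrite galg_mulE (bigD1 g) //= gmonoE eqxx big1 ?addr0 // => y /negbTE yg.
by rewrite gmonoE yg mul0r.
Qed.

Lemma gmonoMr c g a x : (a * gmono c g) x = a (x * g^-1)%g * c.
Proof.
rewrite galg_mulE (bigD1 (x * g^-1)%g) //= gmonoE.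
rewrite invMg invgK -mulgA mulVg mulg1 eqxx big1 ?addr0 // => y yxg.
rewrite gmonoE ifN ?mulr0 //; apply: contraNneq yxg => <-.
by rewrite invMg invgK mulKVg.
Qed.

Lemma gmonoM c d g h : gmono c g * gmono d h = gmono (c * d) (g * h)%g.
Proof.
apply/ffunP => x; rewrite gmonoMl !gmonoE (canF_eq (mulKVg g)).
by rewrite eq_sym; case: eqP; rewrite ?mulr0.
Qed.

Lemma gmono1 : gmono 1 1%g = 1.
Proof. by apply/ffunP => x; rewrite galg_oneE gmonoE; case: eqP. Qed.

Lemma galg_gmono a : a = \sum_g gmono (a g) g.
Proof.
apply/ffunP => x; rewrite galg_sumE (bigD1 x) //= gmonoE eqxx big1 ?addr0 //.
by move=> y yx; rewrite gmonoE eq_sym (negbTE yx).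
Qed.

End Monomials.

Section Embedding.
Variables (F : fieldType) (gT hT : finGroupType) (j : gT -> hT).
Hypothesis jM : {morph j : x y / (x * y)%g}.
Hypothesis j_inj : injective j.

Let j1 : j 1%g = 1%g.
Proof. by apply: (mulgI (j 1%g)); rewrite -jM !mulg1. Qed.

Let jV x : j x^-1%g = (j x)^-1%g.
Proof. by apply: (mulgI (j x)); rewrite -jM !mulgV j1. Qed.

Definition galg_map_fun (a : group_algebra F gT) : group_algebra F hT :=
  [ffun h => \sum_(g | j g == h) a g].

Fact galg_map_add : {morph galg_map_fun : a b / a + b}.
Proof.
move=> a b; apply/ffunP => h; rewrite !ffunE -big_split /=.
by apply: eq_bigr => g _; rewrite ffunE.
Qed.

Lemma galg_map_sum (f : hT -> F) (a : group_algebra F gT) :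
  \sum_h galg_map_fun a h * f h = \sum_g a g * f (j g).
Proof.
rewrite [RHS](partition_big j predT) //=; apply: eq_bigr => h _.
by rewrite ffunE mulr_suml; apply: eq_bigr => g /eqP ->.
Qed.

Fact galg_map_mul : {morph galg_map_fun : a b / a * b}.
Proof.
move=> a b; apply/ffunP => h; rewrite galg_mulE galg_map_sum ffunE.
under eq_bigr => g _ do rewrite galg_mulE.
rewrite exchange_big /=; apply: eq_bigr => g _.
rewrite ffunE mulr_sumr [LHS](reindex_inj (mulgI g)) /=.
apply: eq_big => [k|k _]; last by rewrite mulKg.
by rewrite jM (canF_eq (mulKg (j g))).
Qed.

Definition galg_map : corner_morph (group_algebra F hT) (group_algebra F gT) :=
  CornerMorph galg_map_add galg_map_mul.

Lemma galg_mapE a h : galg_map a h = \sum_(g | j g == h) a g.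
Proof. exact: ffunE. Qed.

Lemma galg_map_gmono c g : galg_map (gmono c g) = gmono c (j g).
Proof.
apply/ffunP => h; rewrite galg_mapE gmonoE eq_sym; case: eqP => [<-|jgh].
  rewrite (big_pred1 g) => [|k]; last by rewrite (inj_eq j_inj).
  by rewrite gmonoE eqxx.
by rewrite big1 // => k /eqP jk; rewrite gmonoE; case: eqP => // kg; case: jgh; rewrite -kg.
Qed.

Lemma galg_map1 : galg_map 1 = 1.
Proof. by rewrite -gmono1 galg_map_gmono j1 gmono1. Qed.

(** Truncation to the subgroup, left linear over the smaller algebra by [galg_resM]; it serves as
    the map [rho] of [scopes_idempotent]. *)
Definition galg_res (b : group_algebra F hT) : group_algebra F gT := [ffun g => b (j g)].

Lemma galg_resM a b : galg_res (galg_map a * b) = a * galg_res b.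
Proof.
apply/ffunP => g; rewrite ffunE !galg_mulE galg_map_sum.
by apply: eq_bigr => k _; rewrite ffunE jM jV.
Qed.

(** * Orbits of a subgroup on a coset space *)

Section Orbit.
Variables (K : {set gT}) (H : {set hT}) (Y : coset_space H).
Hypothesis stabY : forall g, (coset_act (j g) Y == Y) = (g \in K).

Let K1 : 1%g \in K.
Proof. by rewrite -stabY j1 coset_act1. Qed.

Definition orbit_pt (C : coset_space K) : coset_space H := coset_act (j (repr (val C))) Y.

Let coset_actI (h : hT) : injective (coset_act (H := H) h).
Proof.
by apply: (can_inj (g := coset_act h^-1)) => X; rewrite -coset_actM mulVg coset_act1.
Qed.

(** [K] is merely a set here, so its cosets are handled as translates of the point [Y] that it
    stabilises. *)
Lemma mem_stab g g' : (coset_act (j g) Y == coset_act (j g') Y) = (g'^-1 * g \in K)%g.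
Proof.
by rewrite -stabY jM jV coset_actM -[RHS](inj_eq (@coset_actI (j g'))) -!coset_actM mulgV mul1g.
Qed.

Lemma mem_coset_space (C : coset_space K) g g' :
  g \in val C -> (g' \in val C) = (g^-1 * g' \in K)%g.
Proof.
case: C => C /= /lcosetsP[x _ ->]; rewrite !mem_lcoset => gK.
rewrite -!mem_stab in gK *; rewrite -(eqP gK).
by rewrite mem_stab.
Qed.

Lemma coset_space_neq0 (C : coset_space K) : repr (val C) \in val C.
Proof.
case: C => C /= /lcosetsP[x _ ->]; apply: (mem_repr x).
by rewrite mem_lcoset mulVg.
Qed.

Lemma orbit_ptE (C : coset_space K) g : g \in val C -> orbit_pt C = coset_act (j g) Y.
Proof.
move=> gC; apply/eqP; rewrite mem_stab -(mem_coset_space _ gC).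
exact: coset_space_neq0.
Qed.

Lemma orbit_pt_act g C : orbit_pt (coset_act g C) = coset_act (j g) (orbit_pt C).
Proof.
rewrite -coset_actM -jM; apply: orbit_ptE.
by rewrite /= mem_lcoset mulKg coset_space_neq0.
Qed.

Lemma orbit_pt_inj : injective orbit_pt.
Proof.
move=> C D; rewrite (orbit_ptE (coset_space_neq0 D)) /orbit_pt => /eqP.
rewrite mem_stab => CD; apply/val_inj/setP => g.
rewrite (mem_coset_space _ (coset_space_neq0 D)).
rewrite (mem_coset_space _ (coset_space_neq0 C)) -!mem_stab.
by rewrite -mem_stab in CD; rewrite (eqP CD).
Qed.

Lemma perm_scaleE (gT' : finGroupType) (L : {set gT'}) a (m : perm_module F L) X :
  (a *: m) X = \sum_g a g * m (coset_act g^-1 X).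
Proof. by rewrite [a *: m]/(perm_scale a m) ffunE. Qed.

(** Since [orbit_pt] is injective, this is extension by zero from the orbit. *)
Definition orbit_push (m : perm_module F K) : perm_module F H :=
  [ffun X => \sum_(C | orbit_pt C == X) m C].
Definition orbit_pull (y : perm_module F H) : perm_module F K :=
  [ffun C => y (orbit_pt C)].

Lemma orbit_pushD m m' : orbit_push (m + m') = orbit_push m + orbit_push m'.
Proof.
apply/ffunP => X; rewrite !ffunE -big_split.
by apply: eq_bigr => C _; rewrite ffunE.
Qed.

Lemma orbit_pushZ a m : orbit_push (a *: m) = galg_map a *: orbit_push m.
Proof.
apply/ffunP => X; rewrite perm_scaleE galg_map_sum ffunE.
under eq_bigr => C _ do rewrite perm_scaleE.
rewrite exchange_big /=; apply: eq_bigr => g _; rewrite ffunE mulr_sumr.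
have actK : cancel (coset_act (H := K) g) (coset_act g^-1).
  by move=> C; rewrite -coset_actM mulVg coset_act1.
rewrite (reindex_inj (can_inj actK)); apply: eq_big => [C|C _]; last by rewrite actK.
rewrite orbit_pt_act -[LHS](inj_eq (@coset_actI (j g)^-1%g)).
by rewrite -coset_actM mulVg coset_act1.
Qed.

Lemma orbit_pullD y y' : orbit_pull (y + y') = orbit_pull y + orbit_pull y'.
Proof. by apply/ffunP => C; rewrite !ffunE. Qed.

Lemma orbit_pullZ a y : orbit_pull (galg_map a *: y) = a *: orbit_pull y.
Proof.
apply/ffunP => C; rewrite perm_scaleE ffunE perm_scaleE galg_map_sum.
by apply: eq_bigr => g _; rewrite ffunE orbit_pt_act jV.
Qed.

Lemma orbit_push_pull y X :
  orbit_push (orbit_pull y) X = if X \in codom orbit_pt then y X else 0.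
Proof.
rewrite ffunE; case: ifP => [/codomP[C ->]|XC].
  rewrite (big_pred1 C) ?ffunE // => D; exact: (inj_eq orbit_pt_inj).
by rewrite big1 // => C /eqP CX; rewrite -CX codom_f in XC.
Qed.

(** Elements outside the image of [j] move every point of the orbit off the orbit, so only the
    coefficients of [b] on the subgroup survive compression to the orbit. *)
Lemma orbit_pull_scale b m :
    (forall h C D, coset_act h (orbit_pt C) = orbit_pt D -> h \in codom j) ->
  orbit_pull (b *: orbit_push m) = galg_res b *: m.
Proof.
move=> codom_j; apply/ffunP => C; rewrite ffunE !perm_scaleE.
rewrite (bigID (fun h => h \in codom j)) /= addrC big1 ?add0r => [|h jh]; last first.
  rewrite ffunE big1 ?mulr0 // => D /eqP DC; case/negP: jh.
  by apply: (codom_j h D C); rewrite DC -coset_actM mulgV coset_act1.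
transitivity (\sum_g b (j g) * orbit_push m (coset_act (j g)^-1 (orbit_pt C))).
  rewrite [RHS](partition_big j (mem (codom j))) => [|g _]; last exact: codom_f.
  apply: eq_bigr => h /codomP[g ->]; rewrite (big_pred1 g) // => k.
  exact: (inj_eq j_inj).
apply: eq_bigr => g _; rewrite -jV -orbit_pt_act; congr (_ * _).
  by rewrite ffunE.
by rewrite ffunE (big_pred1 (coset_act g^-1 C)) // => D; rewrite (inj_eq orbit_pt_inj).
Qed.
End Orbit.
End Embedding.

(** * Embedded symmetric groups and Young subgroups *)

Section SymEmbed.
Variables m k : nat.

Definition sym_embed_fun (s : 'S_m) (i : 'I_(m + k)) : 'I_(m + k) :=
  match split i with inl a => lshift k (s a) | inr b => rshift m b end.

Lemma sym_embed_fun_lshift s a : sym_embed_fun s (lshift k a) = lshift k (s a).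
Proof. by rewrite /sym_embed_fun (unsplitK (inl a)). Qed.

Lemma sym_embed_fun_rshift s b : sym_embed_fun s (rshift m b) = rshift m b.
Proof. by rewrite /sym_embed_fun (unsplitK (inr b)). Qed.

Fact sym_embed_subproof s : injective (sym_embed_fun s).
Proof.
apply: (can_inj (g := sym_embed_fun s^-1)) => i; case: (split_ordP i) => a ->.
  by rewrite !sym_embed_fun_lshift permK.
by rewrite !sym_embed_fun_rshift.
Qed.
Definition sym_embed s : 'S_(m + k) := perm (@sym_embed_subproof s).

Lemma sym_embed_lshift s a : sym_embed s (lshift k a) = lshift k (s a).
Proof. by rewrite permE sym_embed_fun_lshift. Qed.

Lemma sym_embed_rshift s b : sym_embed s (rshift m b) = rshift m b.
Proof. by rewrite permE sym_embed_fun_rshift. Qed.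

Lemma sym_embedM : {morph sym_embed : s t / (s * t)%g}.
Proof.
move=> s t; apply/permP => i; rewrite permM; case: (split_ordP i) => a ->.
  by rewrite !sym_embed_lshift permM.
by rewrite !sym_embed_rshift.
Qed.

Lemma sym_embed_inj : injective sym_embed.
Proof.
move=> s t /permP st; apply/permP => a; have := st (lshift k a).
by rewrite !sym_embed_lshift => /(@lshift_inj _ _).
Qed.

Lemma codom_sym_embed (h : 'S_(m + k)) :
  (forall b, h (rshift m b) = rshift m b) -> h \in codom sym_embed.
Proof.
(* The default [a] is never taken: [h] fixes the last letters, so by injectivity it sends no other
   letter there. *)
move=> hr; pose f (a : 'I_m) : 'I_m := if split (h (lshift k a)) is inl c then c else a.
have fE a : h (lshift k a) = lshift k (f a).
  rewrite /f; case: (split_ordP (h (lshift k a))) => c hc //.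
  by move: hc; rewrite -hr => /perm_inj /eqP; rewrite eq_lrshift.
have f_inj : injective f.
  by move=> a b fab; apply/(@lshift_inj _ k)/(@perm_inj _ h); rewrite !fE fab.
apply/codomP; exists (perm f_inj); apply/permP => i.
case: (split_ordP i) => a ->; last by rewrite hr sym_embed_rshift.
by rewrite sym_embed_lshift permE fE.
Qed.
End SymEmbed.

Lemma reshape_index_cons x s i :
  reshape_index (x :: s) i = if (i < x)%N then 0 else (reshape_index s (i - x)).+1.
Proof.
rewrite /reshape_index /= subn_eq0; case: ltnP => // le_xi.
by rewrite subSn.
Qed.

Lemma reshape_index_catl s t i : (i < sumn s)%N ->
  reshape_index (s ++ t) i = reshape_index s i.
Proof.
elim: s i => [|x s IHs] i //= lt_i; rewrite !reshape_index_cons.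
by case: ltnP => // le_xi; rewrite IHs //; lia.
Qed.

Lemma reshape_index_catr s t i :
  reshape_index (s ++ t) (sumn s + i) = (size s + reshape_index t i)%N.
Proof.
elim: s i => [|x s IHs] i //=; rewrite reshape_index_cons ifN; last by lia.
by rewrite -addnA addKn IHs.
Qed.

Lemma reshape_index_ones k i : (i < k)%N -> reshape_index (nseq k 1%N) i = i.
Proof.
elim: k i => // k IHk [|i] lt_ik //=.
by rewrite reshape_index_cons /= subn1 IHk.
Qed.

(** The fibres of [tau] come in no order, while a partition is weakly decreasing: listing the
    letters fibre by fibre, larger fibres first, gives a permutation that turns fibres into rows. *)
Lemma sort_fibres n (tau : 'I_n -> nat) : exists (nu : intpart n) (a : 'S_n),
  forall i k, (tau (a i) == tau (a k)) = (reshape_index nu i == reshape_index nu k).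
Proof.
pose c := [tuple tau i | i < n].
pose vs := sort (fun v w => count_mem w c <= count_mem v c)%N (undup c).
pose nu := [seq count_mem v c | v <- vs].
have mem_vs v : (v \in vs) = (v \in tval c) by rewrite mem_sort mem_undup.
have uniq_vs : uniq vs by rewrite sort_uniq undup_uniq.
(* [t] lists the values of [tau] in constant blocks; it rearranges [c], and the rearranging
   permutation is the required [a]. *)
pose t := flatten [seq nseq (count_mem v c) v | v <- vs].
have ct : perm_eq t c.
  apply/allP => v _ /=; apply/eqP; rewrite /t count_flatten -map_comp.
  have cnt w : (count_mem v (nseq (count_mem w c) w)) = if w == v then count_mem v c else 0%N.
    by rewrite count_nseq /=; case: eqP => [->|]; rewrite ?mul1n ?mul0n.
  rewrite (eq_map (g := fun w => if w == v then count_mem v c else 0%N) cnt).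
  have [vc|vc] := boolP (v \in tval c); last first.
    rewrite (count_memPn vc); elim: {+}vs => //= w s ->; by case: eqP.
  move: uniq_vs; rewrite -mem_vs in vc; elim: {+}vs vc => //= w s IHs.
  rewrite inE eq_sym; case: eqP => [->|_] /= vs' /andP[ws us]; last by rewrite IHs.
  rewrite -[RHS]addn0; congr addn; elim: s ws {IHs us vs'} => //= x s IHs.
  by rewrite inE negb_or eq_sym => /andP[/negbTE -> /IHs].
have sz_t : size t = n by rewrite (perm_size ct) size_tuple.
have shape_t : shape [seq nseq (count_mem v c) v | v <- vs] = nu.
  by rewrite /shape -map_comp; apply: eq_map => v; rewrite /= size_nseq.
have sum_nu : sumn nu = n by rewrite -shape_t -size_flatten.
have nuP : is_intpart nu && (sumn nu == n).
  rewrite sum_nu eqxx andbT /is_intpart; apply/andP; split.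
    rewrite sorted_map; apply: sort_sorted => v w; exact: leq_total.
  apply/mapP => -[v]; rewrite mem_vs => vc /esym/eqP.
  by rewrite -leqn0 leqNgt -has_count has_pred1 vc.
have [a aE] : exists a : 'S_n, forall i : 'I_n, nth 0%N t i = tau (a i).
  have /tuple_permP[a tE] : perm_eq (Tuple (introT eqP sz_t)) c by [].
  exists a => i; have /= -> := tE.
  by rewrite (nth_map i) ?size_enum_ord // nth_ord_enum tnth_mktuple.
exists (IntPart nuP), a => i k; rewrite -!aE /=.
have nthE (l : 'I_n) : (reshape_index nu l < size vs)%N /\
    nth 0%N t l = nth 0%N vs (reshape_index nu l).
  have lt_l : (reshape_index nu l < size vs)%N.
    by rewrite -(size_map (fun v => count_mem v c)) reshape_indexP // sum_nu.
  split=> //; rewrite /t nth_flatten shape_t (nth_map 0%N) // nth_nseq.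
  case: ifP => // /negP[].
  rewrite -[X in (_ < X)%N](nth_map 0%N 0%N (fun v => count_mem v c)) //.
  by rewrite reshape_offsetP // sum_nu.
have [lt_i ->] := nthE i; have [lt_k ->] := nthE k.
by rewrite nth_uniq.
Qed.

Section YoungCosets.
Variables (n : nat) (la : intpart n).
Let H := young_subgroup la.
Local Notation row := (reshape_index la).

Lemma mem_young_lcoset (g s : 'S_n) :
  (s \in g *: H)%g = [forall i, row (s i) == row (g i)].
Proof.
rewrite mem_lcoset inE; apply/forallP/forallP => sg i.
  by have := sg (g i); rewrite permM permK.
by have := sg (g^-1 i)%g; rewrite permM permKV.
Qed.

Lemma young_lcoset_eq (g h : 'S_n) :
  (g *: H == h *: H)%g = [forall i, row (g i) == row (h i)].
Proof.
apply/eqP/forallP => [gh|gh].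
  by apply/forallP; rewrite -mem_young_lcoset -gh mem_young_lcoset; apply/forallP.
apply/setP => s; rewrite !mem_young_lcoset; apply: eq_forallb => i.
by rewrite (eqP (gh i)).
Qed.
End YoungCosets.

(** * Restriction of Young permutation modules *)

Section YoungRestriction.
Variables (F : fieldType) (m k : nat).
Local Notation emb := (@sym_embed m k).
Let iota := galg_map F (@sym_embedM m k).
Variable la : intpart (m + k).
Let H := young_subgroup la.
Implicit Types X Y : coset_space H.

Definition young_stab (nu : intpart m) Y : Prop :=
  forall g, (coset_act (emb g) Y == Y) = (g \in young_subgroup nu).

Definition sym_orbit X : {set coset_space H} :=
  [set Y | [exists g, coset_act (emb g) X == Y]].

Lemma sym_orbitP X Y : reflect (exists g, coset_act (emb g) X = Y) (Y \in sym_orbit X).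
Proof.
by rewrite inE; apply: (iffP existsP) => [[g /eqP gX]|[g gX]]; exists g => //; apply/eqP.
Qed.

Lemma sym_orbit_eq X Y : Y \in sym_orbit X -> sym_orbit Y = sym_orbit X.
Proof.
case/sym_orbitP => g <-; apply/setP => Z; apply/sym_orbitP/sym_orbitP => -[h <-].
  by exists (h * g)%g; rewrite sym_embedM coset_actM.
exists (h * g^-1)%g; rewrite -coset_actM -sym_embedM.
by rewrite -mulgA mulVg mulg1.
Qed.

(** The stabiliser in 'S_m of the coset of h consists of the permutations that keep i |-> row of
    h(i) on the first m letters; translation by the permutation of [sort_fibres] conjugates it to a
    standard Young subgroup. *)
Lemma young_orbit_rep X : exists nu Y, Y \in sym_orbit X /\ young_stab nu Y.
Proof.
case: X => X0 X0P; have [h _ hE] := lcosetsP X0P.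
pose X : coset_space H := exist _ X0 X0P.
have [nu [a aE]] := sort_fibres (fun i : 'I_m => reshape_index la (h (lshift k i))).
exists nu, (coset_act (emb a) X); split; first by apply/sym_orbitP; exists a.
move=> g; rewrite -coset_actM -val_eqE /= hE -!lcosetM young_lcoset_eq inE.
apply/forallP/forallP => [gE i|gE i].
  have := gE (lshift k i).
  by rewrite !permM !sym_embed_lshift aE.
rewrite !permM; case: (split_ordP i) => b ->; last by rewrite !sym_embed_rshift.
by rewrite !sym_embed_lshift aE.
Qed.

(** The choice depends on [X] only through its orbit, hence is constant on orbits; by
    [young_orbit_rep] the default [X] is never reached. *)
Definition orbit_rep X : coset_space H :=
  odflt X [pick Y in sym_orbit X | `[< exists nu, young_stab nu Y >]].

Lemma orbit_repP X : orbit_rep X \in sym_orbit X /\ exists nu, young_stab nu (orbit_rep X).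
Proof.
rewrite /orbit_rep; case: pickP => [Y /andP[XY /asboolP] //|] /=.
have [nu [Y [XY YP]]] := young_orbit_rep X.
move/(_ Y); rewrite XY /= => /asboolP[]; by exists nu.
Qed.

Lemma orbit_rep_eq X Y : Y \in sym_orbit X -> orbit_rep Y = orbit_rep X.
Proof.
move=> XY; rewrite /orbit_rep (sym_orbit_eq XY); case: pickP => //= none.
have [nu [Z [XZ ZP]]] := young_orbit_rep X.
have := none Z; rewrite XZ /= => /asboolP[]; by exists nu.
Qed.

(* Mackey: restricted to 'S_m, the permutation module splits into the spans of the
   'S_m-orbits of cosets, and the orbit of [Y] is 'S_m modulo a Young subgroup. *)
Lemma orbit_component Y : exists (nu : intpart m)
    (i : {linear corner iota (perm_module F H) -> young_perm_module F nu})
    (p : {linear young_perm_module F nu -> corner iota (perm_module F H)}),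
  forall y X, corner_val (p (i y)) X = if orbit_rep X == Y then corner_val y X else 0.
Proof.
have iota1 : iota 1 = 1 by exact: galg_map1 (@sym_embed_inj m k).
have inRes (y : perm_module F H) : y \in @corner_pred _ _ iota (perm_module F H).
  by rewrite inE iota1 scale1r.
(* A [Y] that is not its own representative represents no orbit, and zero maps serve for it. *)
have [repY|repY] := eqVneq (orbit_rep Y) Y; last first.
  have [_ [nu _]] := orbit_repP Y.
  exists nu, \0, \0 => y X; rewrite /= [LHS]ffunE; case: eqP => // XY.
  case/eqP: repY; rewrite -[in RHS]XY.
  by apply: orbit_rep_eq; have [] := orbit_repP X; rewrite XY.
have [_ [nu]] := orbit_repP Y; rewrite repY => stabY.
pose i (y : corner iota (perm_module F H)) : young_perm_module F nu :=
  orbit_pull emb (young_subgroup nu) Y (corner_val y).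
pose p (y : young_perm_module F nu) : corner iota (perm_module F H) :=
  Corner (inRes (orbit_push emb Y y)).
have iP a u v : i (a *: u + v) = a *: i u + i v.
  by rewrite /i orbit_pullD (orbit_pullZ (@sym_embedM m k) stabY).
have pP a u v : p (a *: u + v) = a *: p u + p v.
  by apply: val_inj; rewrite /= orbit_pushD (orbit_pushZ (@sym_embedM m k) stabY).
exists nu, (linear_of iP), (linear_of pP) => y X /=.
rewrite (orbit_push_pull (@sym_embedM m k) stabY); congr (if _ then _ else _).
apply/codomP/eqP => [[C ->]|XY].
  by rewrite -[RHS]repY; apply: orbit_rep_eq; apply/sym_orbitP; exists (repr (val C)).
have [/sym_orbitP[g gX] _] := orbit_repP X; rewrite XY in gX.
have CP : (g^-1 *: young_subgroup nu)%g \in lcosets (young_subgroup nu) [set: 'S_m].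
  by apply/lcosetsP; exists (g^-1)%g.
pose C0 : coset_space (young_subgroup nu) := exist _ (g^-1 *: young_subgroup nu)%g CP.
exists C0; rewrite (orbit_ptE (@sym_embedM m k) stabY (g := (g^-1)%g)).
  rewrite -gX -coset_actM -sym_embedM mulVg.
  have -> : emb 1 = 1%g by apply: (mulgI (emb 1)); rewrite -sym_embedM !mulg1.
  by rewrite coset_act1.
rewrite /= mem_lcoset mulVg -stabY.
have -> : emb 1 = 1%g by apply: (mulgI (emb 1)); rewrite -sym_embedM !mulg1.
by rewrite coset_act1.
Qed.

Lemma young_restriction (Z : lmodType (group_algebra F 'S_m)) :
    fin_mod Z -> indecomposable Z -> retract Z (corner iota (young_perm_module F la)) ->
  exists nu : intpart m, retract Z (young_perm_module F nu).
Proof.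
move=> finZ indZ [i [p ipK]].
pose M := corner iota (perm_module F H).
have comp Y : {nu : intpart m & {iY : {linear M -> young_perm_module F nu} &
    {pY : {linear young_perm_module F nu -> M} | forall y X,
       corner_val (pY (iY y)) X = if orbit_rep X == Y then corner_val y X else 0}}}.
  by have [nu /cid[iY /cid[pY iYP]]] := cid (orbit_component Y); exists nu, iY, pY.
pose X_ Y := young_perm_module F (projT1 (comp Y)).
pose i_ Y : {linear Z -> X_ Y} := projT1 (projT2 (comp Y)) \o i.
pose p_ Y : {linear X_ Y -> Z} := p \o sval (projT2 (projT2 (comp Y))).
have [z|Y rY] := @retract_sum _ Z _ (enum {: coset_space H}) X_ i_ p_ finZ indZ; last first.
  by exists (projT1 (comp Y)).
rewrite -[RHS]ipK -(linear_sum p); congr (p _); apply/val_inj/ffunP => X.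
have corner_sum (s : seq (coset_space H)) (f : coset_space H -> M) :
    corner_val (\sum_(Y <- s) f Y) X = \sum_(Y <- s) corner_val (f Y) X.
  apply: (big_morph (fun y : M => corner_val y X)) => [y y'|]; exact: ffunE.
rewrite [LHS]corner_sum big_enum /=.
under eq_bigr => Y _ do rewrite (svalP (projT2 (projT2 (comp Y)))).
(* At a coset [X] the one surviving projection is that of its orbit representative. *)
rewrite (bigD1 (orbit_rep X)) //= eqxx big1 ?addr0 // => Y /negbTE.
by rewrite eq_sym => ->.
Qed.
End YoungRestriction.

(** * Induction of Young permutation modules *)

Section YoungInduction.
Variables (F : fieldType) (m k : nat) (mu : intpart m).
Local Notation emb := (@sym_embed m k).

Fact induced_intpart_subproof :
  is_intpart (mu ++ nseq k 1%N) && (sumn (mu ++ nseq k 1%N) == m + k)%N.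
Proof.
have /andP[/andP[mu_sorted mu0] /eqP mu_sum] := partsP mu.
rewrite sumn_cat mu_sum sumn_nseq mul1n eqxx andbT /is_intpart mem_cat negb_or mu0.
rewrite mem_nseq andbF andbT.
have ge1 : all (fun x => 1 <= x)%N mu.
  by apply/allP => x x_mu; rewrite lt0n; apply: contraNneq mu0 => <-.
elim: (parts mu) mu_sorted ge1 => [|x [|y s] IHs] /=.
- by case: k => // l _ _; elim: l => //= l ->.
- move=> _ /andP[x1 _]; case: k => //= l; rewrite x1 /=.
  by elim: l => //= l ->.
- by case/andP => -> ys /andP[_ ge1]; apply: IHs.
Qed.
(** The Young subgroup of this partition is that of [mu], fixing the last [k] letters, so its
    permutation module is induced from that of [mu]. *)
Definition induced_intpart : intpart (m + k) := IntPart induced_intpart_subproof.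
Let H := young_subgroup induced_intpart.

Lemma row_lshift (i : 'I_m) : reshape_index induced_intpart (lshift k i) = reshape_index mu i.
Proof.
have /andP[_ /eqP mu_sum] := partsP mu.
by rewrite /= reshape_index_catl // mu_sum.
Qed.

Lemma row_rshift (b : 'I_k) : reshape_index induced_intpart (rshift m b) = (size mu + b)%N.
Proof.
have /andP[_ /eqP mu_sum] := partsP mu.
have -> : rshift m b = (sumn mu + b)%N :> nat by rewrite mu_sum.
by rewrite reshape_index_catr reshape_index_ones.
Qed.

Lemma row_rshift_inj (b : 'I_k) (i : 'I_(m + k)) :
  reshape_index induced_intpart i = reshape_index induced_intpart (rshift m b) ->
  i = rshift m b.
Proof.
rewrite row_rshift; case: (split_ordP i) => c ->.
  rewrite row_lshift => rowc; have /andP[_ /eqP mu_sum] := partsP mu.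
  have : (reshape_index mu c < size mu)%N by rewrite reshape_indexP // mu_sum.
  by rewrite rowc -ltn_subRL subnn.
by rewrite row_rshift => /addnI /val_inj ->.
Qed.

Definition base_coset : coset_space H.
Proof. by exists H; apply/lcosetsP; exists 1%g; rewrite ?inE ?lcoset1. Defined.

Lemma base_coset_stab g :
  (coset_act (emb g) base_coset == base_coset) = (g \in young_subgroup mu).
Proof.
rewrite -val_eqE /= -{2}[H]lcoset1 young_lcoset_eq inE.
apply/forallP/forallP => gE i; last first.
  rewrite perm1; case: (split_ordP i) => b ->; last by rewrite sym_embed_rshift.
  by rewrite sym_embed_lshift !row_lshift.
by have := gE (lshift k i); rewrite perm1 sym_embed_lshift !row_lshift.
Qed.

(** The last letters are alone in their rows and every point of the base orbit keeps them in place,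
    so an [h] taking one such point to another must fix them. *)
Lemma base_coset_codom h (C D : coset_space (young_subgroup mu)) :
  coset_act h (orbit_pt emb base_coset C) = orbit_pt emb base_coset D ->
  h \in codom emb.
Proof.
rewrite /orbit_pt -coset_actM => /(congr1 val) /= /eqP.
rewrite young_lcoset_eq => /forallP hE; apply: codom_sym_embed => b.
have := hE (rshift m b); rewrite permM sym_embed_rshift => /eqP/row_rshift_inj.
by rewrite -[in X in _ = X -> _](sym_embed_rshift (repr (val C)) b) => /perm_inj.
Qed.
End YoungInduction.

(** * Computing in group algebras of symmetric groups *)

(** Permutations in one-line notation, composed from left to right as in 'S_n. *)
Definition pmul (p q : seq nat) : seq nat := [seq nth 0%N q i | i <- p].
Definition pinv (p : seq nat) : seq nat := [seq index i p | i <- iota 0 (size p)].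

Fixpoint lexle (s t : seq nat) : bool :=
  match s, t with
  | x :: s', y :: t' => if x == y then lexle s' t' else (x <= y)%N
  | _, _ => true
  end.

Definition cancel2 : seq (seq nat) -> seq (seq nat) :=
  foldr (fun p s => if s is q :: s' then if p == q then s' else p :: s else [:: p]) [::].
(** Sorting makes equal codes neighbours, so that [cancel2] removes them in pairs; [norm2_sum] uses
    only that sorting permutes the list. *)
Definition norm2 (l : seq (seq nat)) := cancel2 (sort lexle l).

Lemma cancel2_sum (V : zmodType) (w : seq nat -> V) (l : seq (seq nat)) :
  (forall x : V, x + x = 0) -> \sum_(p <- cancel2 l) w p = \sum_(p <- l) w p.
Proof.
move=> V2; elim: l => //= p l IHl; rewrite big_cons -IHl.
case: (cancel2 l) => [|q s]; first by rewrite big_cons !big_nil.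
by case: eqP => [->|_]; rewrite !big_cons // addrA V2 add0r.
Qed.

Lemma norm2_sum (V : zmodType) (w : seq nat -> V) (l : seq (seq nat)) :
  (forall x : V, x + x = 0) -> \sum_(p <- norm2 l) w p = \sum_(p <- l) w p.
Proof. by move=> V2; rewrite cancel2_sum //; apply: perm_big; rewrite perm_sort. Qed.

Lemma mem_norm2 l : {subset norm2 l <= l}.
Proof.
move=> p; rewrite -(mem_sort lexle l) /norm2; elim: (sort lexle l) => //= q s IHs.
rewrite in_cons; case: (cancel2 s) IHs => [|r t] IHs; first by rewrite inE => ->.
case: ifP => _ pt; first by rewrite IHs ?orbT // inE pt orbT.
by move: pt; rewrite in_cons => /orP[->|/IHs ->]; rewrite ?orbT.
Qed.

Section Codes.
Variable n : nat.
Implicit Types (p q : seq nat) (g h : 'S_n).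

Definition is_code p := perm_eq p (iota 0 n).
Definition code g : seq nat := [seq val (g i) | i <- enum 'I_n].
Definition decode p : 'S_n := odflt 1%g [pick g | code g == p].

Lemma nth_code g (i : 'I_n) : nth 0%N (code g) i = g i.
Proof. by rewrite (nth_map i) ?size_enum_ord // nth_ord_enum. Qed.

Lemma size_code g : size (code g) = n.
Proof. by rewrite size_map size_enum_ord. Qed.

Lemma code_inj : injective code.
Proof.
by move=> g h gh; apply/permP => i; apply: val_inj; rewrite /= -!nth_code gh.
Qed.

Lemma codeK : cancel code decode.
Proof.
move=> g; rewrite /decode; case: pickP => [h /eqP /code_inj //|/(_ g)].
by rewrite eqxx.
Qed.

Lemma codeM g h : code (g * h) = pmul (code g) (code h).
Proof.
by rewrite /pmul -map_comp; apply: eq_map => i; rewrite /= permM nth_code.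
Qed.

Lemma code_is_code g : is_code (code g).
Proof.
rewrite /is_code -val_enum_ord /code map_comp perm_map //.
apply: uniq_perm; last 1 first.
- by move=> i; rewrite mem_enum; apply/mapP; exists (g^-1 i)%g; rewrite ?mem_enum ?permKV.
- by rewrite map_inj_uniq ?enum_uniq //; apply: perm_inj.
- exact: enum_uniq.
Qed.

Lemma is_codeP p : is_code p -> {g | p = code g}.
Proof.
move=> pP; apply: cid; have sz_iota : size (iota 0 n) == n by rewrite size_iota.
have /tuple_permP[a pE] : perm_eq p (Tuple sz_iota) by [].
exists a; rewrite pE; apply: eq_map => i /=.
by rewrite (tnth_nth 0%N) nth_iota.
Qed.

Lemma decodeK p : is_code p -> code (decode p) = p.
Proof. by case/is_codeP => g ->; rewrite codeK. Qed.

Lemma decodeM p q : is_code p -> is_code q -> decode (pmul p q) = (decode p * decode q)%g.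
Proof. by move=> /is_codeP[g ->] /is_codeP[h ->]; rewrite -codeM !codeK. Qed.

Lemma is_code_mul p q : is_code p -> is_code q -> is_code (pmul p q).
Proof. by move=> /is_codeP[g ->] /is_codeP[h ->]; rewrite -codeM code_is_code. Qed.

Lemma pinv_code g : pinv (code g) = code g^-1.
Proof.
rewrite /pinv size_code -val_enum_ord -map_comp; apply: eq_map => i /=.
rewrite /code map_comp index_map; last exact: val_inj.
by rewrite -{1}(permKV g i) index_map ?index_enum_ord //; apply: perm_inj.
Qed.

Lemma decodeV p : is_code p -> decode (pinv p) = (decode p)^-1%g.
Proof. by case/is_codeP => g ->; rewrite pinv_code !codeK. Qed.

Lemma is_code_inv p : is_code p -> is_code (pinv p).
Proof. by case/is_codeP => g ->; rewrite pinv_code code_is_code. Qed.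

Definition all_codes := permutations (iota 0 n).

Lemma mem_all_codes p : (p \in all_codes) = is_code p.
Proof. by rewrite mem_permutations. Qed.

Lemma sum_all_codes (V : zmodType) (w : 'S_n -> V) :
  \sum_g w g = \sum_(p <- all_codes) w (decode p).
Proof.
rewrite -(big_map decode predT w) -big_enum; apply: perm_big.
apply: uniq_perm; first exact: enum_uniq.
  rewrite map_inj_in_uniq ?permutations_uniq // => p q.
  by rewrite !mem_all_codes => /decodeK {2}<- /decodeK {2}<- ->.
move=> g; rewrite mem_enum; apply/esym/mapP; exists (code g); rewrite ?codeK //.
by rewrite mem_all_codes code_is_code.
Qed.

Local Notation A := (group_algebra 'F_2 'S_n).

Lemma addxx2 (x : A) : x + x = 0.
Proof.
apply/ffunP => g; rewrite !ffunE; move: (x g) => y.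
by apply/val_inj; case: y => [[|[|]]].
Qed.

Definition ev (l : seq (seq nat)) : A := \sum_(p <- l) gmono 1 (decode p).

Lemma ev_cat l l' : ev (l ++ l') = ev l + ev l'.
Proof. exact: big_cat. Qed.

Lemma ev_norm2 l : ev (norm2 l) = ev l.
Proof. exact: norm2_sum addxx2. Qed.

Definition lmul (l l' : seq (seq nat)) := [seq pmul p q | p <- l, q <- l'].

Lemma ev_lmul l l' : all is_code l -> all is_code l' -> ev (lmul l l') = ev l * ev l'.
Proof.
move=> /allP lP /allP l'P; rewrite /ev big_allpairs_dep mulr_suml.
rewrite big_seq [RHS]big_seq; apply: eq_bigr => p /lP pP; rewrite mulr_sumr.
rewrite big_seq [RHS]big_seq; apply: eq_bigr => q /l'P qP.
by rewrite gmonoM mulr1 decodeM.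
Qed.

(* Identities between elements of the group algebra are decided by multiplying out
   lists of codes, equal codes cancelling in pairs. *)
Inductive gexpr :=
  GLit of seq (seq nat) | GAdd of gexpr & gexpr | GMul of gexpr & gexpr.

Fixpoint den (e : gexpr) : A :=
  match e with
  | GLit l => ev l
  | GAdd a b => den a + den b
  | GMul a b => den a * den b
  end.

(** Cancelling after every product keeps the intermediate lists short. *)
Fixpoint run (e : gexpr) : seq (seq nat) :=
  match e with
  | GLit l => l
  | GAdd a b => run a ++ run b
  | GMul a b => norm2 (lmul (run a) (run b))
  end.

Fixpoint wf (e : gexpr) : bool :=
  match e with
  | GLit l => all is_code l
  | GAdd a b => wf a && wf b
  | GMul a b => wf a && wf b
  end.

Lemma run_code e : wf e -> all is_code (run e).
Proof.
elim: e => //= [a IHa b IHb|a IHa b IHb] /andP[/IHa /allP aP /IHb /allP bP].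
  by apply/allP => p; rewrite mem_cat => /orP[/aP|/bP].
apply/allP => p /mem_norm2 /allpairsP[[q r] [/= /aP qP /bP rP ->]].
exact: is_code_mul.
Qed.

Lemma denE e : wf e -> den e = ev (run e).
Proof.
elim: e => //= a IHa b IHb /andP[wfa wfb]; rewrite IHa // IHb //.
  by rewrite ev_cat.
by rewrite ev_norm2 ev_lmul // run_code.
Qed.

Lemma den_eq e e' : [&& wf e, wf e' & norm2 (run e ++ run e') == [::]] -> den e = den e'.
Proof.
case/and3P => wfe wfe' /eqP ee'; rewrite !denE //.
have := ev_norm2 (run e ++ run e'); rewrite ee' ev_cat /ev big_nil -/(ev _) -/(ev _).
move/esym/(canRL (addrK _)); rewrite sub0r => ->.
by apply: (addrI (ev (run e'))); rewrite addrN addxx2.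
Qed.
End Codes.

Section CodeEmbedding.
Variables m k : nat.
Local Notation emb := (@sym_embed m k).
Let iota2 := galg_map 'F_2 (@sym_embedM m k).
Definition ext (p : seq nat) := p ++ iota m k.

Lemma code_sym_embed s : code (emb s) = ext (code s).
Proof.
have sz : size (ext (code s)) = (m + k)%N by rewrite size_cat size_code size_iota.
have nthE (i : 'I_(m + k)) : nth 0%N (code (emb s)) i = nth 0%N (ext (code s)) i.
  rewrite nth_code nth_cat size_code; case: (split_ordP i) => b ->.
    by rewrite sym_embed_lshift /= nth_code.
  by rewrite sym_embed_rshift /= addKn nth_iota.
apply: (@eq_from_nth _ 0%N) => [|i]; rewrite size_code ?sz // => lt_i.
exact: (nthE (Ordinal lt_i)).
Qed.

Lemma is_code_ext p : is_code m p -> is_code (m + k) (ext p).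
Proof. by case/is_codeP => g ->; rewrite -code_sym_embed code_is_code. Qed.

Lemma decode_ext p : is_code m p -> decode (m + k) (ext p) = emb (decode m p).
Proof. by case/is_codeP => g ->; rewrite -code_sym_embed !codeK. Qed.

Lemma galg_map_ev l : all (is_code m) l -> iota2 (ev m l) = ev (m + k) (map ext l).
Proof.
elim: l => [_|p l IHl /andP[pP lP]].
  rewrite /ev !big_nil; apply: (addrI (iota2 0)); by rewrite -corner_add !addr0.
rewrite map_cons /ev !big_cons corner_add -/(ev _ _) IHl //.
by rewrite galg_map_gmono ?decode_ext //; apply: sym_embed_inj.
Qed.

Lemma galg_res_gmono (h : 'S_(m + k)) :
  galg_res emb (gmono (1 : 'F_2) h) =
  if drop m (code h) == iota m k then gmono 1 (decode m (take m (code h))) else 0.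
Proof.
apply/ffunP => g; rewrite ffunE gmonoE; case: eqP => [gh|gh].
  rewrite -gh code_sym_embed /ext take_cat drop_cat size_code ltnn subnn drop0 take0 cats0.
  by rewrite eqxx codeK gmonoE eqxx.
case: eqP => [dh|_]; last by rewrite ffunE.
have /codomP[g' hE] : h \in codom emb.
  apply: codom_sym_embed => b; apply: val_inj; rewrite /= -nth_code.
  by rewrite -[code h](cat_take_drop m) dh nth_cat size_takel ?size_code ?leq_addr //=
     ltnNge leq_addr /= addKn nth_iota.
rewrite hE code_sym_embed take_cat size_code ltnn subnn take0 cats0 codeK gmonoE.
by case: eqP gh => // ->; rewrite hE.
Qed.

Definition res_codes l := [seq take m p | p <- l & drop m p == iota m k].

Lemma galg_res_ev l : all (is_code (m + k)) l ->
  galg_res emb (ev (m + k) l) = ev m (res_codes l).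
Proof.
move/allP => lP; rewrite /ev big_map big_filter; apply/ffunP => g.
rewrite ffunE !galg_sumE [RHS]big_mkcond big_seq [RHS]big_seq.
apply: eq_bigr => p /lP pP; have := galg_res_gmono (decode _ p).
move/ffunP/(_ g); rewrite ffunE => ->; rewrite decodeK //.
by case: ifP; rewrite ?ffunE.
Qed.

Lemma commute_embed l :
    all (is_code (m + k)) l &&
    all (fun p => norm2 (lmul [:: ext p] l ++ lmul l [:: ext p]) == [::]) (all_codes m) ->
  forall a, iota2 a * ev (m + k) l = ev (m + k) l * iota2 a.
Proof.
case/andP => lP /allP l_comm a; rewrite [a]galg_gmono.
have iota_sum : iota2 (\sum_g gmono (a g) g) = \sum_g iota2 (gmono (a g) g).
  have iota0 : iota2 0 = 0 by apply: (addrI (iota2 0)); rewrite -corner_add !addr0.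
  exact: (big_morph iota2 (@corner_add _ _ iota2) iota0).
rewrite iota_sum mulr_suml mulr_sumr; apply: eq_bigr => g _.
have [->|->] : a g = 0 \/ a g = 1.
- by case: (a g) => [[|[|]]] // i; [left|right]; apply: val_inj.
- have -> : gmono (0 : 'F_2) g = 0 by apply/ffunP => x; rewrite !ffunE if_same.
  have -> : iota2 0 = 0 by apply: (addrI (iota2 0)); rewrite -corner_add !addr0.
  by rewrite mul0r mulr0.
rewrite galg_map_gmono; last exact: sym_embed_inj.
have /l_comm /eqP lg : code g \in all_codes m by rewrite mem_all_codes code_is_code.
have gE : gmono 1 (emb g) = ev (m + k) [:: ext (code g)].
  by rewrite /ev big_seq1 decode_ext ?code_is_code // codeK.
have gP : all (is_code (m + k)) [:: ext (code g)] by rewrite /= is_code_ext ?code_is_code.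
rewrite gE -!ev_lmul //.
have := ev_norm2 (m + k) (lmul [:: ext (code g)] l ++ lmul l [:: ext (code g)]).
rewrite lg ev_cat {1}/ev big_nil => H; apply: (addIr (ev (m + k) (lmul l [:: ext (code g)]))).
by rewrite -H addxx2.
Qed.
End CodeEmbedding.

(** * Central idempotents *)

(** Comparing the ranks of [y] and [phi y] splits [P] into two halves exchanged by [phi], whose
    equal sums cancel. *)
Lemma sum_involution (V : zmodType) (T : finType) (P : pred T) (f : T -> V) (phi : T -> T) :
    (forall x : V, x + x = 0) -> involutive phi ->
    (forall y, P (phi y) = P y) -> (forall y, f (phi y) = f y) ->
    (forall y, P y -> phi y != y) ->
  \sum_(y | P y) f y = 0.
Proof.
move=> V2 phiK Pphi fphi phi_neq.
rewrite (bigID (fun y => enum_rank y < enum_rank (phi y))%N) /=.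
set s := (X in X + _ = 0).
suff -> : \sum_(i | P i && ~~ (enum_rank i < enum_rank (phi i))%N) f i = s.
  exact: V2.
rewrite (reindex_inj (inv_inj phiK)) /s; apply: eq_big => [y|y _]; last exact: fphi.
rewrite Pphi phiK; case Py: (P y) => //=; rewrite -leqNgt ltn_neqAle.
by rewrite (inj_eq val_inj) (inj_eq enum_rank_inj) eq_sym phi_neq.
Qed.

(* The cycle of [p] through [i], listed from [j] on. *)
Fixpoint cycle_from (fuel : nat) (p : seq nat) (i j : nat) : seq nat :=
  if fuel is f.+1 then
    let k := nth 0%N p j in if k == i then [:: j] else j :: cycle_from f p i k
  else [::].
Definition cycles (p : seq nat) : seq (seq nat) :=
  sort (fun c d => size d <= size c)%N
    [seq c <- [seq cycle_from (size p) p i i | i <- iota 0 (size p)]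
       | all (leq (head 0%N c)) c].
Fixpoint cycle_blocks (o : nat) (ls : seq nat) : seq nat :=
  if ls is l :: ls' then rcons (iota o.+1 l.-1) o ++ cycle_blocks (o + l) ls' else [::].

(* Listing the cycles of [p] one after the other conjugates [p] to the standard
   permutation of its cycle type. *)
Definition conj_to_rep p := flatten (cycles p).
Definition class_rep p := cycle_blocks 0 (map size (cycles p)).

Section CentralIdempotents.
Variable n : nat.
Local Notation A := (group_algebra 'F_2 'S_n).

Definition rep_ok p := [&& is_code n (class_rep p), is_code n (conj_to_rep p)
  & pmul (class_rep p) (conj_to_rep p) == pmul (conj_to_rep p) p].

(** The unordered pair of classes in the summand z(p) z(p^-1 k), written as one word of length 2n so
    that [norm2] cancels equal products. *)
Definition square_key k p :=
  let q := class_rep p in let r := class_rep (pmul (pinv p) k) in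
  if lexle q r then q ++ r else r ++ q.

(* The coefficient at [k] of the square of a class function, as a sum of products
   of two values. Conjugation by an involution [c] that centralises [k] permutes
   the summands, so that those outside the centraliser of [c] cancel. *)
Definition square_keys k c :=
  norm2 [seq square_key k p | p <- all_codes n & pmul c p == pmul p c].

Definition square_terms k c := [seq take n q | q <- square_keys k c].

(** If the two halves of each surviving key agree, each surviving product is a square in 'F_2 and
    equals the value itself: the quadratic equation at [k] becomes linear. *)
Definition square_ok k c :=
  [&& is_code n k, is_code n c, pmul c c == iota 0 n, pmul c k == pmul k c
    & all (fun q => take n q == drop n q) (square_keys k c)].

Variable z : A.
Hypothesis z_idem : central_idempotent z.
Let zc p := z (decode n p).

Lemma central_conj (x h : 'S_n) : z (h^-1 * x * h)%g = z x.
Proof.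
have := z_idem.2 (gmono 1 h) => /ffunP /(_ (x * h)%g).
by rewrite gmonoMl gmonoMr mulgK mulr1 mul1r mulgA => ->.
Qed.

Hypothesis reps_ok : all rep_ok (all_codes n).

Lemma value_class_rep p : is_code n p -> zc p = zc (class_rep p).
Proof.
rewrite -mem_all_codes => pP; have /and3P[rP hP /eqP rh] := allP reps_ok _ pP.
rewrite mem_all_codes in pP.
rewrite /zc -(central_conj (decode n (class_rep p)) (decode n (conj_to_rep p))).
by rewrite -mulgA -decodeM // rh decodeM // mulKg.
Qed.

Lemma value_square_terms k c : square_ok k c ->
  zc k = \sum_(r <- square_terms k c) zc r.
Proof.
case/and5P => kP cP /eqP cc /eqP ck /allP diag.
pose w q := zc (take n q) * zc (drop n q).
have F2 (x : 'F_2) : x + x = 0 by case: x => [[|[|]]] // i; apply: val_inj.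
have F2M (x : 'F_2) : x * x = x by case: x => [[|[|]]] // i; apply: val_inj.
have c1 : (decode n c * decode n c)%g = 1%g.
  by apply: code_inj; rewrite codeM decodeK // cc -(codeK 1%g) decodeK ?code_is_code //
    /code -val_enum_ord; apply: eq_map => i; rewrite perm1.
have cV : (decode n c)^-1%g = decode n c by apply/eqP; rewrite eq_invg_mul c1.
have ckG : (decode n c * decode n k = decode n k * decode n c)%g by rewrite -!decodeM // ck.
have decode_eq q r : is_code n q -> is_code n r -> (decode n q == decode n r) = (q == r).
  move=> qP rP; apply/eqP/eqP => [qr|-> //].
  by rewrite -(decodeK qP) -(decodeK rP) qr.
transitivity (\sum_(p <- all_codes n | pmul c p == pmul p c) zc p * zc (pmul (pinv p) k)).
  rewrite /zc -{1}z_idem.1 galg_mulE.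
  rewrite (bigID (fun y => decode n c * y == y * decode n c)%g) /=.
  rewrite [X in _ + X](sum_involution (phi := fun y => (decode n c * y * decode n c)%g)) //.
  - rewrite addr0 big_mkcond sum_all_codes [RHS]big_mkcond /= big_seq [RHS]big_seq.
    apply: eq_bigr => p; rewrite mem_all_codes => pP.
    rewrite -!decodeM // -decodeV // -decodeM ?is_code_inv //.
    by rewrite decode_eq ?is_code_mul.
  - by move=> y; rewrite -!mulgA c1 mulg1 !mulgA c1 mul1g.
  - by move=> y; rewrite -!mulgA c1 mulg1 !mulgA c1 mul1g eq_sym.
  - move=> y; congr (_ * _); first by rewrite -{1}cV central_conj.
    rewrite !invMg cV -[in RHS](central_conj _ (decode n c)) cV.
    by rewrite !mulgA -(mulgA _ (decode n k)) -ckG !mulgA.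
  - move=> y; apply: contraNneq => {2}<-.
    by rewrite -!mulgA c1 mulg1.
rewrite -big_filter.
transitivity (\sum_(q <- square_keys k c) w q); last first.
  rewrite big_map big_seq [RHS]big_seq; apply: eq_bigr => q /diag /eqP tq.
  by rewrite /w -tq F2M.
rewrite norm2_sum // big_map big_seq [RHS]big_seq; apply: eq_bigr => p.
rewrite mem_filter mem_all_codes => /andP[_ pP].
have p'P : is_code n (pmul (pinv p) k) by rewrite is_code_mul ?is_code_inv.
have sz q : is_code n q -> size (class_rep q) = n.
  rewrite -mem_all_codes => /(allP reps_ok)/and3P[/perm_size].
  by rewrite size_iota.
rewrite value_class_rep // (value_class_rep p'P) /w /square_key.
by case: ifP => _; rewrite take_cat drop_cat sz // ltnn subnn take0 drop0 cats0 // mulrC.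
Qed.

Variables (zeros zeros' : seq (seq nat * seq nat)) (r3 r5 c5 : seq nat) (P : pred (seq nat)).

(** A certificate solving z * z = z class by class: the values at [zeros] are empty sums, those at
    [zeros'] are sums over [zeros], and the value at [r5] reduces to that at [r3]. Two free values
    remain, at 1 and at [r3], hence four solutions. *)
Definition class_equations :=
  [&& all (fun kc => square_ok kc.1 kc.2 && (square_terms kc.1 kc.2 == [::])) zeros,
      all (fun kc => square_ok kc.1 kc.2 &&
             all (mem (unzip1 zeros)) (square_terms kc.1 kc.2)) zeros',
      square_ok r5 c5,
      [seq r <- square_terms r5 c5 | r \notin unzip1 zeros] == [:: r3],
      ~~ P (iota 0 n)
    & all (fun p => if P p then class_rep p \in [:: r3; r5]
                    else (p == iota 0 n) || (class_rep p \in unzip1 zeros ++ unzip1 zeros'))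
        (all_codes n)].

Lemma ev_filter (Q : pred (seq nat)) g :
  ev n [seq p <- all_codes n | Q p] g = if Q (code g) then 1 else 0.
Proof.
pose w h : 'F_2 := if Q (code h) then gmono 1 h g else 0.
rewrite /ev galg_sumE big_filter big_mkcond (eq_big_seq (fun p => w (decode n p))) => [|p].
  rewrite -(sum_all_codes w) (bigD1 g) //= big1 ?addr0 /w ?gmonoE ?eqxx // => h /negbTE hg.
  by rewrite gmonoE eq_sym hg if_same.
by rewrite mem_all_codes /w => /decodeK ->.
Qed.

Lemma central_idempotent_cases : class_equations ->
  let E := ev n [seq p <- all_codes n | P p] in [\/ z = 0, z = 1, z = E | z = 1 + E].
Proof.
case/and5P => /allP zerosP /allP zeros'P r5P /eqP r5E /andP[/negbTE P1 /allP classP] E.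
have z0 k : k \in unzip1 zeros -> zc k = 0.
  case/mapP => -[k' c] /zerosP/andP[/= kP /eqP kE] ->.
  by rewrite (value_square_terms kP) kE big_nil.
have z0' k : k \in unzip1 zeros' -> zc k = 0.
  case/mapP => -[k' c] /zeros'P/andP[/= kP /allP kE] ->.
  by rewrite (value_square_terms kP) big_seq big1 // => r /kE /z0.
have z5 : zc r5 = zc r3.
  rewrite (value_square_terms r5P) (bigID (mem (unzip1 zeros))) /= big1 ?add0r => [|r /z0 //].
  by rewrite -big_filter r5E big_seq1.
have code1 : code (1%g : 'S_n) = iota 0 n.
  by rewrite /code -val_enum_ord; apply: eq_map => i; rewrite perm1.
have zE g : z g = if g == 1%g then z 1%g else if P (code g) then zc r3 else 0.
  case: eqP => [->//|/eqP g1].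
  have gP : code g \in all_codes n by rewrite mem_all_codes code_is_code.
  rewrite -[in LHS](codeK g) -/(zc (code g)) value_class_rep ?code_is_code //.
  have := classP _ gP; case: ifP => _.
    by rewrite !inE => /orP[] /eqP ->.
  rewrite -code1 (inj_eq (@code_inj n)) (negbTE g1) /= mem_cat.
  by case/orP => [/z0|/z0'].
have EE g : E g = if P (code g) then 1 else 0 by rewrite /E ev_filter.
have F2 (x : 'F_2) : x = 0 \/ x = 1.
  by case: x => [[|[|]]] // i; [left|right]; apply: val_inj.
have zg g : z g = z 1%g * (1 : A) g + zc r3 * E g.
  rewrite zE EE galg_oneE; case: eqP => [->|_] /=.
    by rewrite code1 P1 mulr0 addr0 mulr1.
  by rewrite mulr0 add0r; case: ifP => _; rewrite ?mulr1 ?mulr0.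
case: (F2 (z 1%g)) (F2 (zc r3)) zg => -> [] -> zg.
- by apply: Or41; apply/ffunP => g; rewrite zg !mul0r addr0 ffunE.
- by apply: Or43; apply/ffunP => g; rewrite zg mul0r mul1r add0r.
- by apply: Or42; apply/ffunP => g; rewrite zg mul0r mul1r addr0.
- by apply: Or44; apply/ffunP => g; rewrite zg !mul1r [RHS]ffunE.
Qed.
End CentralIdempotents.

(** * Conjugacy classes in degrees 5 and 7 *)

Definition moved (p : seq nat) : nat := count (fun i => nth 0%N p i != i) (iota 0 (size p)).
Definition is_cycle3 p := moved p == 3%N.
(** Moving five letters leaves the cycle types 5 and 3+2; the square of the latter moves only
    three. *)
Definition is_cycle5 p := (moved p == 5%N) && (moved (pmul p p) == 5%N).
Definition cycles3 m := [seq p <- all_codes m | is_cycle3 p].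
Definition cycles5 m := [seq p <- all_codes m | is_cycle5 p].

Definition power_code m p k := iter k (pmul p) (iota 0 m).
Definition rep_of n (ls : seq nat) := cycle_blocks 0 (ls ++ nseq (n - sumn ls) 1%N).
(** The ten classes of even order, each with the involution among the powers of its
    representative. *)
Definition zeros7 := [seq (rep_of 7 kl.1, power_code 7 (rep_of 7 kl.1) kl.2) | kl <-
  [:: ([:: 2], 1); ([:: 2; 2], 1); ([:: 2; 2; 2], 1); ([:: 4], 2); ([:: 4; 2], 2);
      ([:: 4; 3], 6); ([:: 3; 2], 3); ([:: 3; 2; 2], 3); ([:: 5; 2], 5); ([:: 6], 3)]]%N.
(** For type 3+3 the involution interchanges the two cycles. The centraliser of a 7-cycle has odd
    order, so the identity is used and all summands are kept. *)
Definition zeros7' := [::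
  (rep_of 7 [:: 3; 3], [:: 3; 4; 5; 0; 1; 2; 6]); (rep_of 7 [:: 7], iota 0 7)]%N.
Definition zeros5 := [seq (rep_of 5 kl.1, power_code 5 (rep_of 5 kl.1) kl.2) | kl <-
  [:: ([:: 2], 1); ([:: 2; 2], 1); ([:: 4], 2); ([:: 3; 2], 3)]]%N.
Definition is_cycle35 p := is_cycle3 p || is_cycle5 p.

Lemma rep_ok5 : all (rep_ok 5) (all_codes 5). Proof. by vm_compute. Qed.
Lemma rep_ok7 : all (rep_ok 7) (all_codes 7). Proof. by vm_compute. Qed.

Lemma class_equations5 :
  class_equations 5 zeros5 [::] (rep_of 5 [:: 3]) (rep_of 5 [:: 5]) (iota 0 5) is_cycle35.
Proof. by vm_compute. Qed.

(** The representative 5-cycle fixes the letters 5 and 6, and the involution used for it transposes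
    them. *)
Lemma class_equations7 : class_equations 7 zeros7 zeros7'
  (rep_of 7 [:: 3]) (rep_of 7 [:: 5]) [:: 0; 1; 2; 3; 4; 6; 5]%N is_cycle35.
Proof. by vm_compute. Qed.

Definition idem35 n : group_algebra 'F_2 'S_n := ev n (cycles3 n) + ev n (cycles5 n).

Lemma idem35E n : idem35 n = ev n [seq p <- all_codes n | is_cycle35 p].
Proof.
apply/ffunP => g; rewrite [LHS]ffunE !ev_filter /is_cycle35 /is_cycle5 /is_cycle3.
by case: (moved (code g) =P 3%N) => [->|_] /=; rewrite ?addr0 ?add0r.
Qed.

Lemma central_idempotent5 z : central_idempotent z ->
  [\/ z = 0, z = 1, z = idem35 5 | z = 1 + idem35 5].
Proof.
by move=> zP; rewrite idem35E; apply: (central_idempotent_cases zP rep_ok5 class_equations5).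
Qed.

Lemma central_idempotent7 z : central_idempotent z ->
  [\/ z = 0, z = 1, z = idem35 7 | z = 1 + idem35 7].
Proof.
by move=> zP; rewrite idem35E; apply: (central_idempotent_cases zP rep_ok7 class_equations7).
Qed.

Definition augmentation (F : fieldType) (gT : finGroupType) (a : group_algebra F gT) : F :=
  \sum_g a g.

(** The coset space is a single point, so the group algebra acts on it through the augmentation. *)
Lemma principal_augmentation (F : fieldType) (gT : finGroupType)
  (B : block (group_algebra F gT)) : principal_block B <-> augmentation (block_idem B) = 1.
Proof.
have cosetP (X : coset_space [set: gT]) : val X = [set: gT].
  case: X => X /= /lcosetsP[x _ ->]; apply/setP => y.
  by rewrite mem_lcoset !inE.
have coset_eq (X Y : coset_space [set: gT]) : X = Y.
  by apply: val_inj; rewrite !cosetP.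
have scaleE a (m : perm_module F [set: gT]) X : (a *: m) X = augmentation a * m X.
  rewrite perm_scaleE mulr_suml; apply: eq_bigr => g _.
  by rewrite (coset_eq (coset_act _ X) X).
have X0P : [set: gT] \in lcosets [set: gT] [set: gT].
  apply/lcosetsP; exists 1%g; rewrite ?inE // lcoset1 //.
pose X0 : coset_space [set: gT] := exist _ [set: gT] X0P.
split=> [prB|augB].
  have /ffunP/(_ X0) := prB [ffun=> 1].
  by rewrite scaleE ffunE mulr1.
by move=> m; apply/ffunP => X; rewrite scaleE augB mul1r.
Qed.

(** * The divided power idempotent *)

Section IdealGenerated.
Variable R : pzRingType.
Implicit Types f r : R.

Definition ideal_of f r : Prop := exists s : seq (R * R), r = \sum_(uv <- s) uv.1 * f * uv.2.

Lemma ideal_ofD f r r' : ideal_of f r -> ideal_of f r' -> ideal_of f (r + r').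
Proof. by case=> s -> [s' ->]; exists (s ++ s'); rewrite big_cat. Qed.

Lemma ideal_ofM f p r q : ideal_of f r -> ideal_of f (p * r * q).
Proof.
case=> s ->; exists [seq (p * uv.1, uv.2 * q) | uv <- s].
rewrite big_map mulr_sumr mulr_suml; apply: eq_bigr => uv _ /=.
by rewrite !mulrA.
Qed.

Lemma ideal_of_refl f : ideal_of f f.
Proof. by exists [:: (1, 1)]; rewrite big_seq1 mul1r mulr1. Qed.

Lemma ideal_of_trans g f r : ideal_of f g -> ideal_of g r -> ideal_of f r.
Proof.
move=> fg [s ->]; elim: s => [|uv s IHs].
  by exists [::]; rewrite !big_nil.
by rewrite big_cons; apply: ideal_ofD IHs; apply: ideal_ofM.
Qed.

Lemma ideal_of_ord f r : ideal_of f r ->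
  exists n (u v : 'I_n -> R), \sum_i u i * f * v i = r.
Proof.
case=> s ->; pose uv (i : 'I_(size s)) := tnth (in_tuple s) i.
exists (size s), (fun i => (uv i).1), (fun i => (uv i).2).
by rewrite [RHS](big_tnth _ _ s).
Qed.
End IdealGenerated.

(* The map [s |-> iota s * f] is then an isomorphism from [S * a] onto [f * R * f]:
   injective, since [rho (t * _)] is a retraction of it, and onto. *)
Record scopes_idempotent (R S : pzRingType) (iota : corner_morph R S) (rho : R -> S)
    (a : S) (b f : R) : Prop := ScopesIdempotent {
  scopes_idemM : f * f = f;
  scopes_comm : forall s, iota s * f = f * iota s;
  scopes_a : iota a * f = f;
  scopes_b : b * f = f;
  scopes_onto : forall r, exists s, f * r * f = iota s * f;
  scopes_ideal : ideal_of f b;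
  scopes_split : exists2 t, (forall s, iota s * t = t * iota s) & rho (t * f) = a }.

(* To be read with [S] and [R] the group algebras of degrees 5 and 7 over 'F_2, and
   [a] and [b] their block idempotents; [x5, x6, x7] are the Jucys-Murphy elements of
   the last three letters, [t4, t5, t6] the last three simple transpositions, and
   [z] is 1 plus the sum of the 3-cycles of degree 5. *)
Section DividedPowers.
Variables (R S : pzRingType) (iota : corner_morph R S).
Hypothesis iota1 : iota 1 = 1.
Hypothesis char2 : forall r : R, r + r = 0.
Variables (a0 z0 y0 t0 : S) (b c t5 t6 x6 x7 : R).
Variables a z x5 t4 : R.
Hypothesis aE : iota a0 = a.
Hypothesis zE : iota z0 = z.
Hypothesis x5E : iota y0 = x5.
Hypothesis t4E : iota t0 = t4.
Variable e : R.
Hypothesis eE : e = a * b.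

Hypothesis bC : forall r, b * r = r * b.
Hypothesis bb : b * b = b.
Hypothesis a0C : forall s, a0 * s = s * a0.
Hypothesis z0C : forall s, z0 * s = s * z0.
Hypothesis aa : a0 * a0 = a0.
Hypothesis zz : z0 * z0 = a0.
Hypothesis x6C : forall s, iota s * x6 = x6 * iota s.
Hypothesis x7C : forall s, iota s * x7 = x7 * iota s.
Hypothesis t6C : forall s, iota s * t6 = t6 * iota s.
Hypothesis x67 : x6 * x7 = x7 * x6.
Hypothesis t66 : t6 * t6 = 1.
Hypothesis t6x6 : t6 * x6 = x7 * t6 + 1.
Hypothesis t5x7 : t5 * x7 = x7 * t5.
Hypothesis x5t5 : x5 * t5 = t5 * x6 + 1.
Hypothesis braid45 : t5 * (t4 * t5) = t4 * (t5 * t4).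
Hypothesis x5_nil : x5 * (x5 * (x5 * a)) = 0.
Hypothesis x6_quad :
  x6 * (x6 * (x6 * (x6 * (x6 * a)))) = z * (x6 * (x6 * (x6 * a))).
Hypothesis x6_unip : a + x6 * (x6 * (x6 * (x6 * a))) = a * c.
Hypothesis x7_unip : x7 * (x7 * (x7 * (x7 * c))) = c.
Hypothesis x67_pow :
  x7 * (x7 * (x7 * (x7 * 1))) + x6 * (x6 * (x6 * (x6 * 1))) = a + b.

Let addr_eq0 (r s : R) : r + s = 0 -> r = s.
Proof. by move=> rs; rewrite -[r]addr0 -(char2 s) addrA rs add0r. Qed.

Let aI s : a * iota s = iota s * a.
Proof. by rewrite -aE -!corner_mul a0C. Qed.

Let ax6 : a * x6 = x6 * a. Proof. by rewrite -aE x6C. Qed.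
Let ax7 : a * x7 = x7 * a. Proof. by rewrite -aE x7C. Qed.
Let at6 : a * t6 = t6 * a. Proof. by rewrite -aE t6C. Qed.
Let zx6 : z * x6 = x6 * z. Proof. by rewrite -zE x6C. Qed.
Let zt6 : z * t6 = t6 * z. Proof. by rewrite -zE t6C. Qed.
Let t4x6 : t4 * x6 = x6 * t4. Proof. by rewrite -t4E x6C. Qed.
Let az : a * a = a. Proof. by rewrite -aE -corner_mul aa. Qed.
Let zza : z * z = a. Proof. by rewrite -zE -aE -corner_mul zz. Qed.

Lemma e_comm r : a * r = r * a -> e * r = r * e.
Proof. by move=> ar; rewrite eE -mulrA bC mulrA ar mulrA. Qed.

Let ex6 : e * x6 = x6 * e. Proof. exact/e_comm/ax6. Qed.
Let ex7 : e * x7 = x7 * e. Proof. exact/e_comm/ax7. Qed.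
Let et6 : e * t6 = t6 * e. Proof. exact/e_comm/at6. Qed.
Let eI s : e * iota s = iota s * e. Proof. exact/e_comm/aI. Qed.

Let ee : e * e = e.
Proof. by rewrite eE mulrA -(mulrA a b) bC mulrA az -mulrA bb. Qed.

Let ae : a * e = e.
Proof. by rewrite eE mulrA az. Qed.

(* The relations below hold on elements [r] of the right ideal [e * R]. *)
Let p6 r := x6 * (x6 * (x6 * (x6 * r))).
Let p7 r := x7 * (x7 * (x7 * (x7 * r))).

(** By [x67_pow] the sum of the two fourth powers is [a + b], which acts on [e * R] as 1 + 1 = 0. *)
Lemma p6_p7 r : e * r = r -> p6 r = p7 r.
Proof.
move=> er; apply: addr_eq0; rewrite addrC.
have -> : p7 r + p6 r = (p7 1 + p6 1) * r.
  by rewrite mulrDl /p6 /p7 !mulr1 -!mulrA.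
rewrite x67_pow -er mulrA mulrDl ae bC eE -mulrA bb.
by rewrite char2 mul0r.
Qed.

Let p6z r : e * r = r -> p6 (x6 * r) = z * (x6 * (x6 * (x6 * r))).
Proof.
move=> er; have := congr1 (fun s => s * (b * r)) x6_quad.
have abr : a * (b * r) = r by rewrite mulrA -eE.
by rewrite -!mulrA abr.
Qed.

Let e6 r : e * r = r -> e * (x6 * r) = x6 * r.
Proof. by move=> er; rewrite mulrA ex6 -mulrA er. Qed.
Let e7 r : e * r = r -> e * (x7 * r) = x7 * r.
Proof. by move=> er; rewrite mulrA ex7 -mulrA er. Qed.
Let et r : e * r = r -> e * (t6 * r) = t6 * r.
Proof. by move=> er; rewrite mulrA et6 -mulrA er. Qed.
Let eiota s r : e * r = r -> e * (iota s * r) = iota s * r.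
Proof. by move=> er; rewrite mulrA eI -mulrA er. Qed.

Let ez r : e * r = r -> e * (z * r) = z * r.
Proof. by move=> er; rewrite -zE eiota. Qed.

Lemma zzr r : e * r = r -> z * (z * r) = r.
Proof. by move=> er; rewrite mulrA zza -er mulrA ae. Qed.

(** Since x6^5 = z x6^3 and z^2 = 1 on [e], x6^4 is idempotent and kills d = r + x6^4 r. By
    [x6_unip] d is a multiple of [c], so x7^4 fixes it; as the fourth powers agree on [e], d = 0. *)
Lemma p6_id r : e * r = r -> p6 r = r.
Proof.
move=> er; apply/esym/addr_eq0.
have p66 : p6 (p6 r) = p6 r.
  have zx s : x6 * (z * s) = z * (x6 * s) by rewrite !mulrA zx6.
  have -> : p6 (p6 r) = x6 * (x6 * (x6 * p6 (x6 * r))) by [].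
  rewrite p6z // !zx -[x6 * (x6 * (x6 * (x6 * (x6 * (x6 * r)))))]/(x6 * (x6 * p6 r)).
  have -> : x6 * (x6 * p6 r) = x6 * p6 (x6 * r) by [].
  by rewrite p6z // zx zzr // !e6.
have dE : r + p6 r = a * (c * (b * r)).
  have := congr1 (fun s => s * (b * r)) x6_unip.
  have abr : a * (b * r) = r by rewrite mulrA -eE.
  by rewrite mulrDl -!mulrA abr.
have p7d : p7 (r + p6 r) = r + p6 r.
  have x7a s : x7 * (a * s) = a * (x7 * s) by rewrite !mulrA ax7.
  rewrite dE /p7 !x7a; congr (a * _).
  have := congr1 (fun s => s * (b * r)) x7_unip.
  by rewrite -!mulrA.
rewrite -p7d -p6_p7; last by rewrite mulrDr er /p6 !e6.
have -> : p6 (r + p6 r) = p6 r + p6 (p6 r) by rewrite /p6 !mulrDr.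
by rewrite p66 char2.
Qed.

(** With x6^4 = 1: x6^2 = x6^6 = x6 (z x6^3) = z. *)
Lemma x6x6 r : e * r = r -> x6 * (x6 * r) = z * r.
Proof.
move=> er; rewrite -{1}(p6_id er).
have -> : x6 * (x6 * p6 r) = x6 * p6 (x6 * r) by [].
rewrite p6z // mulrA -zx6 -!mulrA -/(p6 r).
by rewrite p6_id.
Qed.

Let tt r : t6 * (t6 * r) = r.
Proof. by rewrite mulrA t66 mul1r. Qed.

Let t6x6r r : t6 * (x6 * r) = x7 * (t6 * r) + r.
Proof. by rewrite mulrA t6x6 mulrDl mul1r mulrA. Qed.

Let t6x7r r : t6 * (x7 * r) = x6 * (t6 * r) + r.
Proof.
have := congr1 (fun s => t6 * s) (t6x6r (t6 * r)).
by rewrite /= mulrDr !tt => ->; rewrite -addrA char2 addr0.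
Qed.

Let t6z r : t6 * (z * r) = z * (t6 * r).
Proof. by rewrite !mulrA zt6. Qed.

(** Put y = x6 + x7. As x6^2 = z commutes with [t6], straightening t6 x6^2 gives y^2 t6 = y, hence
    y^2 = y t6 and y^3 = y. But y^4 = x6^4 + x7^4 = 0, so y = 0. *)
Lemma x7_x6 r : e * r = r -> x7 * r = x6 * r.
Proof.
move=> er; apply: addr_eq0.
pose y s := x7 * s + x6 * s.
have ey s : e * s = s -> e * y s = y s by move=> es; rewrite mulrDr e6 ?e7.
have x67r s : x6 * (x7 * s) = x7 * (x6 * s) by rewrite !mulrA x67.
have yy s : y (y s) = x7 * (x7 * s) + x6 * (x6 * s).
  by rewrite /y !mulrDr x67r addrA -(addrA (x7 * (x7 * s))) char2 addr0.
have yt s : e * s = s -> x7 * (x7 * (t6 * s)) + z * (t6 * s) = y s.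
  by move=> es; rewrite -t6z -x6x6 // !t6x6r mulrDr !addrA char2 add0r.
have yyt s : e * s = s -> y (y s) = y (t6 * s).
  by move=> es; rewrite yy x6x6 // -{1 2}[s]tt yt ?et.
have y3 s : e * s = s -> y (y (y s)) = y s.
  by move=> es; rewrite (yyt s es) yy x6x6 ?et // yt.
have y4 : y (y (y (y r))) = 0.
  have yD s s' : y (s + s') = y s + y s' by rewrite /y !mulrDr addrACA.
  have -> : y (y (y (y r))) = p7 r + p6 r.
    rewrite yy (yy r) !mulrDr -!x67r addrA -(addrA (p7 r)) char2 addr0.
    by [].
  by rewrite p6_p7 // char2.
by rewrite -/(y r) -(y3 r) // -{1}(y3 r) // y4 /y !mulr0 addr0.
Qed.

Let xx r (er : e * r = r) := x6x6 er.
Let tx r (er : e * r = r) : t6 * (x6 * r) = x6 * (t6 * r) + r.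
Proof. by rewrite t6x6r x7_x6 ?et. Qed.

Variables u f : R.
Hypothesis uE : u = e + t6 * e.
Hypothesis fu : f = x6 * u.

Let tu : t6 * u = u. Proof. by rewrite uE mulrDr tt addrC. Qed.
Let eu : e * u = u. Proof. by rewrite uE mulrDr et // ee. Qed.
Let tf : t6 * f = f + u.
Proof. by rewrite fu tx // tu. Qed.
Let ef : e * f = f. Proof. by rewrite fu; apply: e6. Qed.
Let fE r : e * r = r -> f * r = x6 * (r + t6 * r).
Proof. by move=> er; rewrite fu uE -mulrA mulrDl er -mulrA er. Qed.

(** By [fE], f f = x6 (f + t6 f), and t6 f = f + u leaves x6 u. *)
Lemma scopes_idemP : f * f = f.
Proof. by rewrite fE // tf addrA char2 add0r. Qed.

Let fxf : f * (x6 * f) = 0.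
Proof. by rewrite {2}fu xx // fE ?ez // t6z tu char2 mulr0. Qed.

Let ftf : f * (t6 * f) = f.
Proof. by rewrite fE ?et // tt addrC tf addrA char2 add0r. Qed.

Let fxtf : f * (x6 * (t6 * f)) = f.
Proof.
by rewrite tf mulrDr mulrDr fxf add0r -fu scopes_idemP.
Qed.

Lemma scopes_idem_comm s : iota s * f = f * iota s.
Proof.
rewrite fu uE mulrA x6C -!mulrA; congr (x6 * _).
by rewrite mulrDr mulrDl -mulrA eI !mulrA t6C.
Qed.

Lemma e_ideal : ideal_of f e.
Proof.
(* Indeed u x6 = x6 u + e = f + e, while x6^3 f x6 = x6^4 u x6 = u x6. *)
have -> : e = x6 * (x6 * x6) * f * x6 + f.
  have ux : u * x6 = x6 * u + e.
    by rewrite uE mulrDl -mulrA ex6 tx // mulrDr addrA.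
  have -> : x6 * (x6 * x6) * f * x6 = p6 (u * x6) by rewrite /p6 fu -!mulrA.
  rewrite p6_id; last by rewrite mulrA eu.
  by rewrite ux fu addrAC char2 add0r.
by apply: ideal_ofD; [apply: ideal_ofM|]; apply: ideal_of_refl.
Qed.

(** The span over [S] of the four monomials of the degenerate Hecke algebra on two strands, taken
    modulo x6^2 = z; the lemmas below place [e * R * e] inside it. *)
Definition hecke r : Prop := exists p q k l : S,
  r = iota p * e + iota q * (x6 * e) + iota k * (t6 * e) + iota l * (x6 * (t6 * e)).

Let iota0 : iota 0 = 0.
Proof. by apply: (addrI (iota 0)); rewrite -corner_add !addr0. Qed.

Lemma heckeD r r' : hecke r -> hecke r' -> hecke (r + r').
Proof.
move=> [p [q [k [l ->]]]] [p' [q' [k' [l' ->]]]].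
exists (p + p'), (q + q'), (k + k'), (l + l').
rewrite !corner_add !mulrDl addrACA; congr (_ + _).
by rewrite addrACA; congr (_ + _); rewrite addrACA.
Qed.

Lemma hecke_iota s r : hecke r -> hecke (iota s * r).
Proof.
move=> [p [q [k [l ->]]]]; exists (s * p), (s * q), (s * k), (s * l).
by rewrite !corner_mul !mulrDr !mulrA.
Qed.

Lemma hecke_z r : hecke r -> hecke (z * r). Proof. by rewrite -zE; apply: hecke_iota. Qed.
Lemma hecke_x5 r : hecke r -> hecke (x5 * r). Proof. by rewrite -x5E; apply: hecke_iota. Qed.
Lemma hecke_t4 r : hecke r -> hecke (t4 * r). Proof. by rewrite -t4E; apply: hecke_iota. Qed.

Lemma hecke_e : hecke e.
Proof. by exists 1, 0, 0, 0; rewrite iota0 iota1 mul1r !mul0r !addr0. Qed.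
Lemma hecke_xe : hecke (x6 * e).
Proof. by exists 0, 1, 0, 0; rewrite iota0 iota1 mul1r !mul0r !addr0 add0r. Qed.
Lemma hecke_te : hecke (t6 * e).
Proof. by exists 0, 0, 1, 0; rewrite iota0 iota1 mul1r !mul0r addr0 !add0r. Qed.
Lemma hecke_xte : hecke (x6 * (t6 * e)).
Proof. by exists 0, 0, 0, 1; rewrite iota0 iota1 mul1r !mul0r !add0r. Qed.

Lemma hecke_x r : hecke r -> hecke (x6 * r).
Proof.
move=> [p [q [k [l ->]]]].
have xI s r' : x6 * (iota s * r') = iota s * (x6 * r') by rewrite !mulrA x6C.
rewrite !mulrDr !xI (xx ee) (xx (et ee)).
apply: heckeD; [apply: heckeD; [apply: heckeD|]|]; apply: hecke_iota;
  [exact: hecke_xe|apply: hecke_z; exact: hecke_e|exact: hecke_xte|].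
by apply: hecke_z; exact: hecke_te.
Qed.

Lemma hecke_t r : hecke r -> hecke (t6 * r).
Proof.
move=> [p [q [k [l ->]]]].
have tI s r' : t6 * (iota s * r') = iota s * (t6 * r') by rewrite !mulrA t6C.
rewrite !mulrDr !tI (tx ee) (tx (et ee)) !tt.
apply: heckeD; [apply: heckeD; [apply: heckeD|]|]; apply: hecke_iota;
  [exact: hecke_te| |exact: hecke_e|]; apply: heckeD.
- exact: hecke_xte.
- exact: hecke_e.
- exact: hecke_xe.
- exact: hecke_te.
Qed.

Let fI s r : f * (iota s * r) = iota s * (f * r).
Proof. by rewrite mulrA -scopes_idem_comm -mulrA. Qed.

Lemma hecke_corner r : hecke r -> exists s, f * r * f = iota s * f.
Proof.
(* Compression by [f] sends the monomials 1, x6, t6, x6 t6 to f, 0, f, f. *)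
move=> [p [q [k [l ->]]]]; exists (p + k + l).
rewrite -!mulrA !mulrDl -!mulrA ef !mulrDr !fI scopes_idemP fxf ftf fxtf.
by rewrite mulr0 addr0 !corner_add !mulrDl.
Qed.

Lemma hecke_ind (P : R -> Prop) : P e -> (forall r, P r -> P (x6 * r)) ->
    (forall r, P r -> P (t6 * r)) -> (forall s r, P r -> P (iota s * r)) ->
    (forall r r', P r -> P r' -> P (r + r')) ->
  forall r, hecke r -> P r.
Proof.
move=> Pe Px Pt PI PD r [p [q [k [l ->]]]].
by apply/PD; [apply/PD; [apply/PD|]|]; apply/PI; auto.
Qed.

Lemma hecke_mulr r y : e * y = y * e ->
  (hecke (e * y)) -> hecke r -> hecke (r * y).
Proof.
move=> ey Ley; elim/hecke_ind => //.
- by move=> r' Lr; rewrite -mulrA; apply: hecke_x.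
- by move=> r' Lr; rewrite -mulrA; apply: hecke_t.
- by move=> s r' Lr; rewrite -mulrA; apply: hecke_iota.
- by move=> r1 r2 L1 L2; rewrite mulrDl; apply: heckeD.
Qed.

Lemma hecke_mulx r : hecke r -> hecke (r * x6).
Proof. by apply: hecke_mulr; rewrite ex6 //; apply: hecke_xe. Qed.
Lemma hecke_mult r : hecke r -> hecke (r * t6).
Proof. by apply: hecke_mulr; rewrite et6 //; apply: hecke_te. Qed.
Lemma hecke_mul_iota s r : hecke r -> hecke (r * iota s).
Proof. by apply: hecke_mulr; rewrite eI //; apply: hecke_iota; apply: hecke_e. Qed.

(** Moving [x6] through [X] turns X = X x6^4 into x5^4 X plus terms in [hecke], and x5^3 vanishes on
    [a]. Thus what intertwines the nilpotent [x5] with the invertible [x6] is zero modulo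
    [hecke]. *)
Lemma hecke_nil X l : e * X = X -> X * e = X -> X * x6 = x5 * X + l -> hecke l -> hecke X.
Proof.
move=> eX Xe Xx Ll.
have XxE r : X * (x6 * r) = x5 * (X * r) + l * r by rewrite mulrA Xx mulrDl mulrA.
have x5X : x5 * (x5 * (x5 * X)) = 0.
  have := congr1 (fun r => r * (b * X)) x5_nil.
  by rewrite mul0r -!mulrA (mulrA a b X) -eE eX.
have -> : X = X * (x6 * (x6 * (x6 * (x6 * e)))) by rewrite -/(p6 e) p6_id.
have Lre r : hecke r -> hecke (r * e) by apply: hecke_mulr; rewrite ?ee //; apply: hecke_e.
have L0 := Lre _ Ll.
have L1 : hecke (l * (x6 * e)) by rewrite mulrA; apply/Lre/hecke_mulx.
have L2 : hecke (l * (x6 * (x6 * e))) by rewrite !mulrA; apply/Lre/hecke_mulx/hecke_mulx.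
have L3 : hecke (l * (x6 * (x6 * (x6 * e)))).
  by rewrite !mulrA; apply/Lre/hecke_mulx/hecke_mulx/hecke_mulx.
rewrite !XxE Xe !mulrDr x5X mulr0 add0r.
by do ?[apply: heckeD]; do ?[apply: hecke_x5].
Qed.

Let ex5 : e * x5 = x5 * e. Proof. by rewrite -x5E eI. Qed.
Let et4 : e * t4 = t4 * e. Proof. by rewrite -t4E eI. Qed.

Lemma corner_t5 : hecke (e * t5 * e).
Proof.
apply: (@hecke_nil _ e); last exact: hecke_e.
- by rewrite !mulrA ee.
- by rewrite -mulrA ee.
rewrite [RHS](_ : _ = e * (x5 * t5) * e + e); last first.
  by rewrite mulrA mulrA -ex5 -!mulrA.
by rewrite x5t5 mulrDr mulrDl mulr1 ee -addrA char2 addr0 -!mulrA ex6.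
Qed.

(** On [e] one may replace [x6] by [x7], which this word carries to [x5]; straightening leaves only
    shorter words, already in [hecke]. *)
Lemma corner_t5t4t6t5 : hecke (e * (t5 * (t4 * (t6 * t5))) * e).
Proof.
have L1 : hecke (e * (t5 * (t4 * t5)) * e).
  rewrite braid45 mulrA et4 -!mulrA -et4 !mulrA -(mulrA t4) -(mulrA t4).
  by rewrite -t4E; apply/hecke_mul_iota/hecke_iota/corner_t5.
have L2 : hecke (e * (t4 * (t6 * t5)) * e).
  rewrite mulrA et4 -!mulrA; apply: hecke_t4; rewrite mulrA et6 -mulrA; apply: hecke_t.
  by rewrite mulrA; apply: corner_t5.
apply: (@hecke_nil _ (e * (t5 * (t4 * t5)) * e + e * (t4 * (t6 * t5)) * e)); last exact: heckeD.
- by rewrite !mulrA ee.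
- by rewrite -mulrA ee.
have x6t6 r : x6 * (t6 * r) = t6 * (x7 * r) + r by rewrite t6x7r -addrA char2 addr0.
have x5D : t5 * (t4 * (t6 * t5)) * x7 =
    x5 * (t5 * (t4 * (t6 * t5))) + (t5 * (t4 * t5) + t4 * (t6 * t5)).
  have -> : x5 * (t5 * (t4 * (t6 * t5))) = t5 * (x6 * (t4 * (t6 * t5))) + t4 * (t6 * t5).
    by rewrite mulrA x5t5 mulrDl mul1r -(mulrA t5).
  have -> : x6 * (t4 * (t6 * t5)) = t4 * (t6 * (t5 * x7) + t5).
    by rewrite t5x7 -x6t6 !mulrA t4x6.
  by rewrite !mulrDr -!mulrA -[X in X + _]addrA -addrA char2 addr0.
rewrite -mulrA ex6 -(x7_x6 ee) mulrA -(mulrA e) x5D mulrDr !mulrDl.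
by rewrite mulrDr mulrDl mulrA ex5 -!mulrA.
Qed.

Definition double_coset_reps : seq R :=
  [:: 1; t6; t5; t5 * t6; t6 * t5; t6 * (t5 * t6); t5 * (t4 * (t6 * t5))].

Lemma corner_rep d : d \in double_coset_reps -> hecke (e * d * e).
Proof.
have Lre r : hecke r -> hecke (r * e) by apply: hecke_mulr; rewrite ?ee //; apply: hecke_e.
have L5 := corner_t5.
rewrite !inE => /or4P[||| /or4P[]] /eqP ->.
- by rewrite mulr1 ee; apply: hecke_e.
- by rewrite et6 -mulrA ee; apply: hecke_te.
- exact: L5.
- by rewrite -mulrA -mulrA -et6 !mulrA; apply: hecke_mult.
- by rewrite mulrA et6 -!mulrA; apply: hecke_t; rewrite mulrA.
- by rewrite mulrA et6 -!mulrA -et6; apply: hecke_t; rewrite !mulrA; apply: hecke_mult.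
- exact: corner_t5t4t6t5.
Qed.

Definition double_coset_span r : Prop :=
  exists s : seq (S * R * S),
    all (fun w => w.1.2 \in double_coset_reps) s /\
    r = \sum_(w <- s) iota w.1.1 * w.1.2 * iota w.2.

Lemma scopes_corner r : double_coset_span r -> exists s, f * r * f = iota s * f.
Proof.
case=> s [/allP s_reps ->].
have L0 : hecke 0 by exists 0, 0, 0, 0; rewrite iota0 !mul0r !addr0.
have : hecke (e * (\sum_(w <- s) iota w.1.1 * w.1.2 * iota w.2) * e).
  rewrite mulr_sumr mulr_suml big_seq; elim/big_ind: _ => // [|w /s_reps wr].
    exact: heckeD.
  rewrite !mulrA eI -!mulrA -eI; apply: hecke_iota; rewrite !mulrA; apply: hecke_mul_iota.
  exact: corner_rep.
case/hecke_corner => s' sE; exists s'; rewrite -sE.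
have fe : f * e = f by rewrite fu uE -!mulrA mulrDl -mulrA ee.
by rewrite !mulrA fe -!mulrA ef.
Qed.

Lemma scopes_b_idem : b * f = f.
Proof.
have be : b * e = e by rewrite eE bC -mulrA bb.
by rewrite -ef mulrA be.
Qed.
Lemma scopes_a_idem : a * f = f. Proof. by rewrite -ef mulrA ae. Qed.

(** With k5 = 1 + j and k3^2 = b, the equation b^2 = b becomes 1 = k3 j + j k3 + j^2, so [a]
    generates the unit ideal. Multiplying by the central [b] puts [b] in the ideal of [e], and
    [e_ideal] in that of [f]. *)
Lemma scopes_full (k5 j k3 : R) : ideal_of a j -> j = 1 + k5 -> k3 * k3 = b ->
  b = k3 + k5 -> ideal_of f b.
Proof.
move=> aj jE kk bE.
have k5E : k5 = 1 + j by rewrite jE addrA char2 add0r.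
have one : 1 = k3 * j + j * k3 + j * j.
  apply: addr_eq0; have : (k3 + k5) * (k3 + k5) = b by rewrite -bE bb.
  rewrite mulrDl !mulrDr kk -addrA => /(canRL (addKr _)); rewrite addNr => <-.
  rewrite k5E !mulrDr !mulrDl !mulr1 !mul1r.
  rewrite [RHS]addrA [k3 + _ + _]addrACA char2 add0r -[1 + j + _]addrA (addrA j) char2 add0r.
  by rewrite addrCA.
have a1 : ideal_of a 1.
  rewrite one; apply: ideal_ofD; [apply: ideal_ofD|].
  - by rewrite -[_ * j]mulr1; apply: ideal_of_trans aj (ideal_ofM _ _ (ideal_of_refl _)).
  - by rewrite -[j * _]mul1r mulrA; apply: ideal_of_trans aj (ideal_ofM _ _ (ideal_of_refl _)).
  - by rewrite -[j * j]mul1r mulrA; apply: ideal_of_trans aj (ideal_ofM _ _ (ideal_of_refl _)).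
apply: ideal_of_trans e_ideal _.
have [s sE] := a1; exists s; rewrite -[LHS]mulr1 sE mulr_sumr; apply: eq_bigr => uv _.
by rewrite eE bC -!mulrA bC.
Qed.

(* [z * w * x6 ^+ 3 * f = z * w * x6 ^+ 4 * u = z * w * u], because [x6 ^+ 4] fixes [e]. *)
Lemma scopes_retraction (rho : R -> S) (w : R) :
    (forall s r, rho (iota s * r) = s * rho r) ->
    (forall s, iota s * w = w * iota s) ->
    rho (w * (1 + t6) * b) = z0 ->
  exists2 t, (forall s, iota s * t = t * iota s) & rho (t * f) = a0.
Proof.
move=> rhoM wC rho_w; exists (z * (w * (x6 * (x6 * x6)))) => [s|].
  have x6C' r : iota s * (x6 * r) = x6 * (iota s * r) by rewrite !mulrA x6C.
  by rewrite -zE mulrA -corner_mul -z0C corner_mul -!mulrA (mulrA _ w) wC -mulrA !x6C' x6C.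
have -> : z * (w * (x6 * (x6 * x6))) * f = iota (z0 * a0) * (w * (1 + t6) * b).
  have -> : z * (w * (x6 * (x6 * x6))) * f = z * (w * p6 u) by rewrite fu /p6 -!mulrA.
  rewrite p6_id // corner_mul zE aE -mulrA; congr (_ * _).
  have ta : (1 + t6) * a = a * (1 + t6) by rewrite mulrDl mulrDr mul1r mulr1 at6.
  have -> : u = a * (1 + t6) * b by rewrite -ta -mulrA -eE mulrDl mul1r.
  by rewrite !mulrA -aE wC.
by rewrite rhoM rho_w -mulrA a0C mulrA zz aa.
Qed.

Lemma scopes_idempotentP (k5 j k3 w : R) (rho : R -> S) :
    (forall r, double_coset_span r) ->
    ideal_of a j -> j = 1 + k5 -> k3 * k3 = b -> b = k3 + k5 ->
    (forall s r, rho (iota s * r) = s * rho r) ->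
    (forall s, iota s * w = w * iota s) ->
    rho (w * (1 + t6) * b) = z0 ->
  scopes_idempotent iota rho a0 b f.
Proof.
move=> span aj jE kk bE rhoM wC rho_w; split.
- exact: scopes_idemP.
- exact: scopes_idem_comm.
- by rewrite aE; apply: scopes_a_idem.
- exact: scopes_b_idem.
- by move=> r; apply: scopes_corner.
- exact: scopes_full aj jE kk bE.
- exact: scopes_retraction rhoM wC rho_w.
Qed.
End DividedPowers.

(** * Double cosets of degree 5 in degree 7 *)

Section DoubleCosets.
Variable n : nat.
Implicit Types g a b c : 'S_n.+1.

Definition fixes_from k g : Prop := forall i : 'I_n.+1, (k <= i)%N -> g i = i.
Definition adj k : 'S_n.+1 := tperm (inord k) (inord k.+1).

Lemma fixes_fromM k g h : fixes_from k g -> fixes_from k h -> fixes_from k (g * h)%g.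
Proof. by move=> gk hk i ki; rewrite permM gk ?hk. Qed.

Lemma adjK k : (adj k * adj k = 1)%g.
Proof. exact: tperm2. Qed.

Lemma fixes_adj k l c : (l <= k)%N -> (k < n)%N -> fixes_from l c ->
  (c * adj k = adj k * c)%g.
Proof.
move=> lk kn cl; apply/esym; rewrite conjgC tpermJ !cl // inordK; lia.
Qed.

Lemma adj_braid k : (k.+1 < n)%N ->
  (adj k * (adj k.+1 * adj k) = adj k.+1 * (adj k * adj k.+1))%g.
Proof.
move=> kn.
have kk : (inord k : 'I_n.+1) == inord k.+1 = false.
  by rewrite -val_eqE /= !inordK; lia.
have kk2 : (inord k : 'I_n.+1) == inord k.+2 = false.
  by rewrite -val_eqE /= !inordK; lia.
have k1k2 : (inord k.+1 : 'I_n.+1) == inord k.+2 = false.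
  by rewrite -val_eqE /= !inordK; lia.
have conjE (a b : 'S_n.+1) : (b * b = 1 -> b * (a * b) = a ^ b)%g.
  by move=> bb; rewrite /conjg; congr (_ * _)%g; apply/eqP; rewrite eq_sym eq_invg_mul bb.
rewrite !conjE ?adjK // /adj !tpermJ !tpermL !tpermR !tpermD ?kk ?kk2 ?k1k2 //.
- by rewrite eq_sym kk.
- by rewrite eq_sym kk2.
Qed.

(** If [g] moves the letter k+1, a transposition sends the preimage j of k+1 to k and [adj k] sends
    k to k+1, so the remaining factor fixes k+1. *)
Lemma fixes_peel k g : (k < n)%N -> fixes_from k.+2 g ->
  fixes_from k.+1 g \/ exists a b,
    [/\ fixes_from k.+1 a, fixes_from k.+1 b & g = (a * adj k * b)%g].
Proof.
move=> kn gk; pose t : 'I_n.+1 := inord k.+1; pose p : 'I_n.+1 := inord k.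
have tE : t = k.+1 :> nat by rewrite inordK.
have pE : p = k :> nat by rewrite inordK // ltnW.
have [gt|gt] := eqVneq (g t) t.
  left=> i; rewrite leq_eqVlt => /orP[/eqP ki|]; last exact: gk.
  by rewrite (_ : i = t) //; apply: val_inj; rewrite /= tE.
right; pose j := (g^-1 t)%g; have gj : g j = t by rewrite permKV.
have jk : (j < k.+1)%N.
  case: (ltngtP j k.+1) => // [kj|jE].
    by have := gk j kj; rewrite gj => jt; move: kj; rewrite -jt tE ltnn.
  have jt : j = t by apply: val_inj; rewrite /= tE.
  by rewrite -{1}jt gj eqxx in gt.
exists (tperm j p), (adj k * tperm j p * g)%g; split.
- move=> i ki; have lt1 : (j < i)%N := leq_trans jk ki; have lt2 : (p < i)%N by rewrite pE.
  by rewrite tpermD // -val_eqE neq_ltn ?lt1 ?lt2.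
- move=> i; rewrite leq_eqVlt => /orP[/eqP ki|ki].
    have -> : i = t by apply: val_inj; rewrite /= tE.
    by rewrite !permM tpermR tpermR.
  have lt1 : (j < i)%N by apply: leq_trans jk (ltnW ki).
  have lt2 : (p < i)%N by rewrite pE ltnW.
  have lt3 : (t < i)%N by rewrite tE.
  by rewrite !permM !tpermD ?gk // -val_eqE neq_ltn ?lt1 ?lt2 ?lt3.
- by rewrite !mulgA -(mulgA (tperm j p) (adj k) (adj k)) adjK mulg1 tperm2 mul1g.
Qed.
End DoubleCosets.

(** Letters 6 and 5 are peeled off on both sides, and whatever commutes with the transpositions
    between moves outwards. If [adj 6 4] occurs twice, the factor in between is peeled at letter 4:
    either it slides past and the braid relation applies, or the last representative appears. *)
Lemma sym7_double_coset (g : 'S_7) : exists a d b, [/\ fixes_from 5 a, fixes_from 5 b,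
  g = (a * d * b)%g & d \in [:: 1; adj 6 5; adj 6 4; adj 6 4 * adj 6 5; adj 6 5 * adj 6 4;
    adj 6 5 * (adj 6 4 * adj 6 5); adj 6 4 * (adj 6 3 * (adj 6 5 * adj 6 4))]%g].
Proof.
have one : fixes_from 5 (1%g : 'S_7) by move=> i _; rewrite perm1.
have fix6 (h : 'S_7) : fixes_from 6 h -> fixes_from 5 h \/ exists a b,
    [/\ fixes_from 5 a, fixes_from 5 b & h = (a * adj 6 4 * b)%g].
  exact: (@fixes_peel 6 4).
have com (c : 'S_7) : fixes_from 5 c -> (c * adj 6 5 = adj 6 5 * c)%g.
  exact: (@fixes_adj 6 5 5).
have [g6|[a [b [a6 b6 ->]]]] : fixes_from 6 g \/ exists a b,
    [/\ fixes_from 6 a, fixes_from 6 b & g = (a * adj 6 5 * b)%g].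
- by apply: (@fixes_peel 6 5) => // i; rewrite leqNgt ltn_ord.
- have [g5|[a [b [a5 b5 ->]]]] := fix6 _ g6.
    by exists g, 1%g, 1%g; rewrite !mulg1 !inE eqxx.
  by exists a, (adj 6 4), b; rewrite !inE eqxx !orbT.
have [a5|[a1 [a2 [a15 a25 ->]]]] := fix6 _ a6; have [b5|[b1 [b2 [b15 b25 ->]]]] := fix6 _ b6.
- by exists a, (adj 6 5), b; rewrite !inE eqxx !orbT.
- exists (a * b1)%g, (adj 6 5 * adj 6 4)%g, b2; split=> //; first exact: fixes_fromM.
    by rewrite !mulgA -(mulgA a (adj 6 5) b1) -(com b1 b15) !mulgA.
  by rewrite !inE eqxx !orbT.
- exists a1, (adj 6 4 * adj 6 5)%g, (a2 * b)%g; split=> //; first exact: fixes_fromM.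
    by rewrite !mulgA -(mulgA _ a2 (adj 6 5)) (com a2 a25) !mulgA.
  by rewrite !inE eqxx !orbT.
have c5 : fixes_from 5 (a2 * b1)%g by apply: fixes_fromM.
have gE : (a1 * adj 6 4 * a2 * adj 6 5 * (b1 * adj 6 4 * b2) =
    a1 * (adj 6 4 * (a2 * b1) * adj 6 5 * adj 6 4) * b2)%g.
  by rewrite !mulgA -(mulgA _ (adj 6 5) b1) -(com b1 b15) !mulgA.
rewrite gE; move: (a2 * b1)%g c5 => c c5 {gE}.
have [c4|[c1 [c2 [c14 c24 ->]]]] : fixes_from 4 c \/ exists a b,
    [/\ fixes_from 4 a, fixes_from 4 b & c = (a * adj 6 3 * b)%g].
- exact: (@fixes_peel 6 3).
- exists (a1 * c)%g, (adj 6 5 * (adj 6 4 * adj 6 5))%g, b2; split=> //.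
  + exact: fixes_fromM.
  + rewrite -(@fixes_adj 6 4 4 c) // -adj_braid // !mulgA.
    by rewrite -(mulgA (a1 * c)%g (adj 6 4)).
  + by rewrite !inE eqxx !orbT.
exists (a1 * c1)%g, (adj 6 4 * (adj 6 3 * (adj 6 5 * adj 6 4)))%g, (c2 * b2)%g; split=> //.
+ by apply: fixes_fromM => // i i5; apply: c14; apply: leq_trans i5.
+ by apply: fixes_fromM => // i i5; apply: c24; apply: leq_trans i5.
+ have c1C := @fixes_adj 6 4 4 c1 isT isT c14.
  have c2C := @fixes_adj 6 4 4 c2 isT isT c24.
  have c2C' := @fixes_adj 6 5 4 c2 isT isT c24.
  rewrite !mulgA -(mulgA a1 (adj 6 4) c1) -c1C !mulgA; congr (_ * _)%g.
  by rewrite -!mulgA -c2C [in RHS](mulgA (adj 6 5) c2) -c2C' -!mulgA.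
+ by rewrite !inE eqxx !orbT.
Qed.

(** * The relations in degrees 5 and 7 *)

Definition swap_code n i j : seq nat :=
  [seq if k == i then j else if k == j then i else k | k <- iota 0 n].

Lemma code_tperm n (i j : 'I_n) : code (tperm i j) = swap_code n i j.
Proof.
rewrite /code /swap_code -val_enum_ord -[RHS]map_comp; apply: eq_map => k /=.
by rewrite permE /= -!val_eqE /=; case: eqP => // _; case: eqP.
Qed.

Lemma code_adj n k : (k < n)%N -> code (adj n k) = swap_code n.+1 k k.+1.
Proof. by move=> kn; rewrite code_tperm !inordK //; lia. Qed.

Section Degree57.
Local Notation emb := (@sym_embed 5 2).
Local Notation R := (group_algebra 'F_2 'S_7).
Local Notation S := (group_algebra 'F_2 'S_5).
Definition iota57 : corner_morph R S := galg_map 'F_2 (@sym_embedM 5 2).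
Definition res57 : R -> S := galg_res emb.

Definition t4 : R := ev 7 [:: swap_code 7 3 4].
Definition t5 : R := ev 7 [:: swap_code 7 4 5].
Definition t6 : R := ev 7 [:: swap_code 7 5 6].

Lemma ev_adj k : (k < 6)%N -> ev 7 [:: swap_code 7 k k.+1] = gmono 1 (adj 6 k).
Proof. by move=> k6; rewrite /ev big_seq1 -code_adj // codeK. Qed.

Lemma span57 (r : R) : double_coset_span iota57 t5 t6 t4 r.
Proof.
have iotaE g : iota57 (gmono 1 g) = gmono 1 (emb g).
  by apply: galg_map_gmono; apply: sym_embed_inj.
have t4E : t4 = gmono 1 (adj 6 3) by apply: ev_adj.
have t5E : t5 = gmono 1 (adj 6 4) by apply: ev_adj.
have t6E : t6 = gmono 1 (adj 6 5) by apply: ev_adj.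
have word (g : 'S_7) : exists w : S * R * S, w.1.2 \in double_coset_reps t5 t6 t4 /\
    gmono 1 g = iota57 w.1.1 * w.1.2 * iota57 w.2.
  have [a [d [b [a5 b5 -> dP]]]] := sym7_double_coset g.
  have fixed (h : 'S_7) : fixes_from 5 h -> h \in codom emb.
    by move=> h5; apply: codom_sym_embed => i; apply: h5; rewrite /= leq_addr.
  have /codomP[a' ->] := fixed a a5; have /codomP[b' ->] := fixed b b5.
  exists (gmono 1 a', gmono 1 d, gmono 1 b'); split; last by rewrite !iotaE !gmonoM !mulr1.
  rewrite /double_coset_reps t4E t5E t6E -gmono1 !gmonoM !mulr1.
  exact: (map_f (fun h : 'S_7 => gmono (1 : 'F_2) h) dP).
pose W g := projT1 (cid (word g)).
exists [seq W g | g <- enum 'S_7 & r g != 0]; split.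
  by apply/allP => w /mapP[g _ ->]; rewrite /W; case: cid => w' /= [].
rewrite big_map big_filter big_enum_cond /= [LHS]galg_gmono [RHS]big_mkcond /=.
apply: eq_bigr => g _; rewrite /W; case: cid => w /= [_ <-].
have [->|->] : r g = 0 \/ r g = 1.
- by case: (r g) => [[|[|]]] // i; [left|right]; apply: val_inj.
- by rewrite eqxx; apply/ffunP => h; rewrite !ffunE if_same.
- by rewrite oner_eq0.
Qed.

Lemma ev_one n : ev n [:: iota 0 n] = 1.
Proof.
have code1 : code (1%g : 'S_n) = iota 0 n.
  by rewrite /code -val_enum_ord; apply: eq_map => i; rewrite perm1.
by rewrite /ev big_seq1 -code1 codeK gmono1.
Qed.

Lemma norm2_eq n l l' : norm2 (l ++ l') = [::] -> ev n l = ev n l'.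
Proof.
move=> ll'; apply: (addIr (ev n l')); rewrite -ev_cat -ev_norm2 ll' addxx2.
by rewrite /ev big_nil.
Qed.

Lemma commute_codes n l : all (is_code n) l ->
    all (fun p => norm2 (run (GMul (GLit l) (GLit [:: p])) ++
                         run (GMul (GLit [:: p]) (GLit l))) == [::]) (all_codes n) ->
  forall a, ev n l * a = a * ev n l.
Proof.
move=> lP /allP l_comm a; rewrite [a]galg_gmono [LHS]mulr_sumr [RHS]mulr_suml.
apply: eq_bigr => g _; have [->|->] : a g = 0 \/ a g = 1.
- by case: (a g) => [[|[|]]] // i; [left|right]; apply: val_inj.
- have -> : gmono (0 : 'F_2) g = 0 by apply/ffunP => x; rewrite !ffunE if_same.
  by rewrite mul0r mulr0.
have gP : is_code n (code g) := code_is_code g.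
have gE : gmono 1 g = ev n [:: code g] by rewrite /ev big_seq1 codeK.
have lg : code g \in all_codes n by rewrite mem_all_codes.
rewrite gE; pose c := GLit [:: code g].
apply: (@den_eq n (GMul (GLit l) c) (GMul c (GLit l))).
by rewrite /= gP lP (l_comm _ lg).
Qed.

(** Letters are numbered from 0, so [x5], [x6], [x7] have [k] equal to 4, 5, 6. *)
Definition jucys_murphy n k := [seq swap_code n i k | i <- iota 0 k].
Definition lift3 m := [seq ext m (7 - m) p | p <- cycles3 m].
Definition lift5 m := [seq ext m (7 - m) p | p <- cycles5 m].

Definition G1 := GLit [:: iota 0 7].
Definition Gx5 := GLit (map (ext 5 2) (jucys_murphy 5 4)).
Definition Gx6 := GLit (jucys_murphy 7 5).
Definition Gx7 := GLit (jucys_murphy 7 6).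
Definition Gt4 := GLit [:: swap_code 7 3 4].
Definition Gt5 := GLit [:: swap_code 7 4 5].
Definition Gt6 := GLit [:: swap_code 7 5 6].
Definition Ga := GAdd G1 (GAdd (GLit (lift3 5)) (GLit (lift5 5))).
Definition Gz := GAdd G1 (GLit (lift3 5)).
Definition Gb := GAdd (GLit (cycles3 7)) (GLit (cycles5 7)).
(** On [a], 1 + x6^4 is multiplication by this sum of the 5-cycles on six letters ([same_x6_unip]),
    and x7^4 fixes it ([same_x7_unip]). *)
Definition Gc := GLit (lift5 6).
Infix "*g" := GMul (at level 40, left associativity).
Infix "+g" := GAdd (at level 50, left associativity).
Definition same (x y : gexpr) := [&& wf 7 x, wf 7 y & norm2 (run x ++ run y) == [::]].
Definition right_mul x y := x *g (x *g (x *g (x *g y))).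

Lemma same_x67 : same (Gx6 *g Gx7) (Gx7 *g Gx6). Proof. by vm_compute. Qed.
Lemma same_t66 : same (Gt6 *g Gt6) G1. Proof. by vm_compute. Qed.
Lemma same_t6x6 : same (Gt6 *g Gx6) (Gx7 *g Gt6 +g G1). Proof. by vm_compute. Qed.
Lemma same_t5x7 : same (Gt5 *g Gx7) (Gx7 *g Gt5). Proof. by vm_compute. Qed.
Lemma same_x5t5 : same (Gx5 *g Gt5) (Gt5 *g Gx6 +g G1). Proof. by vm_compute. Qed.
Lemma same_braid : same (Gt5 *g (Gt4 *g Gt5)) (Gt4 *g (Gt5 *g Gt4)).
Proof. by vm_compute. Qed.
Lemma same_x5_nil : same (Gx5 *g (Gx5 *g (Gx5 *g Ga))) (GLit [::]).
Proof. by vm_compute. Qed.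
Lemma same_x6_quad :
  same (Gx6 *g right_mul Gx6 Ga) (Gz *g (Gx6 *g (Gx6 *g (Gx6 *g Ga)))).
Proof. by vm_compute. Qed.
Lemma same_x6_unip : same (Ga +g right_mul Gx6 Ga) (Ga *g Gc).
Proof. by vm_compute. Qed.
Lemma same_x7_unip : same (right_mul Gx7 Gc) Gc. Proof. by vm_compute. Qed.
Lemma same_x67_pow : same (right_mul Gx7 G1 +g right_mul Gx6 G1) (Ga +g Gb).
Proof. by vm_compute. Qed.
Lemma same_k3k3 : same (GLit (cycles3 7) *g GLit (cycles3 7)) Gb.
Proof. by vm_compute. Qed.

Definition G1_5 := GLit [:: iota 0 5].
Lemma same_zz : [&& wf 5 ((G1_5 +g GLit (cycles3 5)) *g (G1_5 +g GLit (cycles3 5))),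
    wf 5 (G1_5 +g (GLit (cycles3 5) +g GLit (cycles5 5)))
  & norm2 (run ((G1_5 +g GLit (cycles3 5)) *g (G1_5 +g GLit (cycles3 5))) ++
           run (G1_5 +g (GLit (cycles3 5) +g GLit (cycles5 5)))) == [::]].
Proof. by vm_compute. Qed.

Lemma comm_K3 : all (is_code 5) (cycles3 5) && all (fun p =>
   norm2 (run (GMul (GLit (cycles3 5)) (GLit [:: p])) ++
          run (GMul (GLit [:: p]) (GLit (cycles3 5)))) == [::]) (all_codes 5).
Proof. by vm_compute. Qed.

Definition commute57 l := all (is_code 7) l &&
  all (fun p => norm2 (lmul [:: ext 5 2 p] l ++ lmul l [:: ext 5 2 p]) == [::]) (all_codes 5).
Lemma comm_x6 : commute57 (jucys_murphy 7 5). Proof. by vm_compute. Qed.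
Lemma comm_x7 : commute57 (jucys_murphy 7 6). Proof. by vm_compute. Qed.
Lemma comm_t6 : commute57 [:: swap_code 7 5 6]. Proof. by vm_compute. Qed.
(** The 3-cycles (i 5 6) of one orientation: an orbit sum under conjugation by degree 5, so it
    commutes with that group. It is chosen so that w (1 + t6) b truncates to 1 + K3, as
    [res_transfer] checks. *)
Definition transfer_codes := [seq pmul (swap_code 7 i 6) (swap_code 7 5 6) | i <- iota 0 5].
Lemma comm_transfer : commute57 transfer_codes. Proof. by vm_compute. Qed.

Definition Gtransfer := GLit transfer_codes *g (G1 +g Gt6) *g Gb.
Lemma res_transfer : wf 7 Gtransfer &&
  (norm2 (res_codes 5 2 (run Gtransfer) ++ iota 0 5 :: cycles3 5) == [::]).
Proof. by vm_compute. Qed.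

(* The conjugates of [a] by these permutations, one for each choice of two fixed
   letters, add up to 1 plus the sum of the 5-cycles. *)
Definition pair_codes := [seq [seq k <- iota 0 7 | k \notin [:: i; j]] ++ [:: i; j] |
  i <- iota 0 7, j <- iota 0 i].
Definition conj_a w := GLit [:: pinv w] *g Ga *g GLit [:: w].
Definition Gj := foldr (fun w x => conj_a w +g x) (GLit [::]) pair_codes.
Lemma same_j : same Gj (G1 +g GLit (cycles5 7)). Proof. by vm_compute. Qed.

Lemma sameP x y : same x y -> den 7 x = den 7 y.
Proof. exact: den_eq. Qed.

Lemma ideal_of_conj : ideal_of (den 7 Ga) (den 7 Gj).
Proof.
rewrite /Gj; elim: pair_codes => [|w s IHs].
  by exists [::]; rewrite /= /ev !big_nil.
rewrite /=; apply: ideal_ofD => //; apply: ideal_ofM; exact: ideal_of_refl.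
Qed.

Lemma cycles3_codes n : all (is_code n) (cycles3 n).
Proof. by apply/allP => p; rewrite mem_filter mem_all_codes => /andP[]. Qed.

Lemma cycles5_codes n : all (is_code n) (cycles5 n).
Proof. by apply/allP => p; rewrite mem_filter mem_all_codes => /andP[]. Qed.

Lemma jucys_murphy_codes : all (is_code 5) (jucys_murphy 5 4). Proof. by []. Qed.

Lemma iota57_t4 : iota57 (ev 5 [:: swap_code 5 3 4]) = t4.
Proof. exact: (@galg_map_ev 5 2 [:: swap_code 5 3 4] isT). Qed.

Lemma den_Ga : den 7 Ga = 1 + (ev 7 (lift3 5) + ev 7 (lift5 5)).
Proof. by rewrite /= ev_one. Qed.

Lemma den_Gz : den 7 Gz = 1 + ev 7 (lift3 5).
Proof. by rewrite /= ev_one. Qed.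

Lemma ev_nil n : ev n [::] = 0.
Proof. by rewrite /ev big_nil. Qed.

Lemma iota57_ev l : all (is_code 5) l -> iota57 (ev 5 l) = ev 7 (map (ext 5 2) l).
Proof. exact: (@galg_map_ev 5 2). Qed.

Local Opaque ev cycles3 cycles5 lift3 lift5 all_codes jucys_murphy swap_code.

Lemma iota57_1 : iota57 1 = 1.
Proof. exact: (galg_map1 _ (@sym_embedM 5 2) (@sym_embed_inj 5 2)). Qed.

Lemma commute57P l : commute57 l -> forall s, iota57 s * ev 7 l = ev 7 l * iota57 s.
Proof. exact: (@commute_embed 5 2). Qed.

Theorem scopes57 : central_idempotent (1 + idem35 5) -> central_idempotent (idem35 7) ->
  exists f : R, scopes_idempotent iota57 res57 (1 + idem35 5) (idem35 7) f.
Proof.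
move=> aP bP.
have iota3 : iota57 (ev 5 (cycles3 5)) = ev 7 (lift3 5) := iota57_ev (cycles3_codes 5).
have iota5 : iota57 (ev 5 (cycles5 5)) = ev 7 (lift5 5) := iota57_ev (cycles5_codes 5).
have iotaD3 (p q r : S) (q' r' : R) : iota57 q = q' -> iota57 r = r' ->
    iota57 (p + (q + r)) = iota57 p + (q' + r').
  by move=> <- <-; rewrite !corner_add.
have aE : iota57 (1 + idem35 5) = den 7 Ga.
  by apply: (etrans (iotaD3 1 _ _ _ _ iota3 iota5)); rewrite iota57_1 den_Ga.
have zE : iota57 (1 + ev 5 (cycles3 5)) = den 7 Gz.
  apply: etrans (corner_add _ _ _) _.
  by rewrite den_Gz; apply: (f_equal2 +%R iota57_1 iota3).
have x5E : iota57 (ev 5 (jucys_murphy 5 4)) = den 7 Gx5 := iota57_ev jucys_murphy_codes.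
pose e := den 7 Ga * idem35 7; pose u := e + t6 * e.
exists (den 7 Gx6 * u).
pose k3 := ev 7 (cycles3 7); pose k5 := ev 7 (cycles5 7).
pose K3 := ev 5 (cycles3 5).
have K3C : forall s, (1 + K3) * s = s * (1 + K3).
  have [K3P K3A] := andP comm_K3.
  by move=> s; rewrite mulrDl mulrDr mul1r mulr1 (commute_codes K3P K3A).
have zz : (1 + K3) * (1 + K3) = 1 + idem35 5.
  (* Naming the unit [o] exchanges 1 for [ev 5 [:: iota 0 5]], the form in which the computed
     identity is stated. *)
  have H (o : S) : o = 1 -> (o + K3) * (o + K3) = o + idem35 5 ->
    (1 + K3) * (1 + K3) = 1 + idem35 5 by move=> ->.
  exact: H (ev_one 5) (den_eq same_zz).
have t66 : t6 * t6 = 1 := etrans (sameP same_t66) (ev_one 7).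
have t6x6 : t6 * den 7 Gx6 = den 7 Gx7 * t6 + 1.
  exact: etrans (sameP same_t6x6) (f_equal2 +%R erefl (ev_one 7)).
have x5t5 : den 7 Gx5 * t5 = t5 * den 7 Gx6 + 1.
  exact: etrans (sameP same_x5t5) (f_equal2 +%R erefl (ev_one 7)).
have x5_nil : den 7 Gx5 * (den 7 Gx5 * (den 7 Gx5 * den 7 Ga)) = 0.
  exact: etrans (sameP same_x5_nil) (ev_nil 7).
have x67_pow : den 7 (right_mul Gx7 G1) + den 7 (right_mul Gx6 G1) = den 7 Ga + idem35 7.
  exact: (sameP same_x67_pow).
have {}x67_pow :
    den 7 Gx7 * (den 7 Gx7 * (den 7 Gx7 * (den 7 Gx7 * 1))) +
    den 7 Gx6 * (den 7 Gx6 * (den 7 Gx6 * (den 7 Gx6 * 1))) = den 7 Ga + idem35 7.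
  have H (o : R) : o = 1 ->
      den 7 Gx7 * (den 7 Gx7 * (den 7 Gx7 * (den 7 Gx7 * o))) +
      den 7 Gx6 * (den 7 Gx6 * (den 7 Gx6 * (den 7 Gx6 * o))) = den 7 Ga + idem35 7 ->
      den 7 Gx7 * (den 7 Gx7 * (den 7 Gx7 * (den 7 Gx7 * 1))) +
      den 7 Gx6 * (den 7 Gx6 * (den 7 Gx6 * (den 7 Gx6 * 1))) = den 7 Ga + idem35 7.
    by move=> ->.
  exact: H (ev_one 7) x67_pow.
have jE : den 7 Gj = 1 + k5.
  exact: etrans (sameP same_j) (f_equal2 +%R (ev_one 7) erefl).
have rho_w : res57 (ev 7 transfer_codes * (1 + t6) * idem35 7) = 1 + K3.
  have [wfw /eqP nw] := andP res_transfer.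
  have H (o : R) : o = 1 -> res57 (ev 7 transfer_codes * (o + t6) * idem35 7) = 1 + K3 ->
    res57 (ev 7 transfer_codes * (1 + t6) * idem35 7) = 1 + K3 by move=> ->.
  apply: (H _ (ev_one 7)).
  have -> : ev 7 transfer_codes * (ev 7 [:: iota 0 7] + t6) * idem35 7 =
    ev 7 (run Gtransfer) := denE wfw.
  apply: etrans (galg_res_ev (m := 5) (k := 2) (run_code wfw)) _.
  apply: etrans (norm2_eq 5 nw) _.
  by rewrite -(ev_one 5) -ev_cat.
apply: (@scopes_idempotentP R S iota57 iota57_1 (@addxx2 7) (1 + idem35 5)
  (1 + K3) (ev 5 (jucys_murphy 5 4)) (ev 5 [:: swap_code 5 3 4]) (idem35 7)
  (den 7 Gc) t5 t6 (den 7 Gx6) (den 7 Gx7) _ _ _ _ aE zE x5E iota57_t4 e erefl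
  bP.2 bP.1 aP.2 K3C aP.1 zz (commute57P comm_x6) (commute57P comm_x7)
  (commute57P comm_t6) (sameP same_x67) t66 t6x6 (sameP same_t5x7) x5t5
  (sameP same_braid) x5_nil (sameP same_x6_quad) (sameP same_x6_unip)
  (sameP same_x7_unip) x67_pow u _ erefl erefl k5 (den 7 Gj) k3 (ev 7 transfer_codes)
  res57 span57
  ideal_of_conj jE (sameP same_k3k3) erefl _ (commute57P comm_transfer) rho_w).
exact: galg_resM.
Qed.
End Degree57.

(** * Young modules and blocks *)

Section ScopesCorner.
Variables (R S : pzRingType) (iota : corner_morph R S) (rho : R -> S) (a : S) (b f : R).
Hypothesis iota1 : iota 1 = 1.
Hypothesis fP : scopes_idempotent iota rho a b f.
Hypothesis aP : central_idempotent a.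

Let ff := scopes_idemM fP.
Let fC := scopes_comm fP.

Fact scopes_morph_add : {morph (fun s => iota s * f) : s t / s + t}.
Proof. by move=> s t; rewrite corner_add mulrDl. Qed.
Fact scopes_morph_mul : {morph (fun s => iota s * f) : s t / s * t}.
Proof.
move=> s t; rewrite corner_mul -!mulrA; congr (_ * _).
by rewrite mulrA -fC -mulrA ff.
Qed.
Definition scopes_morph : corner_morph R S := CornerMorph scopes_morph_add scopes_morph_mul.
Local Notation theta := scopes_morph.

Lemma scopes_morphE s : theta s = iota s * f. Proof. by []. Qed.

Lemma scopes_morph1 : theta 1 = f.
Proof. by rewrite scopes_morphE iota1 mul1r. Qed.

Lemma scopes_morph_a s : theta (a * s) = theta s.
Proof. by rewrite !scopes_morphE corner_mul -mulrA fC mulrA (scopes_a fP) -fC. Qed.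

Lemma scopes_morph_onto r : exists s, theta 1 * r * theta 1 = theta s.
Proof. by rewrite scopes_morph1; apply: (scopes_onto fP). Qed.

Lemma scopes_morph_inj s : (forall s r, rho (iota s * r) = s * rho r) ->
  theta s = 0 -> rho 0 = 0 -> a * s = 0.
Proof.
move=> rhoM; have [t tC tf] := scopes_split fP; rewrite scopes_morphE => sf rho0.
by rewrite aP.2 -tf -rhoM mulrA tC -mulrA sf mulr0.
Qed.

Lemma b_scopes : b * theta 1 = theta 1.
Proof. by rewrite scopes_morph1 (scopes_b fP). Qed.

Lemma scopes_expand : exists n (u v : 'I_n -> R), \sum_i u i * theta 1 * v i = b.
Proof. by rewrite scopes_morph1; apply/ideal_of_ord/(scopes_ideal fP). Qed.

Lemma scopes_corner_val (M : lmodType R) (x : corner theta M) :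
  f *: corner_val x = corner_val x.
Proof. by have := corner_valE x; rewrite scopes_morph1. Qed.

(** As [f] commutes with [S], it acts on the restriction of [M] as an idempotent [S]-endomorphism
    with image [f M]. *)
Lemma retract_corner_iota (M : lmodType R) : retract (corner theta M) (corner iota M).
Proof.
have inP (x : M) : x \in @corner_pred R S iota M by rewrite inE iota1 scale1r.
pose i (x : corner theta M) : corner iota M := Corner (inP (corner_val x)).
pose p (y : corner iota M) : corner theta M := corner_proj theta (corner_val y).
have iP s x y : i (s *: x + y) = s *: i x + i y.
  by apply: val_inj; rewrite /= -scalerA scopes_corner_val.
have pP s x y : p (s *: x + y) = s *: p x + p y.
  apply: val_inj; rewrite /= scalerDr; congr (_ + _).
  by rewrite iota1 mul1r !scalerA -fC -mulrA ff.
exists (linear_of iP), (linear_of pP) => x; apply: val_inj.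
by rewrite /= iota1 mul1r scopes_corner_val.
Qed.

Lemma corner_a (M : lmodType R) (x : corner theta M) : a *: x = x.
Proof.
by apply: val_inj; rewrite /= (scopes_a fP) scopes_corner_val.
Qed.
End ScopesCorner.

(** The map z |-> f push(z) has the left inverse y |-> pull(t y): compressing t f to the base orbit
    acts by [rho (t * f) = a], the identity on [Z]. *)
Lemma young_induction (F : fieldType) (m k : nat) (mu : intpart m)
    (a : group_algebra F 'S_m) (b f : group_algebra F 'S_(m + k))
    (fP : scopes_idempotent (galg_map F (@sym_embedM m k)) (galg_res (@sym_embed m k)) a b f)
    (Z : lmodType (group_algebra F 'S_m)) :
  acts1 a Z -> retract Z (young_perm_module F mu) ->
  retract Z (corner (scopes_morph fP) (young_perm_module F (induced_intpart k mu))).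
Proof.
move=> Z1 [i [p ipK]]; set M := young_perm_module F (induced_intpart k mu).
pose emb := @sym_embed m k; pose iota := galg_map F (@sym_embedM m k).
have iota1 : iota 1 = 1 := galg_map1 F (@sym_embedM m k) (@sym_embed_inj m k).
have stab := base_coset_stab k mu; set X0 := base_coset k mu in stab.
have [t tC tf] := scopes_split fP.
pose push (y : young_perm_module F mu) : M := orbit_push emb X0 y.
pose pull (y : M) : young_perm_module F mu := orbit_pull emb (young_subgroup mu) X0 y.
have pushD y y' : push (y + y') = push y + push y' := orbit_pushD emb X0 y y'.
have pullD y y' : pull (y + y') = pull y + pull y' := orbit_pullD emb _ X0 y y'.
have pushZ s y : push (s *: y) = iota s *: push y := orbit_pushZ (@sym_embedM m k) stab s y.
have pullZ s y : pull (iota s *: y) = s *: pull y := orbit_pullZ (@sym_embedM m k) stab s y.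
pose i' z := corner_proj (scopes_morph fP) (push (i z)).
pose p' (y : corner (scopes_morph fP) M) := p (pull (t *: corner_val y)).
have f_idem : f * f = f := scopes_idemM fP.
have theta1 : scopes_morph fP 1 = f := scopes_morph1 iota1 fP.
have i'P s z z' : i' (s *: z + z') = s *: i' z + i' z'.
  apply: val_inj; rewrite /= -/(scopes_morph fP) linearP pushD pushZ scalerDr.
  congr (_ + _); rewrite -[iota 1 * f]/(scopes_morph fP 1) theta1 !scalerA -mulrA f_idem.
  by rewrite -(scopes_comm fP).
have p'P s y y' : p' (s *: y + y') = s *: p' y + p' y'.
  rewrite /p' corner_valD corner_valZ scalerDr pullD linearD /=; congr (_ + _).
  rewrite -linearZ /= -pullZ; congr (p (pull _)).
  rewrite -[galg_map_fun _ s]/(iota s) -scalerA (scopes_corner_val iota1) !scalerA.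
  by rewrite tC.
exists (linear_of i'P), (linear_of p'P) => z; rewrite /= /p' /i'.
rewrite [corner_val _]/(scopes_morph fP 1 *: push (i z)) theta1 scalerA.
have -> : pull ((t * f) *: push (i z)) = a *: i z.
  rewrite -tf; apply: (orbit_pull_scale (@sym_embedM m k) (@sym_embed_inj m k) stab).
  by move=> h C D; apply: base_coset_codom.
by rewrite linearZ /= ipK Z1.
Qed.

(** * Direct sums and their endomorphism rings *)

Section CornerOfSum.
Variables (R S : pzRingType) (theta : corner_morph R S).
Variables (I J : finType) (V : I -> lmodType R) (W : J -> lmodType S) (tau : J -> I).
Hypothesis tau_inj : injective tau.
Hypothesis tau_onto : forall i, exists j, i = tau j.
Hypothesis VW : forall j, mod_iso (corner theta (V (tau j))) (W j).

Lemma corner_dirsum : mod_iso (corner theta (dirsum V)) (dirsum W).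
Proof.
pose k j : {linear corner theta (V (tau j)) -> W j} := projT1 (cid (VW j)).
have k_bij j : bijective (k j) := projT2 (cid (VW j)).
have compP (x : corner theta (dirsum V)) i :
    (corner_val x : dirsum V) i \in @corner_pred R S theta (V i).
  rewrite inE -{2}(corner_valE x); apply/eqP/esym; exact: ffunE.
pose comp (x : corner theta (dirsum V)) i : corner theta (V i) := Corner (compP x i).
pose K (x : corner theta (dirsum V)) : dirsum W := [ffun j => k j (comp x (tau j))].
have compL s x y i : comp (s *: x + y) i = s *: comp x i + comp y i.
  apply: val_inj; rewrite /= [LHS]ffunE; congr (_ + _); exact: ffunE.
have KL s x y : K (s *: x + y) = s *: K x + K y.
  apply/ffunP => j; rewrite [LHS]ffunE compL linearP [RHS]ffunE; congr (_ + _).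
    by rewrite [RHS]ffunE; congr (_ *: _); rewrite ffunE.
  by rewrite ffunE.
exists (linear_of KL).
have K_inj : injective K.
  move=> x y /ffunP Kxy; apply/val_inj/ffunP => i; have [j ->] := tau_onto i.
  have := Kxy j; rewrite !ffunE => /(bij_inj (k_bij j)) /(congr1 (@corner_val _ _ _ _)).
  by [].
(* The summands depend on the index, so a component is found at an arbitrary [i] and transported
   along each equality [i = tau j]. *)
have lift (w : dirsum W) i : exists v : corner theta (V i), forall j (E : i = tau j),
    k j (eq_rect i (fun i => corner theta (V i)) v (tau j) E) = w j.
  have [j0 ->] := tau_onto i; have [k' _ k'K] := k_bij j0.
  exists (k' (w j0)) => j E; have jj := tau_inj E; subst j.
  by rewrite (eq_irrelevance E erefl) /= k'K.
pose v w i := projT1 (cid (lift w i)).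
have vP w j : k j (v w (tau j)) = w j := projT2 (cid (lift w (tau j))) j erefl.
pose X w : dirsum V := [ffun i => corner_val (v w i)].
have XP w : X w \in @corner_pred R S theta (dirsum V).
  rewrite inE; apply/eqP/ffunP => i; rewrite ffunE /X ffunE; exact: corner_valE.
have KX w : K (Corner (XP w)) = w.
  apply/ffunP => j; rewrite ffunE -[RHS]vP; congr (k j _).
  by apply: val_inj; rewrite /= ffunE.
by exists (fun w => Corner (XP w)) => // x; apply: K_inj; rewrite KX.
Qed.
End CornerOfSum.

Section SchurMorita.
Variables (R S : pzRingType) (theta : corner_morph R S) (e : R).
Hypothesis e_central : central_idempotent e.
Hypothesis e_theta : e * theta 1 = theta 1.
Hypothesis theta_onto : forall r, exists s, theta 1 * r * theta 1 = theta s.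
Variables (n : nat) (u v : 'I_n -> R).
Hypothesis uve : \sum_i u i * theta 1 * v i = e.
Variables (M : lmodType R) (N : lmodType S).
Hypothesis M1 : acts1 e M.
Hypothesis MN : mod_iso (corner theta M) N.

(** By fullness and faithfulness each endomorphism of [N] lifts to exactly one of [M], so the two
    rings are isomorphic; [corner_morita] then applies with the corner cut by 1 and a one-term
    expansion. *)
Lemma endo_corner_morita : morita_equivalent (endo N) (endo M).
Proof.
have [K [K' KK' K'K]] := MN; pose K'l := linear_of (cancel_linear KK' K'K).
have lift (h : endo N) : exists g : endo M,
    forall x : corner theta M, endo_fun g (corner_val x) = corner_val (K' (h (K x))).
  pose h' : {linear corner theta M -> corner theta M} := K'l \o ((h : {linear N -> N}) \o K).
  exact: (corner_full e_central e_theta theta_onto uve h' M1).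
pose L h := projT1 (cid (lift h)).
have LP h x : endo_fun (L h) (corner_val x) = corner_val (K' (h (K x))) :=
  projT2 (cid (lift h)) x.
have L_uniq (g : endo M) (h : endo N) : (forall x : corner theta M,
    endo_fun g (corner_val x) = corner_val (K' (h (K x)))) -> g = L h.
  move=> gP; apply: endoP; apply: (corner_faithful uve M1) => x.
  by rewrite [LHS]gP [RHS]LP.
have LD (g h : endo N) : L (g + h) = L g + L h.
  apply/esym/L_uniq => x.
  apply: (etrans (f_equal2 +%R (LP g x) (LP h x))).
  by rewrite -[RHS]/(corner_val (K'l (g (K x) + h (K x)))) linearD.
have LM (g h : endo N) : L (g * h) = L g * L h.
  apply/esym/L_uniq => x.
  apply: (etrans (congr1 (endo_fun (L g)) (LP h x))).
  by apply: (etrans (LP g _)); rewrite K'K.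
have L1 : L 1 = 1.
  by apply/esym/L_uniq => x; apply: (congr1 (@corner_val _ _ _ _)); apply/esym/KK'.
pose Lm := @CornerMorph (endo M) (endo N) L LD LM; have Lm1 : Lm 1 = 1 := L1.
apply: (@corner_morita (endo M) (endo N) Lm _ _ 1 (fun=> 1) (fun=> 1)).
- move=> g h gh; apply: endoP => y.
  have gh' : K' (g (K (K' y))) = K' (h (K (K' y))).
    apply: val_inj; rewrite /= -!LP.
    exact: (congr1 (fun r : endo M => endo_fun r (corner_val (K' y))) gh).
  by have := congr1 K gh'; rewrite !K'K.
- move=> r; pose s : endo N := K \o (corner_map theta (r : {linear M -> M}) \o K'l).
  exists s; rewrite Lm1 mul1r mulr1; apply: L_uniq => x /=.
  by rewrite !KK'.
- by rewrite big_ord1 Lm1 !mulr1.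
Qed.
End SchurMorita.

Section BlockMorita.
Variables (R S : pzRingType) (iota : corner_morph R S) (rho : R -> S).
Variables (B : block S) (C : block R) (f : R).
Hypothesis rho0 : rho 0 = 0.
Hypothesis rhoM : forall s r, rho (iota s * r) = s * rho r.
Hypothesis fP : scopes_idempotent iota rho (block_idem B) (block_idem C) f.
Local Notation theta := (scopes_morph fP).

Fact block_morph_in (s : block_algebra B) : theta (block_val s) \in block_ideal C.
Proof.
by rewrite inE scopes_morphE mulrA (block_central_idem C).2 -mulrA (scopes_b fP).
Qed.
Definition block_morph_fun s := BlockElt (block_morph_in s).

Fact block_morph_add : {morph block_morph_fun : s t / s + t}.
Proof. by move=> s t; apply: val_inj; apply: corner_add. Qed.
Fact block_morph_mul : {morph block_morph_fun : s t / s * t}.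
Proof. by move=> s t; apply: val_inj; apply: corner_mul. Qed.
Definition block_morph : corner_morph (block_algebra C) (block_algebra B) :=
  CornerMorph block_morph_add block_morph_mul.

Theorem block_morita : morita_equivalent (block_algebra B) (block_algebra C).
Proof.
have [n [u [v uv]]] := ideal_of_ord (scopes_ideal fP).
(* Cutting the factors u_i, v_i by the block idempotent brings them into the block algebra, where
   their sum becomes the unit. *)
have cutP r : block_idem C * r \in block_ideal C.
  by rewrite inE mulrA (block_central_idem C).1.
pose cut r : block_algebra C := BlockElt (cutP r).
apply: (@corner_morita (block_algebra C) (block_algebra B) block_morph _ _ n
  (fun i => cut (u i)) (fun i => cut (v i))).
- move=> s t st; apply: val_inj; apply/eqP; rewrite /= -subr_eq0; apply/eqP.
  rewrite -[LHS]/(block_val (s - t)) -(eqP (block_valP (s - t))).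
  apply: (scopes_morph_inj (fP := fP) (block_central_idem B) rhoM _ rho0).
  have D : block_morph (s - t) + block_morph t = block_morph t.
    by rewrite -corner_add subrK.
  have /(congr1 (@block_val _ _)) : block_morph (s - t) = 0.
    by apply: (addIr (block_morph t)); rewrite D add0r.
  by [].
- move=> r; have [s sE] := scopes_onto fP (block_val r).
  have sP : block_idem B * s \in block_ideal B.
    by rewrite inE mulrA (block_central_idem B).1.
  exists (BlockElt sP); apply: val_inj; rewrite /= (scopes_a fP).
  rewrite -[RHS]/(scopes_morph fP (block_idem B * s)) scopes_morph_a.
  by rewrite scopes_morphE -sE.
- apply: val_inj; rewrite /= -[RHS](block_central_idem C).1 -{2}uv.
  have block_sum (I : Type) (q : seq I) (F : I -> block_algebra C) :
      block_val (\sum_(i <- q) F i) = \sum_(i <- q) block_val (F i).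
    exact: (big_morph (@block_val _ C) (fun _ _ => erefl) erefl).
  rewrite block_sum mulr_sumr; apply: eq_bigr => i _.
  rewrite /= (scopes_a fP) !mulrA; congr (_ * _).
  rewrite -(mulrA _ f) -(block_central_idem C).2 !mulrA.
  by rewrite -(mulrA _ (block_idem C) f) (scopes_b fP).
Qed.
End BlockMorita.

(** * The block idempotents in degrees 5 and 7 *)

Section Augmentation.
Variable n : nat.
Local Notation A := (group_algebra 'F_2 'S_n).

Lemma augmentationD (a b : A) : augmentation (a + b) = augmentation a + augmentation b.
Proof. by rewrite -big_split; apply: eq_bigr => g _; rewrite ffunE. Qed.

Lemma augmentation_gmono g : augmentation (gmono (1 : 'F_2) g : A) = 1.
Proof.
rewrite /augmentation (bigD1 g) //= gmonoE eqxx big1 ?addr0 // => h /negbTE hg.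
by rewrite gmonoE hg.
Qed.

Lemma augmentation_ev l : augmentation (ev n l) = (odd (size l))%:R.
Proof.
elim: l => [|p l IHl].
  by rewrite ev_nil /augmentation big1 // => g _; rewrite ffunE.
rewrite /ev big_cons augmentationD augmentation_gmono -/(ev n l) IHl /=.
by case: (odd (size l)); rewrite ?addr0 //; apply/eqP.
Qed.

Lemma augmentation1 : augmentation (1 : A) = 1.
Proof. by rewrite -gmono1 augmentation_gmono. Qed.
End Augmentation.

Lemma augmentation_idem35 n : odd (size (cycles3 n) + size (cycles5 n)) = false ->
  augmentation (idem35 n) = 0.
Proof.
rewrite /idem35 augmentationD !augmentation_ev oddD.
by case: (odd _); case: (odd _) => // _; apply/eqP.
Qed.

Lemma odd_cycles5 : odd (size (cycles3 5) + size (cycles5 5)) = false.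
Proof. by vm_compute. Qed.
Lemma odd_cycles7 : odd (size (cycles3 7) + size (cycles5 7)) = false.
Proof. by vm_compute. Qed.

Lemma idem35_neq0 n p : is_code n p -> is_cycle35 p -> idem35 n <> 0.
Proof.
case/is_codeP => g -> gP /ffunP/(_ g); rewrite idem35E ev_filter gP => /eqP.
by rewrite ffunE oner_eq0.
Qed.

Local Notation K3 := (GLit (cycles3 5)).
Local Notation K35 := (GAdd K3 (GLit (cycles5 5))).

Lemma idem35_sq :
  [&& wf 5 (GMul K3 K3), wf 5 K35 & norm2 (run (GMul K3 K3) ++ run K35) == [::]].
Proof. by vm_compute. Qed.

Lemma idem35_idem :
  [&& wf 5 (GMul K35 K35), wf 5 K35 & norm2 (run (GMul K35 K35) ++ run K35) == [::]].
Proof. by vm_compute. Qed.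

Local Opaque ev cycles3 cycles5 all_codes.

(** The element is the square of the sum of the 3-cycles, so its centrality follows from that of the
    latter. *)
Lemma central_idem35_5 : central_idempotent (idem35 5).
Proof.
split; first exact: den_eq idem35_idem.
have [K3P K3A] := andP comm_K3; have K3C := commute_codes K3P K3A.
have -> : idem35 5 = ev 5 (cycles3 5) * ev 5 (cycles3 5) := esym (den_eq idem35_sq).
by move=> x; rewrite -mulrA K3C !mulrA K3C.
Qed.

Lemma central_idempotentC n (e : group_algebra 'F_2 'S_n) :
  central_idempotent e -> central_idempotent (1 + e).
Proof.
case=> ee eC; split=> [|x]; last by rewrite mulrDl mulrDr mul1r mulr1 eC.
by rewrite mulrDl mul1r mulrDr mulr1 ee addxx2 addr0.
Qed.

(** Of the four central idempotents, 0 is excluded, 1 splits as [idem35 5] plus its complement, and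
    [idem35 5] has augmentation 0. *)
Lemma block_idem5 (B : block (group_algebra 'F_2 'S_5)) :
  principal_block B -> block_idem B = 1 + idem35 5.
Proof.
move/(principal_augmentation B) => aug1; have aug0 := augmentation_idem35 odd_cycles5.
have ideC := central_idempotentC central_idem35_5.
have augE : augmentation (1 + idem35 5) = 1 by rewrite augmentationD augmentation1 aug0 addr0.
case: (central_idempotent5 (block_central_idem B)) => // BE.
- by case: (block_neq0 BE).
- have [] := @block_primitive _ B _ _ central_idem35_5 ideC.
  + by rewrite mulrDr mulr1 central_idem35_5.1 addxx2.
  + by rewrite BE addrCA addxx2 addr0.
  + have c3P : is_code 5 [:: 1; 2; 0; 3; 4]%N by [].
    by move=> z; case: (idem35_neq0 c3P isT z).
  + move=> z; move: augE; rewrite z /augmentation big1 => [/eqP|g _]; last by rewrite ffunE.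
    by rewrite eq_sym oner_eq0.
- by move: aug1; rewrite BE aug0 => /eqP; rewrite eq_sym oner_eq0.
Qed.

(** Both 1 and [1 + idem35 7] have augmentation 1, and a block with such an idempotent is
    principal. *)
Lemma block_idem7 (B : block (group_algebra 'F_2 'S_7)) :
  ~ principal_block B -> block_idem B = idem35 7.
Proof.
move=> nprB; have aug0 := augmentation_idem35 odd_cycles7.
case: (central_idempotent7 (block_central_idem B)) => // BE.
- by case: (block_neq0 BE).
- by case: nprB; apply/principal_augmentation; rewrite BE augmentation1.
- case: nprB; apply/principal_augmentation.
  by rewrite BE augmentationD augmentation1 aug0 addr0.
Qed.

Lemma block_scopes (B5 : block (group_algebra 'F_2 'S_5))
    (B7 : block (group_algebra 'F_2 'S_7)) :
    principal_block B5 -> ~ principal_block B7 ->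
  exists f, scopes_idempotent iota57 res57 (block_idem B5) (block_idem B7) f.
Proof.
move=> /block_idem5 b5 /block_idem7 b7.
have c5 := block_central_idem B5; have c7 := block_central_idem B7.
(* That [idem35 7] is a central idempotent is inherited from the given block [B7]. *)
rewrite b5 in c5 *; rewrite b7 in c7 *; exact: scopes57.
Qed.

(** * Matching the Young modules of the two blocks *)

Section SchurBlocks.
Variables (F : finFieldType) (m k : nat).
Local Notation S := (group_algebra F 'S_m).
Local Notation R := (group_algebra F 'S_(m + k)).
Local Notation iota := (galg_map F (@sym_embedM m k)).

Lemma fin_young_perm_module n (la : intpart n) : fin_mod (young_perm_module F la).
Proof.
exists (enum {ffun coset_space (young_subgroup la) -> F}) => x.
exact: mem_enum.
Qed.

Lemma fin_corner (T U : pzRingType) (theta : corner_morph T U) (M : lmodType T) :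
  fin_mod M -> fin_mod (corner theta M).
Proof.
case=> s sP; exists [seq corner_proj theta x | x <- s] => x.
apply/mapP; exists (corner_val x); first exact: sP.
by rewrite corner_valK.
Qed.

Lemma young_retract n (Y : intpart n -> lmodType (group_algebra F 'S_n)) la :
  young_modules Y -> retract (Y la) (young_perm_module F la).
Proof.
case=> _ _ /(_ la) [N [MN _]] _; apply: summand_retract; by exists N.
Qed.

Lemma retract_young n (Y : intpart n -> lmodType (group_algebra F 'S_n)) la
    (X : lmodType (group_algebra F 'S_n)) :
  young_modules Y -> indecomposable X -> retract X (young_perm_module F la) ->
  exists mu, mod_iso X (Y mu).
Proof.
case=> _ _ _ Ydec indX /retract_summand XM.
by have [mu _ XY] := Ydec _ _ indX XM; exists mu.
Qed.

Lemma acts1_iso (T : pzRingType) (e : T) (X Z : lmodType T) :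
  mod_iso X Z -> acts1 e X -> acts1 e Z.
Proof. by case=> g [h _ hK] X1 z; rewrite -(hK z) -linearZ X1. Qed.

Variables (Y : intpart m -> lmodType S) (Y' : intpart (m + k) -> lmodType R).
Hypotheses (YP : young_modules Y) (Y'P : young_modules Y').
Variables (B : block S) (C : block R) (f : R).
Hypothesis fP :
  scopes_idempotent iota (galg_res (@sym_embed m k)) (block_idem B) (block_idem C) f.

Theorem schur_block_morita : morita_equivalent (schur_block Y B) (schur_block Y' C).
Proof.
have iota1 : iota 1 = 1 := galg_map1 F (@sym_embedM m k) (@sym_embed_inj m k).
pose theta := scopes_morph fP.
have theta_onto := scopes_morph_onto iota1 fP.
have [n [u [v uve]]] := scopes_expand iota1 fP.
have C_theta := b_scopes iota1 fP.
have C_central := block_central_idem C.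
have [Y_indec Y_inj _ _] := YP; have [Y'_indec Y'_inj _ _] := Y'P.
have in_B (j : block_index Y B) : acts1 (block_idem B) (Y (val j)) := asboolW (valP j).
have in_C (i : block_index Y' C) : acts1 (block_idem C) (Y' (val i)) := asboolW (valP i).
have restriction (i : block_index Y' C) : exists j : block_index Y B,
    mod_iso (corner theta (Y' (val i))) (Y (val j)).
  pose X := corner theta (Y' (val i)).
  have indX : indecomposable X :=
    indec_corner C_central C_theta theta_onto uve (in_C i) (Y'_indec _).
  have finX : fin_mod X.
    by apply/fin_corner/(fin_mod_retract (young_retract _ Y'P))/fin_young_perm_module.
  have RX : retract X (corner iota (young_perm_module F (val i))).
    apply: retract_trans (retract_corner_iota iota1 fP _) _.
    exact/retract_corner/young_retract.
  have [nu Xnu] := young_restriction finX indX RX.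
  have [mu Xmu] := retract_young YP indX Xnu.
  (* The idempotent of [B] fixes [f], hence acts as 1 on every corner. *)
  have mu_B : `[< in_block B (Y mu) >].
    by apply/asboolP/(acts1_iso Xmu) => x; apply: corner_a.
  by exists (exist _ mu mu_B).
have induction (j : block_index Y B) : exists i : block_index Y' C,
    mod_iso (corner theta (Y' (val i))) (Y (val j)).
  have indZ := Y_indec (val j).
  have finZ := fin_mod_retract (young_retract (val j) YP) (@fin_young_perm_module _ _).
  have := young_induction fP (in_B j) (young_retract _ YP).
  case/(corner_retract_indec (@fin_young_perm_module _ _) finZ indZ) => X [indX XM ZX].
  have nzX : ~ mod_zero (corner theta X).
    case: ZX => g [h ghK] z; case: indZ.1 => y.
    by rewrite -(ghK y) (z (g y)) linear0.
  have X1 := indec_acts1 C_central C_theta indX nzX.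
  have [mu Xmu] := retract_young Y'P indX XM.
  have mu_C : `[< in_block C (Y' mu) >] by apply/asboolP/(acts1_iso Xmu).
  exists (exist _ mu mu_C); apply: iso_sym; apply: iso_trans (iso_corner theta Xmu).
  (* The corner of [X] is itself indecomposable, so its nonzero retract is all of it. *)
  apply: retract_indec_iso ZX; last exact: indZ.1.
  exact: (indec_corner C_central C_theta theta_onto uve X1 indX).
pose tau j := projT1 (cid (induction j)).
have tauP j : mod_iso (corner theta (Y' (val (tau j)))) (Y (val j)) :=
  projT2 (cid (induction j)).
have tau_inj : injective tau.
  move=> j j' jj'; apply/val_inj/Y_inj; apply: iso_trans (tauP j').
  by apply: iso_sym; rewrite -jj'; apply: tauP.
have tau_onto i : exists j, i = tau j.
  have [j ij] := restriction i; exists j; apply/val_inj/Y'_inj.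
  apply: (corner_iso_inj C_central C_theta theta_onto uve) => //.
  exact: iso_trans ij (iso_sym (tauP j)).
apply: (endo_corner_morita C_central C_theta theta_onto uve).
  by move=> w; apply/ffunP => i; rewrite [LHS]ffunE; apply: in_C.
exact: (corner_dirsum (V := fun i : block_index Y' C => Y' (val i)) tau_inj tau_onto tauP).
Qed.
End SchurBlocks.

Lemma res57_0 : res57 0 = 0.
Proof. by apply/ffunP => g; rewrite !ffunE. Qed.

Theorem corollary1p1
    (Y5 : intpart 5 -> lmodType (group_algebra 'F_2 'S_5))
    (Y7 : intpart 7 -> lmodType (group_algebra 'F_2 'S_7))
    (hY5 : young_modules Y5) (hY7 : young_modules Y7)
    (B5 : block (group_algebra 'F_2 'S_5))
    (B7 : block (group_algebra 'F_2 'S_7))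
    (hB5 : principal_block B5)
    (hB7 : ~ principal_block B7) (hw7 : block_weight2 Y7 B7 2) :
  morita_equivalent (block_algebra B5) (block_algebra B7) /\
  morita_equivalent (schur_block Y5 B5) (schur_block Y7 B7).
Proof.
have [f fP] := block_scopes hB5 hB7; split.
  apply: (@block_morita _ _ iota57 res57 B5 B7 f res57_0 _ fP).
  exact: galg_resM.
exact: (@schur_block_morita 'F_2 5 2 Y5 Y7 hY5 hY7 B5 B7 f fP).
Qed.
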